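(* Let $d\ge3$, $1\le p,\theta\le\infty$ and $s>1/p$. For $\boldsymbol\alpha=(\alpha_1,\dots,\alpha_{d-1})\in\mathbb R^{d-1}$ and $N\in\mathbb N$ let $$\mathcal P_N(\boldsymbol\alpha)=\Bigl\{\Bigl(\frac nN,\{n\alpha_1\},\dots,\{n\alpha_{d-1}\}\Bigr):n=0,1,\dots,N-1\Bigr\}.$$ Let $\psi:\mathbb N\to(0,\infty)$ be non-decreasing with $\sum_{n\ge1}\frac1{n\psi(n)}<\infty$. Then for (Lebesgue-)almost every $\boldsymbol\alpha\in\mathbb R^{d-1}$ there is a constant $C<\infty$, independent of $N$, such that for every integer $N\ge2$ $$\mathrm{wce}\bigl(\mathcal P_N(\boldsymbol\alpha),\mathring{\mathbf B}^s_{p,\theta}\bigr)\;\le\; C\,\frac{(\log N)^{(d-1)(1-1/\theta)}}{N^s}\,\psi(N)^{s(d-1)}.$$ For example, for every $\delta>0$ and almost every $\boldsymbol\alpha\in\mathbb R^{d-1}$ there is a constant $C<\infty$, independent of $N$, such that for every integer $N\ge3$ $$\mathrm{wce}\bigl(\mathcal P_N(\boldsymbol\alpha),\mathring{\mathbf B}^s_{p,\theta}\bigr)\;\le\; C\,\frac{(\log N)^{(d-1)(s+1-1/\theta)}}{N^s}\,(\log\log N)^{s(d-1)(1+\delta)}.$$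
   Context: Conventions: $\mathbb N=\{1,2,\dots\}$; $\log$ is the logarithm to base $2$; $1/\infty:=0$; $\{x\}$ is the fractional part of $x$. Function space: for $f\in L_1(\mathbb R^d)$ let $\mathcal F f(\boldsymbol\xi)=\int_{\mathbb R^d}f(\boldsymbol y)e^{-2\pi \mathrm i\langle\boldsymbol\xi,\boldsymbol y\rangle}\,d\boldsymbol y$, extended to tempered distributions as usual. Let $\Psi_0\in C_0^\infty(\mathbb R)$ be the up-function, i.e. the function with support $[-1,1]$ and $\mathcal F\Psi_0(\xi)=\prod_{k=0}^\infty \mathrm{sinc}(2^{-k}\xi)$, $\mathrm{sinc}(\xi)=\sin(\pi\xi)/(\pi\xi)$. Fix a non-negative integer $L$ with $L+1>s$, and put $\Psi_1(x)=\frac{d^L}{dx^L}\bigl(2\Psi_0(2\,\cdot)-\Psi_0\bigr)(x)$, $\Psi_j(x)=2^{j-1}\Psi_1(2^{j-1}x)$ for $j\ge1$, and $\Psi_{\boldsymbol m}(\boldsymbol x)=\prod_{i=1}^d\Psi_{m_i}(x_i)$ for $\boldsymbol m\in\mathbb N_0^d$. The Besov space of dominating mixed smoothness $\mathbf B^s_{p,\theta}(\mathbb R^d)$ is the set of tempered distributions $f$ on $\mathbb R^d$ with $$\|f\|_{\mathbf B^s_{p,\theta}}=\Bigl(\sum_{\boldsymbol m\in\mathbb N_0^d}2^{s|\boldsymbol m|_1\theta}\|\Psi_{\boldsymbol m}*f\|_{L_p(\mathbb R^d)}^\theta\Bigr)^{1/\theta}<\infty$$ (supremum over $\boldsymbol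 m$ if $\theta=\infty$), where $|\boldsymbol m|_1=m_1+\dots+m_d$. Put $\mathring{\mathbf B}^s_{p,\theta}=\{f\in\mathbf B^s_{p,\theta}(\mathbb R^d):\mathrm{supp}(f)\subset[0,1]^d\}$ with the same norm. Since $s>1/p$, these functions are continuous. Worst-case error of a point set $\mathcal P=\{\boldsymbol x_0,\dots,\boldsymbol x_{N-1}\}\subset[0,1)^d$: $\mathrm{wce}(\mathcal P,\mathring{\mathbf B}^s_{p,\theta})=\sup\bigl\{\bigl|\int_{[0,1]^d}f(\boldsymbol x)\,d\boldsymbol x-\frac1N\sum_{n=0}^{N-1}f(\boldsymbol x_n)\bigr|: f\in\mathring{\mathbf B}^s_{p,\theta},\ \|f\|_{\mathbf B^s_{p,\theta}}\le1\bigr\}$. *)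

(* Defs.v *)
From HB Require Import structures.
From mathcomp Require Import all_boot all_order all_algebra.
From mathcomp Require Import all_classical all_reals all_analysis.
From mathcomp Require Import complex.

Set Implicit Arguments.
Unset Strict Implicit.
Unset Printing Implicit Defensive.

Import Order.TTheory GRing.Theory Num.Theory.
Import numFieldNormedType.Exports.
Local Open Scope classical_set_scope.
Local Open Scope ring_scope.
Local Open Scope complex_scope.
Import Normc.

(* Lebesgue measure on R^n, as a sigma-finite measure on 'rV[R]_n.  The
   sigma-algebra is generated by the coordinates (the Borel sets); Lebesgue-null
   sets are the `negligible` sets of this measure. *)

Definition measure_rV_display : measure_display -> measure_display.
Proof. exact. Qed.

Section measurable_rV.
Context (R : realType) (n : nat).

Definition rV_coord (i : 'I_n) (x : 'rV[R]_n) : measurableTypeR R := x ord0 i.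

Let rV_set0 : g_sigma_preimage rV_coord set0.
Proof. exact: sigma_algebra0. Qed.

Let rV_setC A : g_sigma_preimage rV_coord A -> g_sigma_preimage rV_coord (~` A).
Proof. exact: sigma_algebraC. Qed.

Let rV_bigcup (F : (set 'rV[R]_n)^nat) :
  (forall i, g_sigma_preimage rV_coord (F i)) ->
  g_sigma_preimage rV_coord (\bigcup_i (F i)).
Proof. exact: sigma_algebra_bigcup. Qed.

HB.instance Definition _ := @isMeasurable.Build
  (measure_rV_display (R.-ocitv.-measurable).-sigma)
  'rV[R]_n (g_sigma_preimage rV_coord) rV_set0 rV_setC rV_bigcup.

Lemma measurable_rV_coord (i : 'I_n) :
  measurable_fun [set: 'rV[R]_n] (rV_coord i).
Proof.
move=> _ Y mY; rewrite setTI; apply: sub_sigma_algebra => /=.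
rewrite -bigcup_seq/=; exists i => /=; first by rewrite mem_index_enum.
by exists Y => //; rewrite setTI.
Qed.
End measurable_rV.

Lemma measurable_fun_rVP d (T : measurableType d) (R : realType) n
    (f : T -> 'rV[R]_n) :
  measurable_fun [set: T] f <->
  forall i, measurable_fun [set: T] (rV_coord i \o f).
Proof.
apply: (@iff_trans _ (g_sigma_preimage
    (fun i => @rV_coord R n i \o f) `<=` measurable)).
  rewrite g_sigma_preimage_comp; split=> [mf A [/= C preC <-]|prefS].
    exact: mf.
  by move=> _ A mA; apply: prefS; exists A.
split=> [fS i|mf].
- move=> _ A mA.
  apply: fS; apply: sub_sigma_algebra.
  case: n i => [[] []//|n i] in f *.
  rewrite -bigcup_mkord_ord.
  exists i; first exact: ltn_ord.
  by exists A => //; rewrite inord_val.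
- apply: smallest_sub; first exact: sigma_algebra_measurable.
  case: n => [|n] in f mf *; first by rewrite big_ord0.
  rewrite -bigcup_mkord_ord; apply: bigcup_sub => i Ii.
  by move=> A [B mB <-]; exact: mf.
Qed.


(* Stated separately because `m1 \x m2` has no canonical sigma-finite structure
   for general sigma-finite m1 and m2. *)
Section pushforward_prod.
Context d1 d2 d3 (T1 : measurableType d1) (T2 : measurableType d2)
  (T3 : measurableType d3) (R : realType).
Variables (m1 : {sigma_finite_measure set T1 -> \bar R})
  (m2 : {sigma_finite_measure set T2 -> \bar R}) (f : T1 * T2 -> T3).
Variable g : T3 -> T1 * T2.
Hypotheses (mf : measurable_fun setT f) (mg : measurable_fun setT g)
  (fK : cancel f g).

Let pm : set T3 -> \bar R := pushforward (m1 \x m2)%E f.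

Let pm0 : pm set0 = 0%E.
Proof. by rewrite /pm /pushforward preimage_set0 measure0. Qed.

Let pm_ge0 A : (0 <= pm A)%E.
Proof. exact: measure_ge0. Qed.

Let pm_sigma_additive : semi_sigma_additive pm.
Proof.
exact: (@measure_semi_sigma_additive _ _ _ (pushforward (m1 \x m2)%E f)).
Qed.

HB.instance Definition _ := isMeasure.Build _ _ _ pm
  pm0 pm_ge0 pm_sigma_additive.

Let pm_sigma_finite : sigma_finite setT pm.
Proof.
have /sigma_finiteP[F [TF ndF Foo]] := sigma_finiteT m1.
have /sigma_finiteP[G [TG ndG Goo]] := sigma_finiteT m2.
exists (fun n => g @^-1` (F n `*` G n)).
  rewrite -preimage_bigcup; apply/seteqP; split=> // z _ /=.
  have [k _ Fk] : (\bigcup_k F k) (g z).1 by rewrite -TF.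
  have [l _ Gl] : (\bigcup_k G k) (g z).2 by rewrite -TG.
  exists (maxn k l) => //; split.
    by move: Fk; exact/subsetPset/ndF/leq_maxl.
  by move: Gl; exact/subsetPset/ndG/leq_maxr.
move=> n; have [mF Fn] := Foo n; have [mG Gn] := Goo n.
have mFG : measurable (F n `*` G n) by exact: measurableX.
split.
  by rewrite -[X in measurable X]setTI; exact: mg.
rewrite /pm /pushforward -comp_preimage (_ : g \o f = id) ?preimage_id//.
  by rewrite product_measure1E// lte_mul_pinfty// ge0_fin_numE.
by apply/funext => x /=; rewrite fK.
Qed.

HB.instance Definition _ := @Measure_isSigmaFinite.Build _ _ _ pm
  pm_sigma_finite.

Lemma pushforward_prod_sigma_finite :
  exists mu : {sigma_finite_measure set T3 -> \bar R},
    pushforward (m1 \x m2)%E f = mu.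
Proof. by exists pm. Qed.

End pushforward_prod.
Section lebesgue_rV.
Context {R : realType}.

Definition rV_cons n (p : measurableTypeR R * 'rV[R]_n) : 'rV[R]_n.+1 :=
  row_mx (p.1%:M : 'rV_1) p.2.

Fixpoint lebesgue_rV n : set 'rV[R]_n -> \bar R :=
  if n is n'.+1 then
    pushforward (@lebesgue_measure R \x @lebesgue_rV n')%E (@rV_cons n')
  else \d_(0 : 'rV[R]_0).

Lemma measurable_rV_cons n : measurable_fun setT (@rV_cons n).
Proof.
apply/measurable_fun_rVP => i.
have [j ->|j ->] := split_ordP (i : 'I_(1 + n)).
  rewrite (_ : _ \o _ = fst)//; apply/funext => -[x y] /=.
  by rewrite /rV_coord /rV_cons (@row_mxEl _ 1 1 n) mxE /= !ord1.
rewrite (_ : _ \o _ = rV_coord j \o snd).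
  by apply: measurableT_comp => //; exact: measurable_rV_coord.
by apply/funext => -[x y] /=; rewrite /rV_coord /rV_cons (@row_mxEr _ 1 1 n).
Qed.

Lemma lebesgue_rV_measure n :
  exists mu : {sigma_finite_measure set 'rV[R]_n -> \bar R}, 
  @lebesgue_rV n = mu.
Proof.
elim: n => [|n [mu IH]] /=.
  by exists (\d_(0 : 'rV[R]_0)).
rewrite IH.
pose g (x : 'rV[R]_n.+1) : measurableTypeR R * 'rV[R]_n :=
  (rV_coord ord0 x, \row_i rV_coord (lift ord0 i) x).
apply: (pushforward_prod_sigma_finite (@lebesgue_measure R) mu (g := g)).
- exact: measurable_rV_cons.
- apply: measurable_fun_pair; first exact: measurable_rV_coord.
  apply/measurable_fun_rVP => i; rewrite (_ : _ \o _ = rV_coord (lift ord0 i)).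
    exact: measurable_rV_coord.
  by apply/funext => x /=; rewrite /rV_coord mxE.
- move=> [x y]; congr pair.
    rewrite /rV_coord /rV_cons (_ : ord0 = lshift n ord0 :> 'I_(1 + n)).
      by rewrite (@row_mxEl _ 1 1 n) mxE.
    exact/val_inj.
  apply/rowP => i; rewrite mxE /rV_coord /rV_cons.
  rewrite (_ : lift ord0 i = rshift 1 i :> 'I_(1 + n)).
    by rewrite (@row_mxEr _ 1 1 n) ord1.
  exact/val_inj.
Qed.

Section instance.
Variable n : nat.
Let mu := projT1 (cid (lebesgue_rV_measure n)).
Let muE : @lebesgue_rV n = mu := projT2 (cid (lebesgue_rV_measure n)).

Let lebesgue_rV0 : @lebesgue_rV n set0 = 0%E.
Proof. by rewrite muE. Qed.

Let lebesgue_rV_ge0 A : (0 <= @lebesgue_rV n A)%E.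
Proof. by rewrite muE. Qed.

Let lebesgue_rV_sigma_additive : semi_sigma_additive (@lebesgue_rV n).
Proof. by rewrite muE; exact: measure_semi_sigma_additive. Qed.

HB.instance Definition _ := isMeasure.Build _ _ _ (@lebesgue_rV n)
  lebesgue_rV0 lebesgue_rV_ge0 lebesgue_rV_sigma_additive.

Let lebesgue_rV_sigma_finite : sigma_finite setT (@lebesgue_rV n).
Proof. by rewrite muE; exact: sigma_finiteT. Qed.

HB.instance Definition _ := @Measure_isSigmaFinite.Build _ _ _ (@lebesgue_rV n)
  lebesgue_rV_sigma_finite.
End instance.
End lebesgue_rV.
Arguments lebesgue_rV R n : clear implicits.

Section complex_valued.
Context {R : realType}.

Definition Cintegral d (T : measurableType d) (mu : {measure set T -> \bar R})
    (D : set T) (f : T -> R[i]) : R[i] :=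
  (\int[mu]_(x in D) complex.Re (f x)) +i* (\int[mu]_(x in D) complex.Im (f x)).

Definition expi (t : R) : R[i] := cos t +i* sin t.

Definition fourier (f : R -> R[i]) (xi : R) : R[i] :=
  Cintegral (@lebesgue_measure R) setT
    (fun y => f y * expi (- (2 * pi * xi * y))).

End complex_valued.

Section up_function.
Context {R : realType}.

Definition sinc (x : R) : R := if x == 0 then 1 else sin (pi * x) / (pi * x).

(* These conditions determine Psi0 uniquely; the up-function exists, but is not
   in the library, so it is a parameter of what follows. *)
Record is_up_function (Psi0 : R -> R) : Prop := IsUpFunction {
  up_smooth : forall n x, derivable (derive1n n Psi0) x 1 ;
  up_support : closure [set x | Psi0 x != 0] = `[- 1, 1]%classic ;
  up_fourier : forall xi, exists2 l : R,
    \prod_(k < n) sinc (2 ^- k * xi) @[n --> \oo] --> l &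
    fourier (fun y => (Psi0 y)%:C) xi = l%:C }.

Variables (L : nat) (Psi0 : R -> R).

(* local_mean j is Psi_j, and local_mean1 is the L-th derivative defining Psi_1;
   no smoothness relation between L and s is built in here. *)
Definition local_mean1 : R -> R :=
  derive1n L (fun x => 2 * Psi0 (2 * x) - Psi0 x).

Definition local_mean (j : nat) : R -> R :=
  if j is j'.+1 then fun x => 2 ^+ j' * local_mean1 (2 ^+ j' * x) else Psi0.

Definition tensor_mean d (m : {ffun 'I_d -> nat}) (x : 'rV[R]_d) : R :=
  \prod_(i < d) local_mean (m i) (x ord0 i).

End up_function.

Section tempered_distributions.
Context {R : realType} {d : nat}.
Local Notation Rd := 'rV[R]_d.
Implicit Types (phi : Rd -> R[i]) (T : (Rd -> R[i]) -> R[i]).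

(* \partial_{i_1} ... \partial_{i_r} f for the list l = [:: i_1; ...; i_r]. *)
Definition partials (l : seq 'I_d) (f : Rd -> R) : Rd -> R :=
  foldr (fun i g x => 'D_(delta_mx ord0 i : Rd) g x) f l.

Definition smooth (f : Rd -> R) : Prop := forall l,
  continuous (partials l f) /\
  forall i x, derivable (partials l f) x (delta_mx ord0 i : Rd).

Definition Cpartials l phi (x : Rd) : R[i] :=
  partials l (fun y => complex.Re (phi y)) x +i*
  partials l (fun y => complex.Im (phi y)) x.

Definition Csmooth phi : Prop :=
  smooth (fun y => complex.Re (phi y)) /\
  smooth (fun y => complex.Im (phi y)).

Definition Ccontinuous (f : Rd -> R[i]) : Prop :=
  continuous (fun y => complex.Re (f y)) /\
  continuous (fun y => complex.Im (f y)).

Definition schwartz_norm (k : nat) phi : \bar R :=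
  ereal_sup [set ((1 + `|z.2|) ^+ k * normc (Cpartials z.1 phi z.2))%:E
            | z in [set z : seq 'I_d * Rd | (size z.1 <= k)%N]].

Definition schwartz phi : Prop :=
  Csmooth phi /\ forall k, (schwartz_norm k phi < +oo)%E.

(* A tempered distribution is encoded by a functional on all functions, of which
   only the values on Schwartz functions matter. *)
Definition tempered T : Prop :=
  (forall (c : R[i]) phi1 phi2, schwartz phi1 -> schwartz phi2 ->
     T (fun x => c * phi1 x + phi2 x) = c * T phi1 + T phi2) /\
  exists (C : R) (k : nat), forall phi, schwartz phi ->
    ((normc (T phi))%:E <= C%:E * schwartz_norm k phi)%E.

Definition test_function (U : set Rd) phi : Prop :=
  Csmooth phi /\
  let K := closure [set x | phi x != 0] in compact K /\ K `<=` U.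

Definition dsupport T : set Rd :=
  ~` \bigcup_(U in [set U | open U /\
       forall phi, test_function U phi -> T phi = 0]) U.

Definition dconvolution (K : Rd -> R) T (x : Rd) : R[i] :=
  T (fun y => (K (x - y))%:C).

Definition regular_distribution (f : Rd -> R[i]) phi : R[i] :=
  Cintegral (lebesgue_rV R d) setT (fun x => f x * phi x).

End tempered_distributions.

Section besov.
Context {R : realType} {d : nat}.
Local Notation Rd := 'rV[R]_d.
Variables (L : nat) (Psi0 : R -> R) (s : R) (p theta : \bar R).
Implicit Types (T : (Rd -> R[i]) -> R[i]) (f : Rd -> R[i]).

Definition unit_cube : set Rd := [set x | forall i, 0 <= x ord0 i <= 1].

Definition besov_block T (m : {ffun 'I_d -> nat}) : \bar R :=
  Lnorm (lebesgue_rV R d) p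
    (fun x => (normc (dconvolution (tensor_mean L Psi0 m) T x))%:E).

(* The second case is meant for theta = +oo; only 1 <= theta is used. *)
Definition besov_norm T : \bar R :=
  match theta with
  | t%:E => poweR (\esum_(m in [set: {ffun 'I_d -> nat}])
      ((2 `^ (s * (\sum_i m i)%:R * t))%:E * poweR (besov_block T m) t)%E) t^-1
  | _ => ereal_sup
      [set ((2 `^ (s * (\sum_i m i)%:R))%:E * besov_block T m)%E
      | m in [set: {ffun 'I_d -> nat}]]
  end.

Definition besov T : Prop := tempered T /\ (besov_norm T < +oo)%E.

Definition besov0 T : Prop := besov T /\ dsupport T `<=` unit_cube.

(* For s > 1/p the elements of besov0 are continuous functions; point values are
   those of the continuous representative f of the distribution. *)
Definition besov0_unit_ball : set (Rd -> R[i]) :=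
  [set f | [/\ Ccontinuous f, besov0 (regular_distribution f) &
               (besov_norm (regular_distribution f) <= 1)%E]].

End besov.

Definition wce {R : realType} {d N : nat} (x : 'I_N -> 'rV[R]_d)
    (F : set ('rV[R]_d -> R[i])) : \bar R :=
  ereal_sup [set (normc (Cintegral (lebesgue_rV R d) unit_cube f -
                         N%:R^-1 * \sum_(n < N) f (x n)))%:E | f in F].

Section kronecker.
Context {R : realType}.

Definition frac (x : R) : R := x - (Num.floor x)%:~R.

(* The points of P_N(alpha) in dimension k.+1, for alpha in R^k. *)
Definition kronecker k (alpha : 'rV[R]_k) (N : nat) (n : 'I_N) : 'rV[R]_k.+1 :=
  \row_(i < k.+1) if unlift ord0 i is Some j then frac (n%:R * alpha ord0 j)
                  else n%:R / N%:R.

Definition log2 (x : R) : R := ln x / ln 2.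

End kronecker.

(* Main.v *)
Require Import Defs.
From HB Require Import structures.
From mathcomp Require Import all_boot all_order all_algebra.
From mathcomp Require Import all_classical all_reals all_analysis.
From mathcomp Require Import measurable_realfun.
From mathcomp Require Import complex.
From mathcomp Require Import ring lra zify.
Set Implicit Arguments.
Unset Strict Implicit.
Unset Printing Implicit Defensive.
Import Order.TTheory GRing.Theory Num.Theory.
Import numFieldNormedType.Exports Normc.
Local Open Scope classical_set_scope.
Local Open Scope ring_scope.

(* Put u = Re f or u = Im f; it is continuous and vanishes off the cube.  From Psi_0
   and Psi_1 one builds dual kernels Phi_0, Phi_1, dilated like the local means, such
   that the sum over m in {0..J}^d of Phi_m * Psi_m is an approximate identity.  Hence
   the quadrature error of u is the sum over m of the integrals of
   (Psi_m * u)(y) kappa_m(y), where kappa_m(y) is the error of the (integer-translated)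
   point set on Phi_m(. - y).

   By Poisson summation in the last k coordinates, realised by Fejer means,
   kappa_m(y) becomes a sum over nonzero frequencies h of products of Fourier
   coefficients with exponential sums over n/N.  For almost every alpha one has
   ||h . alpha|| >= c / prod_i (h_i psi(h_i)) (Borel-Cantelli), so no h whose dyadic
   size is below Y = c N / psi(N)^k is nearly resonant; counting the resonant h in dyadic
   boxes gives |kappa_m| <= C (2^|m| / Y)^B for every B.  Together with an L_1 bound of
   kappa_m, Hoelder's inequality in L_p bounds the m-th term by
   C ||Psi_m * u||_p w(2^|m| / Y), with w(X) = X^(1/p) if X >= 1 and w(X) = X^B otherwise.
   Since 1/p < s < B, the weights concentrate on the about (log N)^k levels with
   2^|m| close to Y, and Hoelder's inequality in l_theta gives
   Y^(-s) (log N)^(k (1 - 1/theta)). *)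

(** The points (n/N, n alpha), n an integer, taken modulo Z in the last k coordinates, form a
    lattice that need not contain the first unit vector. This is why the first coordinate is treated
    differently from the others. Since u lives on the cube, summing over the lattice points of a
    large window changes nothing, while it removes the jumps of the fractional parts, turns the
    kernels into periodisations in the last k coordinates, and lets summation by parts in n run
    without boundary terms.

    The dual kernels must have compact support although Psi_1 carries L derivatives; they therefore
    contain L antiderivatives, each kept compactly supported by a factor 1 - e with e of integral 1.

    Fejer means keep every sum finite. Their frequencies are differences a - b; b is fixed while a
    is counted, and the points counted are separated because the Diophantine condition applies to a
    - a'. All bounds are uniform in the number M of frequencies and in the truncation J of the
    levels, so the limits are taken in inequalities. The point alpha enters the final constant only
    through c. *)

(** * Integration of real-valued functions *)

Section generic_integral.
Context d (T : measurableType d) (R : realType) (mu : {measure set T -> \bar R}).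
Implicit Types f g : T -> R.

Definition rintegrable f := mu.-integrable setT (EFin \o f).

Lemma EFin_Rintegral f : rintegrable f ->
  (\int[mu]_x f x)%:E = (\int[mu]_x (f x)%:E)%E.
Proof. by move=> fi; rewrite /Rintegral fineK// integrable_fin_num. Qed.

Lemma rintegrable_measurable f : rintegrable f -> measurable_fun setT f.
Proof. by move=> /integrableP[/measurable_EFinP]. Qed.

Lemma rintegrableD f g : rintegrable f -> rintegrable g ->
  rintegrable (fun x => f x + g x).
Proof. by move=> fi gi; apply: (integrableD _ fi gi). Qed.

Lemma rintegrableZ c f : rintegrable f -> rintegrable (fun x => c * f x).
Proof. by move=> fi; apply: (integrableZl _ _ fi). Qed.

Lemma rintegrable_sum (I : Type) (s : seq I) (P : pred I) (F : I -> T -> R) :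
  (forall i, P i -> rintegrable (F i)) -> rintegrable (fun x => \sum_(i <- s | P i) F i x).
Proof.
move=> Fi; have := @integrable_sum _ _ _ mu _ measurableT I s P (fun i x => (F i x)%:E) Fi.
by apply: eq_integrable => // x _; rewrite /= sumEFin.
Qed.

Lemma rintegrable_le f g : measurable_fun setT f -> rintegrable g ->
  (forall x, `|f x| <= g x) -> rintegrable f.
Proof.
move=> mf gi fg; apply: (le_integrable _ _ _ gi) => //; first exact/measurable_EFinP.
by move=> x _ /=; rewrite lee_fin (le_trans (fg x))// ler_norm.
Qed.

Lemma rintegrable_norm f : rintegrable f -> rintegrable (fun x => `|f x|).
Proof. by move=> fi; apply: integrable_norm. Qed.

Lemma rintegralD f g : rintegrable f -> rintegrable g ->
  \int[mu]_x (f x + g x) = \int[mu]_x f x + \int[mu]_x g x.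
Proof. by move=> fi gi; rewrite RintegralD. Qed.

Lemma rintegralB f g : rintegrable f -> rintegrable g ->
  \int[mu]_x (f x - g x) = \int[mu]_x f x - \int[mu]_x g x.
Proof. by move=> fi gi; rewrite RintegralB. Qed.

Lemma rintegralZ c f : rintegrable f -> \int[mu]_x (c * f x) = c * \int[mu]_x f x.
Proof. by move=> fi; rewrite RintegralZl. Qed.

Lemma rintegralZr c f : rintegrable f -> \int[mu]_x (f x * c) = \int[mu]_x f x * c.
Proof. by move=> fi; rewrite RintegralZr. Qed.

Lemma rintegral0 : \int[mu]_x (0 : R) = 0.
Proof. by rewrite /Rintegral integral0. Qed.

Lemma rintegral_sum (I : Type) (s : seq I) (P : pred I) (F : I -> T -> R) :
  (forall i, P i -> rintegrable (F i)) ->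
  \int[mu]_x (\sum_(i <- s | P i) F i x) = \sum_(i <- s | P i) \int[mu]_x F i x.
Proof.
move=> Fi; elim: s => [|i s IH].
  by rewrite big_nil; under eq_Rintegral do rewrite big_nil; exact: rintegral0.
rewrite big_cons; case: ifPn => Pi; last first.
  by rewrite -IH; apply: eq_Rintegral => x _; rewrite big_cons (negbTE Pi).
rewrite -IH -rintegralD; [|exact: Fi|exact: rintegrable_sum].
by apply: eq_Rintegral => x _; rewrite big_cons Pi.
Qed.

Lemma le_rintegral f g : rintegrable f -> rintegrable g ->
  (forall x, f x <= g x) -> \int[mu]_x f x <= \int[mu]_x g x.
Proof. by move=> fi gi fg; apply: le_Rintegral => // x _. Qed.

Lemma norm_rintegral f : rintegrable f ->
  `|\int[mu]_x f x| <= \int[mu]_x `|f x|.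
Proof. by move=> fi; apply: le_normr_Rintegral. Qed.

Lemma rintegral_ge0 f : (forall x, 0 <= f x) -> 0 <= \int[mu]_x f x.
Proof. by move=> f0; apply: Rintegral_ge0. Qed.

Lemma eq_rintegral f g : f =1 g -> \int[mu]_x f x = \int[mu]_x g x.
Proof. by move=> fg; apply: eq_Rintegral => x _. Qed.

End generic_integral.
Arguments rintegrable {d T R} mu f.

Section real_fubini.
Context d1 d2 (T1 : measurableType d1) (T2 : measurableType d2) (R : realType).
Variables (m1 : {sigma_finite_measure set T1 -> \bar R})
  (m2 : {sigma_finite_measure set T2 -> \bar R}).
Variables (f : T1 -> T2 -> R) (a : T1 -> R) (b : T2 -> R).
Hypotheses (mf : measurable_fun setT (fun z : T1 * T2 => f z.1 z.2))
  (ia : rintegrable m1 a) (ib : rintegrable m2 b)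
  (fab : forall x y, `|f x y| <= a x * b y).

(** Domination by a product [a x * b y] yields joint integrability through Tonelli. It is the one
    condition that the later uses of Fubini have to verify. *)
Lemma rprod_integrable : (m1 \x m2)%E.-integrable setT (fun z => (f z.1 z.2)%:E).
Proof.
apply/integrable12ltyP; first exact/measurable_EFinP.
have := integrable_norm ia; have := integrable_norm ib => /= ib' ia'.
apply: (@le_lt_trans _ _ (\int[m1]_x \int[m2]_y (`|a x|%:E * `|b y|%:E))%E).
  apply: ge0_le_integral => //.
  - by move=> x _; apply: integral_ge0.
  - apply: (@measurable_fun_fubini_tonelli_F _ _ _ _ _ m2 (fun z => `|(f z.1 z.2)%:E|%E)) => //.
    by apply: measurableT_comp => //; exact/measurable_EFinP.
  - apply: (@measurable_fun_fubini_tonelli_F _ _ _ _ _ m2 (fun z : T1 * T2 => (`|a z.1|%:E * `|b z.2|%:E)%E)).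
      apply: emeasurable_funM; apply/measurable_EFinP.
        apply: measurableT_comp => //; apply: measurableT_comp => //.
        exact: rintegrable_measurable ia.
    apply: measurableT_comp => //; apply: measurableT_comp => //.
    exact: rintegrable_measurable ib.
    by move=> x; rewrite mule_ge0// lee_fin.
  - move=> x _; apply: ge0_le_integral => //.
    + apply/measurable_EFinP; apply: measurableT_comp => //.
      exact: (measurableT_comp mf (pair1_measurable x)).
    + apply: measurable_funeM; apply/measurable_EFinP; apply: measurableT_comp => //.
      exact: rintegrable_measurable ib.
    + by move=> y _; rewrite -EFinM lee_fin -normrM (le_trans (fab x y))// ler_norm.
have ibn : measurable_fun setT (fun y => `|b y|%:E).
  by apply/measurable_EFinP; apply: measurableT_comp => //; exact: rintegrable_measurable ib.
under eq_integral => x _ do rewrite ge0_integralZl_EFin//.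
rewrite ge0_integralZr//.
- apply: lte_mul_pinfty.
  + exact: integral_ge0.
  + by rewrite integrable_fin_num.
  + by rewrite -ge0_fin_numE ?integral_ge0// integrable_fin_num.
- by apply/measurable_EFinP; apply: measurableT_comp => //; exact: rintegrable_measurable ia.
- by apply: integral_ge0.
Qed.

Lemma rsection1_integrable x : rintegrable m2 (f x).
Proof.
apply: (@rintegrable_le _ _ _ _ _ (fun y => a x * b y)) => //.
- exact: (measurableT_comp mf (pair1_measurable x)).
- exact: rintegrableZ.
Qed.

Lemma rsection2_integrable y : rintegrable m1 (fun x => f x y).
Proof.
apply: (@rintegrable_le _ _ _ _ _ (fun x => b y * a x)) => //.
- exact: (measurableT_comp mf (pair2_measurable y)).
- exact: rintegrableZ.
- by move=> x; rewrite mulrC.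
Qed.

Lemma rintegrable_F : rintegrable m1 (fun x => \int[m2]_y f x y).
Proof.
have := integrable_fubini_F rprod_integrable.
by apply: eq_integrable => // x _; rewrite /= (EFin_Rintegral (rsection1_integrable x)).
Qed.

Lemma rintegral12 : \int[m1]_x \int[m2]_y f x y = \int[(m1 \x m2)%E]_z f z.1 z.2.
Proof.
rewrite /Rintegral; congr fine; rewrite -(integral12_prod_meas1 rprod_integrable).
apply: eq_integral => x _ /=.
by rewrite /fubini_F /= -(EFin_Rintegral (rsection1_integrable x)).
Qed.

Lemma rfubini : \int[m1]_x \int[m2]_y f x y = \int[m2]_y \int[m1]_x f x y.
Proof.
rewrite /Rintegral; congr fine.
transitivity (\int[m1]_x \int[m2]_y (f x y)%:E)%E.
  by apply: eq_integral => x _; rewrite -EFin_Rintegral//; exact: rsection1_integrable.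
rewrite (Fubini rprod_integrable) /=.
by apply: eq_integral => y _ /=; rewrite -EFin_Rintegral//; exact: rsection2_integrable.
Qed.

End real_fubini.

(** * Compactly supported functions and convolution *)

Section compact_support.
Context {R : realType}.
Local Notation mu := (@lebesgue_measure R).
Implicit Types (f g F u v w : R -> R) (r s t x : R).

(** The radius is explicit because supports are tracked quantitatively. It may be negative, and then
    [f] is 0; where a segment is needed, [r] is replaced by [|r|] or by its maximum with 0. *)
Definition csupp r f := forall x, r < `|x| -> f x = 0.

Lemma csuppW r r' f : r <= r' -> csupp r f -> csupp r' f.
Proof. by move=> rr' h x /(le_lt_trans rr')/h. Qed.

Lemma cc_restrict r a b f : csupp r f -> a <= - r -> r <= b ->
  f \_ `[a, b] = f.
Proof.
move=> h ar rb; apply/funext => x; rewrite patchE; case: ifPn => // xab.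
apply/esym/h; rewrite ltNge; apply: contra xab => xr.
rewrite inE /= in_itv /=; move: xr; rewrite ler_norml => /andP[h1 h2].
by rewrite (le_trans ar)// (le_trans h2).
Qed.

Lemma cc_integrable r f : continuous f -> csupp r f -> rintegrable mu f.
Proof.
move=> cf h.
have : mu.-integrable `[- r, r] (EFin \o f).
  apply: continuous_compact_integrable; first exact: segment_compact.
  exact: continuous_subspaceT.
move/integrable_mkcond => /(_ _)-/(_ (measurable_itv _)).
by rewrite restrict_EFin (cc_restrict h).
Qed.

Lemma cc_integral_itv r a b f : csupp r f -> a <= - r -> r <= b ->
  \int[mu]_x f x = \int[mu]_(x in `[a, b]) f x.
Proof. by move=> h ar rb; rewrite [RHS]Rintegral_mkcond (cc_restrict h). Qed.

Lemma cc_bounded r f : continuous f -> csupp r f ->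
  exists2 C, 0 <= C & forall x, `|f x| <= C.
Proof.
move=> cf h.
have cn : {within `[- `|r|, `|r|], continuous (fun x => `|f x|)}.
  apply: continuous_subspaceT => x; apply: continuous_comp; first exact: cf.
  exact: norm_continuous.
have [c _ hc] := EVT_max (ge0_cp (normr_ge0 r)).2 cn.
exists `|f c| => // x; case: (leP `|x| `|r|) => xr.
  by apply: hc; rewrite in_itv /= -ler_norml.
by rewrite h ?normr0// (le_lt_trans _ xr)// ler_norm.
Qed.

Lemma cc_FTC r a b f F : continuous f -> csupp r f ->
  (forall x, is_derive x 1 F (f x)) -> a < b -> a <= - r -> r <= b ->
  \int[mu]_x f x = F b - F a.
Proof.
move=> cf h dF ab ar rb; rewrite (cc_integral_itv h ar rb) /Rintegral.
have cF : continuous F.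
  by move=> x; apply: differentiable_continuous; apply/derivable1_diffP; exact: ex_derive.
rewrite (@continuous_FTC2 _ f F a b ab).
- by rewrite -EFinB.
- exact: continuous_subspaceT.
- split.
  + by move=> x _; exact: ex_derive.
  + exact: cvg_at_right_filter (cF a).
  + exact: cvg_at_left_filter (cF b).
- by move=> x _; rewrite derive1E derive_val.
Qed.

Definition prim f x := \int[mu]_(t in `]-oo, x]) f t.

Lemma is_derive_prim r f x : continuous f -> csupp r f ->
  is_derive x 1 (prim f) (f x).
Proof.
move=> cf h.
have [] := @continuous_FTC1 R f -oo%O x (x + 1) _ _ _ (cf x).
- by rewrite ltrDl.
- apply: (@integrableS _ _ _ _ setT) => //.
  exact: cc_integrable cf h.
- by rewrite ltNyr.
- by move=> d1 d2; apply: DeriveDef; [exact: d1|rewrite -derive1E; exact: d2].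
Qed.

Lemma prim0 r f x : csupp r f -> x < - r -> prim f x = 0.
Proof.
move=> h xr; rewrite /prim Rintegral_mkcond -[RHS](rintegral0 mu).
apply: eq_rintegral => y; rewrite patchE; case: ifPn => //.
rewrite inE /= in_itv /= => yx; apply: h; rewrite ltr_normr.
by apply/orP; right; rewrite ltrNr (le_lt_trans yx).
Qed.

Lemma primT r f x : continuous f -> csupp r f -> r <= x ->
  prim f x = \int[mu]_y f y.
Proof.
move=> cf h rx; rewrite (@cc_FTC r (Num.min (-r - 1) (x - 1)) x f (prim f) cf h (fun y => @is_derive_prim r f y cf h))//.
- rewrite (@prim0 r f (Num.min _ _) h) ?subr0//.
  by rewrite gt_min; apply/orP; left; rewrite ltrBlDr ltrDl.
- by rewrite gt_min; apply/orP; right; rewrite ltrBlDr ltrDl.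
- by rewrite ge_min; apply/orP; left; rewrite lerBlDr lerDl.
Qed.

Lemma continuous_affine f s t : continuous f -> continuous (fun x => f (s * x + t)).
Proof.
move=> cf x; apply: (@continuous_comp _ _ _ (fun y => s * y + t) f); last exact: cf.
by apply: cvgD; [apply: cvgMr; exact: cvg_id|exact: cvg_cst].
Qed.

Lemma csupp_affine r f s t : s != 0 -> csupp r f ->
  csupp ((r + `|t|) / `|s|) (fun x => f (s * x + t)).
Proof.
move=> s0 h x; rewrite ltr_pdivrMr ?normr_gt0// => xr; apply: h.
have : `|x| * `|s| <= `|s * x + t| + `|t|.
  by rewrite -normrM -[x * s](addrK t) (mulrC x) (le_trans (ler_normB _ _)).
lra.
Qed.

(** The function [s^-1 * prim f (s * x + t)] is an antiderivative of the left integrand. For [s < 0]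
    the two ends of the support change sides, which turns [s^-1] into its absolute value. *)
Lemma cc_affine r f s t : continuous f -> csupp r f -> s != 0 ->
  \int[mu]_x f (s * x + t) = `|s|^-1 * \int[mu]_x f x.
Proof.
move=> cf h0 s0; pose r' := Num.max r 0.
have h : csupp r' f by apply: csuppW h0; rewrite le_max lexx.
have r'0 : 0 <= r' by rewrite le_max lexx orbT.
have s0' : 0 < `|s| by rewrite normr_gt0.
(* Large enough for [s * b + t] and [s * (- b) + t] to lie on opposite sides of [[- r', r']]. *)
pose b := (r' + `|t| + 1) / `|s|.
have b0 : 0 < b by rewrite divr_gt0// ltr_pwDr// addr_ge0.
have bs : `|s| * b = r' + `|t| + 1 by rewrite mulrCA divff ?gt_eqF// mulr1.
have dG x : is_derive x 1 (fun x => s^-1 * prim f (s * x + t)) (f (s * x + t)).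
  have d1 := is_derive_prim (s * x + t) cf h.
  have d2 : is_derive x 1 (fun x : R => s * x + t) s.
    by apply: is_derive_eq; rewrite /GRing.scale /= mulr1 addr0.
  have d3 := @is_derive1_comp R (prim f) (fun y => s * y + t) x _ _ d1 d2.
  have d4 := is_deriveZ s^-1 d3.
  apply: (is_derive_eq d4).
  by rewrite /GRing.scale /= mulrCA mulVf// mulr1.
have bb : (r' + `|t|) / `|s| <= b by rewrite ler_pM2r ?invr_gt0// lerDl.
rewrite (@cc_FTC _ (- b) b _ _ (@continuous_affine f s t cf) (@csupp_affine r' f s t s0 h) dG)//; last 2 first.
- by rewrite (lt_trans _ b0)// oppr_lt0.
- by rewrite lerN2.
have tt : - `|t| <= t <= `|t| by rewrite -ler_norml.
rewrite -mulrBr; move: s0; rewrite neq_lt => /orP[sn|sp].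
- rewrite (ltr0_norm sn) in bs *.
  rewrite (@primT r' f (s * (- b) + t) cf h); last by lra.
  rewrite (@prim0 r' f (s * b + t) h); last by lra.
  by rewrite sub0r invrN mulrN mulNr.
- rewrite (gtr0_norm sp) in bs *.
  rewrite (@primT r' f (s * b + t) cf h); last by lra.
  rewrite (@prim0 r' f (s * (- b) + t) h); last by lra.
  by rewrite subr0.
Qed.

Lemma cc_shift r f t : continuous f -> csupp r f ->
  \int[mu]_x f (x + t) = \int[mu]_x f x.
Proof.
move=> cf h; have := cc_affine t cf h (oner_neq0 R).
rewrite normr1 invr1 mul1r => <-.
by apply: eq_rintegral => x; rewrite mul1r.
Qed.

Lemma cc_reflect r f t : continuous f -> csupp r f ->
  \int[mu]_x f (t - x) = \int[mu]_x f x.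
Proof.
move=> cf h.
have N10 : (-1 : R) != 0 by rewrite oppr_eq0 oner_neq0.
have := cc_affine t cf h N10.
rewrite normrN1 invr1 mul1r => <-.
by apply: eq_rintegral => x; rewrite mulN1r addrC.
Qed.

Lemma cc_norm_le r C f : 0 <= r -> continuous f -> csupp r f -> (forall x, `|f x| <= C) ->
  \int[mu]_x `|f x| <= C * (2 * r).
Proof.
move=> r0 cf h hC.
have h' : csupp r (fun x => `|f x|) by move=> x xr; rewrite h ?normr0.
have cn : continuous (fun x => `|f x|).
  by move=> x; apply: continuous_comp; [exact: cf|exact: norm_continuous].
rewrite (cc_integral_itv h' (lexx _) (lexx _)).
apply: (@le_trans _ _ (\int[mu]_(x in `[- r, r]) C)).
  apply: le_Rintegral => //.
  - apply: continuous_compact_integrable; first exact: segment_compact.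
    exact: continuous_subspaceT.
  - apply: continuous_compact_integrable; first exact: segment_compact.
    by apply: continuous_subspaceT => ?; exact: cvg_cst.
rewrite Rintegral_cst//= lebesgue_measure_itv /= lte_fin.
case: ltP => _ /=; first by rewrite opprK mulr_natl mulr2n.
by rewrite mulr0 mulr_ge0 ?mulr_ge0// (le_trans _ (hC 0)).
Qed.

(** * Finite differences and functions with controlled differences *)

Section finite_differences.

Definition fdiff t f x := f (x + t) - f x.

Lemma fdiffS A t f x : iter A.+1 (fdiff t) f x =
  iter A (fdiff t) f (x + t) - iter A (fdiff t) f x.
Proof. by []. Qed.

Lemma iter_fdiffD A t f g x : iter A (fdiff t) (fun y => f y + g y) x =
  iter A (fdiff t) f x + iter A (fdiff t) g x.
Proof. by elim: A x => [|A IH] x //; rewrite !fdiffS !IH; ring. Qed.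

Lemma iter_fdiffZ A t c f x : iter A (fdiff t) (fun y => c * f y) x =
  c * iter A (fdiff t) f x.
Proof. by elim: A x => [|A IH] x //; rewrite !fdiffS !IH; ring. Qed.

Lemma iter_fdiff_affine A t f s (u : R) x : iter A (fdiff t) (fun y => f (s * y + u)) x =
  iter A (fdiff (s * t)) f (s * x + u).
Proof.
elim: A x => [|A IH] x //; rewrite !fdiffS !IH.
by have -> : s * (x + t) + u = s * x + u + s * t by ring.
Qed.

Lemma iter_fdiff_derive A t f F : (forall x, is_derive x 1 F (f x)) ->
  forall x, is_derive x 1 (iter A (fdiff t) F) (iter A (fdiff t) f x).
Proof.
move=> dF; elim: A => [|A IH] x //.
apply: is_deriveB.
have d2 : is_derive x 1 (fun x : R => x + t) 1 by apply: is_derive_eq; rewrite addr0.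
have := @is_derive1_comp R _ (fun y => y + t) x _ _ (IH (x + t)) d2.
by rewrite mulr1.
Qed.

Lemma continuous_fdiff A t f : continuous f -> continuous (iter A (fdiff t) f).
Proof.
move=> cf; elim: A => [|A IH]// x.
apply: cvgB; last exact: IH.
have := @continuous_affine _ 1 t IH x; rewrite /continuous_at mul1r.
by under eq_fun do rewrite mul1r.
Qed.

Lemma csupp_fdiff A r t f : csupp r f -> csupp (r + A%:R * `|t|) (iter A (fdiff t) f).
Proof.
move=> h; elim: A => [|A IH] x; first by rewrite mul0r addr0; exact: h.
rewrite -natr1 mulrDl mul1r addrA => xr; rewrite fdiffS !IH ?subrr//.
  by rewrite (le_lt_trans _ xr)// lerDl.
have : `|x| <= `|x + t| + `|t| by rewrite -[x in `|x| <= _](addrK t) ler_normB.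
lra.
Qed.

End finite_differences.

(* Bounds on finite differences pass to convolutions at once; derivatives would need
   differentiation under the integral. *)
Variant tame f : Prop := Tame of (exists r, csupp r f) &
  (forall A, exists C, forall t x, `|iter A (fdiff t) f x| <= C * `|t| ^+ A).

Lemma tame_fdiff f A : tame f ->
  exists C, forall t x, `|iter A (fdiff t) f x| <= C * `|t| ^+ A.
Proof. by move=> [_]; apply. Qed.

Lemma tame_csupp f : tame f -> exists2 r, 0 <= r & csupp r f.
Proof.
move=> [[r h] _]; exists `|r| => //; apply: csuppW h; exact: ler_norm.
Qed.

Lemma tame_bounded f : tame f -> exists2 C, 0 <= C & forall x, `|f x| <= C.
Proof.
move=> [_ /(_ 0)[C hC]].
have hC' x : `|f x| <= C by have := hC 0 x; rewrite /= expr0 mulr1.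
by exists C => //; rewrite (le_trans _ (hC' 0)).
Qed.

Lemma tame_lipschitz f : tame f -> exists2 C, 0 < C & forall x y, `|f x - f y| <= C * `|x - y|.
Proof.
move=> [_ /(_ 1)[C hC]]; exists (Num.max C 1); first by rewrite lt_max ltr01 orbT.
move=> x y; have := hC (x - y) y; rewrite /= /fdiff expr1 [y + _]addrC subrK => /le_trans; apply.
by rewrite ler_wpM2r// le_max lexx.
Qed.

Lemma lipschitz_continuous C f : 0 < C -> (forall x y, `|f x - f y| <= C * `|x - y|) ->
  continuous f.
Proof.
move=> C0 hC x; apply/cvgrPdist_le => e e0; near=> y.
rewrite (le_trans (hC _ _))// mulrC -ler_pdivlMr//.
near: y; apply: (@cvgr_dist_le _ _ _ _ _ id x (@cvg_id _ _)); exact: divr_gt0.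
Unshelve. all: by end_near. Qed.

Lemma tame_continuous f : tame f -> continuous f.
Proof. by move=> /tame_lipschitz[C C0 /(lipschitz_continuous C0)]. Qed.

Lemma tame_integrable f : tame f -> rintegrable mu f.
Proof.
move=> tf; have [r _ h] := tame_csupp tf.
exact: cc_integrable (tame_continuous tf) h.
Qed.

Lemma tame0 : tame (fun _ => 0).
Proof.
split; first by exists 0.
move=> A; exists 0 => t x; rewrite mul0r.
suff -> : iter A (fdiff t) (fun=> 0) x = 0 by rewrite normr0.
by elim: A x => [|A IH] x //; rewrite fdiffS !IH subrr.
Qed.

Lemma tameD f g : tame f -> tame g -> tame (fun x => f x + g x).
Proof.
move=> [[r1 h1] H1] [[r2 h2] H2]; split.
  exists (Num.max r1 r2) => x; rewrite gt_max => /andP[xr1 xr2].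
  by rewrite h1// h2// addr0.
move=> A; have [C1 hC1] := H1 A; have [C2 hC2] := H2 A.
exists (C1 + C2) => t x; rewrite iter_fdiffD mulrDl (le_trans (ler_normD _ _))//.
exact: lerD.
Qed.

Lemma tameZ c f : tame f -> tame (fun x => c * f x).
Proof.
move=> [[r1 h1] H1]; split; first by exists r1 => x /h1 ->; rewrite mulr0.
move=> A; have [C1 hC1] := H1 A; exists (`|c| * C1) => t x.
by rewrite iter_fdiffZ normrM -mulrA ler_wpM2l.
Qed.

Lemma tameB f g : tame f -> tame g -> tame (fun x => f x - g x).
Proof.
move=> tf tg; have := tameD tf (tameZ (-1) tg).
by under eq_fun do rewrite mulN1r.
Qed.

Lemma tame_sum (I : Type) (s : seq I) (P : pred I) (F : I -> R -> R) :
  (forall i, tame (F i)) -> tame (fun x => \sum_(i <- s | P i) F i x).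
Proof.
move=> tF; elim: s => [|i s IH].
  by under eq_fun do rewrite big_nil; exact: tame0.
by under eq_fun do rewrite big_cons; case: (P i) => //; exact: tameD.
Qed.

Lemma tame_affine s (u : R) f : s != 0 -> tame f -> tame (fun x => f (s * x + u)).
Proof.
move=> s0 [[r h] H]; split; first by exists ((r + `|u|) / `|s|); exact: csupp_affine.
move=> A; have [C hC] := H A; exists (C * `|s| ^+ A) => t x.
by rewrite iter_fdiff_affine (le_trans (hC _ _))// normrM exprMn mulrA.
Qed.

(** A difference of order [A.+1] is an increment of the [A]-th difference of [F], whose derivative
    is the [A]-th difference of [f]. The mean value theorem thus trades one difference for a factor
    [t]. *)
Lemma fdiff_mvt A t f F x : (forall x, is_derive x 1 F (f x)) ->
  exists y, iter A.+1 (fdiff t) F x = iter A (fdiff t) f y * t.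
Proof.
move=> dF; have dA := iter_fdiff_derive A t dF.
have cA : continuous (iter A (fdiff t) F).
  by move=> y; apply: differentiable_continuous; apply/derivable1_diffP; exact: ex_derive.
have [t0|t0|->] := ltgtP t 0.
- have [y _ hy] := @MVT R (iter A (fdiff t) F) (iter A (fdiff t) f) (x + t) x ltac:(lra)
    (fun z _ => dA z) (continuous_subspaceT cA).
  exists y; rewrite fdiffS -[LHS]opprB hy; ring.
- have [y _ hy] := @MVT R (iter A (fdiff t) F) (iter A (fdiff t) f) x (x + t) ltac:(lra)
    (fun z _ => dA z) (continuous_subspaceT cA).
  exists y; rewrite fdiffS hy; ring.
- by exists 0; rewrite fdiffS addr0 subrr mulr0.
Qed.

(** Order 0 comes from continuity and compact support; each higher order for [F] comes from the
    order below for [f]. *)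
Lemma tame_antiderivative r f F : (forall x, is_derive x 1 F (f x)) -> csupp r F ->
  tame f -> tame F.
Proof.
move=> dF h [_ H]; split; first by exists r.
have cF : continuous F.
  by move=> y; apply: differentiable_continuous; apply/derivable1_diffP; exact: ex_derive.
case=> [|A].
  have [C _ hC] := cc_bounded cF h.
  by exists C => t x; rewrite expr0 mulr1; exact: hC.
have [C hC] := H A; exists C => t x.
have [y ->] := fdiff_mvt A t x dF.
by rewrite normrM exprSr mulrA ler_wpM2r.
Qed.

(** The condition [r < |x|] is open, so [F] is 0 in a neighbourhood of [x]. *)
Lemma csupp_derive r f F : (forall x, is_derive x 1 F (f x)) -> csupp r F -> csupp r f.
Proof.
move=> dF h x xr; have := dF x => d1.
have d0 : is_derive x 1 F 0.
  have hc : is_derive x (1 : R) (cst (0 : R)) 0 by exact: is_derive_cst.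
  apply: (near_eq_is_derive _ hc).
  have : \forall y \near x, r < `|y|.
    have := @norm_continuous _ _ x => /(_ _); move/cvgr_gt => /(_ _ xr).
    by apply.
  by apply: filterS => y /h ->.
by have [_ <-] := d1; have [_ <-] := d0.
Qed.

Lemma is_derive_derive1n f : (forall n x, derivable (derive1n n f) x 1) ->
  forall n x, is_derive x 1 (derive1n n f) (derive1n n.+1 f x).
Proof.
by move=> sf n x; rewrite derive1nS derive1E; apply: derivableP; exact: sf.
Qed.

(** Induction on the order, for all derivatives at once: each difference costs one derivative, and
    every derivative is bounded as a continuous function of compact support. *)
Lemma tame_smooth r f : (forall n x, derivable (derive1n n f) x 1) -> csupp r f -> tame f.
Proof.
move=> sf h; split; first by exists r.
suff H A n : exists C, forall t x, `|iter A (fdiff t) (derive1n n f) x| <= C * `|t| ^+ A.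
  by move=> A; exact: (H A 0).
have hn k : csupp r (derive1n k f).
  elim: k => [|k IH]; first exact: h.
  exact: csupp_derive (is_derive_derive1n sf k) IH.
elim: A n => [|A IH] n.
  have cF : continuous (derive1n n f).
    by move=> y; apply: differentiable_continuous; apply/derivable1_diffP; exact: sf.
  have [C _ hC] := cc_bounded cF (hn n).
  by exists C => t x; rewrite expr0 mulr1; exact: hC.
have [C hC] := IH n.+1; exists C => t x.
have [y ->] := fdiff_mvt A t x (is_derive_derive1n sf n).
by rewrite normrM exprSr mulrA ler_wpM2r.
Qed.

End compact_support.

(** * The convolution algebra of tame functions *)

Section convolution.
Context {R : realType}.
Local Notation mu := (@lebesgue_measure R).
Implicit Types (f g F u v w : R -> R) (r s t x : R).

Fact conv_key : unit. Proof. exact: tt. Qed.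
(** Locked, so that conversion does not unfold nested convolutions; [convE] opens it. *)
Definition conv u v := locked_with conv_key (fun x => \int[mu]_y (u y * v (x - y))).

Lemma convE u v x : conv u v x = \int[mu]_y (u y * v (x - y)).
Proof. by rewrite /conv unlock. Qed.

Lemma tame_measurable u : tame u -> measurable_fun setT u.
Proof. by move=> tu; apply: continuous_measurable_fun; exact: tame_continuous. Qed.

Lemma tame_translate_neg u x : tame u -> tame (fun y => u (x - y)).
Proof.
move=> tu; have N10 : (-1 : R) != 0 by rewrite oppr_eq0 oner_neq0.
by have := tame_affine x N10 tu; under eq_fun do rewrite mulN1r addrC.
Qed.

Lemma tame_mul_cc u v : tame u -> tame v ->
  continuous (fun y => u y * v y) /\ exists2 r, 0 <= r & csupp r (fun y => u y * v y).
Proof.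
move=> tu tv; split.
  by move=> y; apply: cvgM; exact: tame_continuous.
have [r r0 h] := tame_csupp tu; exists r => // x /h ->; exact: mul0r.
Qed.

Lemma continuous_reflect f x : continuous f -> continuous (fun y => f (x - y)).
Proof.
move=> cf y; have := @continuous_affine _ f (-1) x cf y.
rewrite /continuous_at mulN1r addrC.
by under eq_fun do rewrite mulN1r addrC.
Qed.

Lemma conv_integrable u v x : tame u -> tame v ->
  rintegrable mu (fun y => u y * v (x - y)).
Proof.
move=> tu tv; have [c [r _ h]] := tame_mul_cc tu (tame_translate_neg x tv).
exact: cc_integrable c h.
Qed.

Lemma convC u v : tame u -> tame v -> conv u v = conv v u.
Proof.
move=> tu tv; apply/funext => x; rewrite !convE.
have [c [r _ h]] := tame_mul_cc tu (tame_translate_neg x tv).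
rewrite -(cc_reflect x c h); apply: eq_rintegral => y.
have -> : x - (x - y) = y by ring.
by rewrite mulrC.
Qed.

Lemma convDr u v w : tame u -> tame v -> tame w ->
  conv u (fun x => v x + w x) = (fun x => conv u v x + conv u w x).
Proof.
move=> tu tv tw; apply/funext => x; rewrite !convE.
rewrite -rintegralD; [|exact: conv_integrable|exact: conv_integrable].
by apply: eq_rintegral => y; rewrite mulrDr.
Qed.

Lemma convBr u v w : tame u -> tame v -> tame w ->
  conv u (fun x => v x - w x) = (fun x => conv u v x - conv u w x).
Proof.
move=> tu tv tw; apply/funext => x; rewrite !convE.
rewrite -rintegralB; [|exact: conv_integrable|exact: conv_integrable].
by apply: eq_rintegral => y; rewrite mulrBr.
Qed.

Lemma conv_sumr (I : Type) (s : seq I) (F : I -> R -> R) u :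
  tame u -> (forall i, tame (F i)) ->
  conv u (fun x => \sum_(i <- s) F i x) = (fun x => \sum_(i <- s) conv u (F i) x).
Proof.
move=> tu tF; apply/funext => x; rewrite convE; under eq_bigr do rewrite convE; rewrite -rintegral_sum.
  by apply: eq_rintegral => y; rewrite mulr_sumr.
by move=> i _; exact: conv_integrable.
Qed.

Lemma iter_fdiff_conv A t u v x : tame u -> tame v ->
  iter A (fdiff t) (conv u v) x = \int[mu]_y (u y * iter A (fdiff t) v (x - y)).
Proof.
move=> tu tv; elim: A x => [|A IH] x; first exact: convE.
rewrite fdiffS !IH -rintegralB.
- apply: eq_rintegral => y; rewrite fdiffS -mulrBr.
  by have -> : x + t - y = x - y + t by ring.
- have [r r0 h] := tame_csupp tu.
  apply: (@cc_integrable _ r); last by move=> y /h ->; rewrite mul0r.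
  move=> y; apply: cvgM; first exact: tame_continuous.
  exact: (@continuous_reflect _ (x + t) (@continuous_fdiff _ A t v (tame_continuous tv))).
- have [r r0 h] := tame_csupp tu.
  apply: (@cc_integrable _ r); last by move=> y /h ->; rewrite mul0r.
  move=> y; apply: cvgM; first exact: tame_continuous.
  exact: (@continuous_reflect _ (x) (@continuous_fdiff _ A t v (tame_continuous tv))).
Qed.

Lemma tame_conv u v : tame u -> tame v -> tame (conv u v).
Proof.
move=> tu tv; have [r1 r10 h1] := tame_csupp tu; have [r2 r20 h2] := tame_csupp tv.
split.
  exists (r1 + r2) => x xr; rewrite convE -[RHS](rintegral0 mu).
  apply: eq_rintegral => y; have [yr|yr] := ltP r1 `|y|.
    by rewrite h1 ?mul0r.
  rewrite h2 ?mulr0//.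
  have : `|x| <= `|x - y| + `|y| by rewrite -[x in `|x| <= _](subrK y) ler_normD.
  by lra.
move=> A; have [C hC] := tame_fdiff A tv.
exists (C * \int[mu]_y `|u y|) => t x.
rewrite iter_fdiff_conv//.
have cu := tame_continuous tu.
have iu : rintegrable mu (fun y => `|u y|) by apply: rintegrable_norm; exact: tame_integrable.
have i1 : rintegrable mu (fun y => u y * iter A (fdiff t) v (x - y)).
  apply: (@cc_integrable _ r1); last by move=> y /h1 ->; rewrite mul0r.
  move=> y; apply: cvgM; first exact: cu.
  exact: (@continuous_reflect _ (x) (@continuous_fdiff _ A t v (tame_continuous tv))).
rewrite (le_trans (norm_rintegral i1))// mulrAC -rintegralZ//.
apply: le_rintegral; [exact: rintegrable_norm|exact: rintegrableZ|].
by move=> y; rewrite normrM mulrC ler_wpM2r.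
Qed.

Lemma convA u v w : tame u -> tame v -> tame w ->
  conv (conv u v) w = conv u (conv v w).
Proof.
move=> tu tv tw; apply/funext => x; rewrite !convE.
have [C C0 hC] := tame_bounded tv.
pose f z y := u z * v (y - z) * w (x - y).
have mf : measurable_fun setT (fun p : measurableTypeR R * measurableTypeR R => f p.1 p.2).
  apply: measurable_funM; first apply: measurable_funM.
  - by apply: measurableT_comp => //; exact: tame_measurable.
  - apply: (measurableT_comp (tame_measurable tv)).
    by apply: measurable_funB.
  - apply: (measurableT_comp (tame_measurable (tame_translate_neg x tw))).
    exact: measurable_snd.
have ia : rintegrable mu (fun z => `|u z|) by apply: rintegrable_norm; exact: tame_integrable.
have ib : rintegrable mu (fun y => C * `|w (x - y)|).
  apply: rintegrableZ; apply: rintegrable_norm; apply: tame_integrable.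
  exact: tame_translate_neg.
have fab z y : `|f z y| <= `|u z| * (C * `|w (x - y)|).
  rewrite /f !normrM -mulrA ler_wpM2l// ler_wpM2r//.
transitivity (\int[mu]_y \int[mu]_z f z y).
  apply: eq_rintegral => y; rewrite convE /f rintegralZr//.
  exact: conv_integrable.
rewrite -(rfubini mf ia ib fab); apply: eq_rintegral => z.
have [c [r _ h]] := tame_mul_cc tv (tame_translate_neg (x - z) tw).
transitivity (\int[mu]_y (u z * (v (y - z) * w (x - y)))).
  by apply: eq_rintegral => y; rewrite /f mulrA.
have c' : continuous (fun y => v (y - z) * w (x - y)).
  have tvz : tame (fun y => v (y - z)).
    by have := tame_affine (- z) (oner_neq0 R) tv; under eq_fun do rewrite mul1r.
  exact: (tame_mul_cc tvz (tame_translate_neg x tw)).1.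
have h' : csupp (r + `|z|) (fun y => v (y - z) * w (x - y)).
  move=> y yr; have := h (y - z); have -> : x - z - (y - z) = x - y by ring.
  apply; have : `|y| <= `|y - z| + `|z| by rewrite -[y in `|y| <= _](subrK z) ler_normD.
  by lra.
rewrite rintegralZ; last exact: cc_integrable c' h'.
rewrite convE; congr (_ * _); rewrite -(cc_shift z c' h'); apply: eq_rintegral => y.
by rewrite addrK; have -> : x - (y + z) = x - z - y by ring.
Qed.

Lemma rintegral_conv u v : tame u -> tame v ->
  \int[mu]_x conv u v x = (\int[mu]_x u x) * (\int[mu]_x v x).
Proof.
move=> tu tv.
have [r1 r10 h1] := tame_csupp tu; have [r2 r20 h2] := tame_csupp tv.
have [C C0 hC] := tame_bounded tv.
pose r := r1 + r2.
(* The bound [C] on [v] is not integrable in [x]; it becomes so after the cut-off at [r1 + r2],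
   outside of which the integrand vanishes. *)
pose b x := C * \1_(`[- r, r] : set (measurableTypeR R)) x.
pose f y x := u y * v (x - y).
have mf : measurable_fun setT (fun p : measurableTypeR R * measurableTypeR R => f p.1 p.2).
  apply: measurable_funM.
  - by apply: measurableT_comp => //; exact: tame_measurable.
  - by apply: (measurableT_comp (tame_measurable tv)); apply: measurable_funB.
have ia : rintegrable mu (fun z => `|u z|) by apply: rintegrable_norm; exact: tame_integrable.
have ib : rintegrable mu b.
  by apply: rintegrableZ; exact: integrable_indic_itv.
have fab y x : `|f y x| <= `|u y| * b x.
  have [yr|yr] := ltP r1 `|y|; first by rewrite /f h1// mul0r normr0 mul0r.
  rewrite /f normrM ler_wpM2l// /b indicE.
  case: (boolP (x \in _)) => xr; first by rewrite mulr1.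
  rewrite h2 ?normr0 ?mulr0//.
  have : r < `|x|.
    rewrite ltNge; apply: contra xr => xr.
    by rewrite inE /= in_itv /= -ler_norml.
  have : `|x| <= `|x - y| + `|y| by rewrite -[x in `|x| <= _](subrK y) ler_normD.
  by rewrite /r; lra.
under eq_rintegral do rewrite convE.
rewrite -(rfubini mf ia ib fab) /f.
transitivity (\int[mu]_y (u y * \int[mu]_x v x)).
  apply: eq_rintegral => y; rewrite rintegralZ.
    by rewrite (cc_shift (- y) (tame_continuous tv) h2).
  apply: tame_integrable.
  by have := tame_affine (- y) (oner_neq0 R) tv; under eq_fun do rewrite mul1r.
by rewrite rintegralZr//; exact: tame_integrable.
Qed.

(** For [s > 0] this normalisation preserves the integral and the L_1 norm and makes dilation
    multiplicative for convolution. *)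
Definition dil s u x := s * u (s * x).

Lemma tame_dil s u : tame u -> tame (dil s u).
Proof.
move=> tu; have [->|s0] := eqVneq s 0.
  by rewrite /dil; under eq_fun do rewrite mul0r; exact: tame0.
by apply: tameZ; have := tame_affine 0 s0 tu; under eq_fun do rewrite addr0.
Qed.

Lemma conv_dil s u v : 0 < s -> tame u -> tame v ->
  conv (dil s u) (dil s v) = dil s (conv u v).
Proof.
move=> s0 tu tv; apply/funext => x; rewrite /dil !convE.
have [c [r _ h]] := tame_mul_cc tu (tame_translate_neg (s * x) tv).
have sn0 : s != 0 by rewrite gt_eqF.
transitivity (\int[mu]_y (s * s * (u (s * y + 0) * v (s * x - (s * y + 0))))).
  by apply: eq_rintegral => y; rewrite mulrBr addr0; ring.
rewrite rintegralZ; last first.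
  have := cc_integrable (@continuous_affine _ _ s 0 c) (@csupp_affine _ r _ s 0 sn0 h).
  by [].
by rewrite (cc_affine 0 c h sn0) gtr0_norm// mulrA -(mulrA s s) mulfV// mulr1.
Qed.

Lemma rintegral_dil s u : 0 < s -> tame u -> \int[mu]_x dil s u x = \int[mu]_x u x.
Proof.
move=> s0 tu; rewrite /dil; have [r _ h] := tame_csupp tu.
have sn0 : s != 0 by rewrite gt_eqF.
rewrite rintegralZ; last first.
  apply: tame_integrable.
  by have := tame_affine 0 sn0 tu; under eq_fun do rewrite addr0.
under eq_rintegral do rewrite -[s * _]addr0.
by rewrite (cc_affine 0 (tame_continuous tu) h sn0) gtr0_norm// mulrA mulfV// mul1r.
Qed.

Lemma rintegral_norm_dil s u : 0 < s -> tame u ->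
  \int[mu]_x `|dil s u x| = \int[mu]_x `|u x|.
Proof.
move=> s0 tu; rewrite /dil; have [r _ h] := tame_csupp tu.
have sn0 : s != 0 by rewrite gt_eqF.
have c : continuous (fun x => `|u x|).
  move=> x; apply: continuous_comp; [exact: tame_continuous|exact: norm_continuous].
have hn : csupp r (fun x => `|u x|) by move=> x xr; rewrite h ?normr0.
transitivity (\int[mu]_x (s * `|u (s * x + 0)|)).
  by apply: eq_rintegral => x; rewrite normrM gtr0_norm// addr0.
rewrite rintegralZ; last first.
  exact: cc_integrable (@continuous_affine _ _ s 0 c) (@csupp_affine _ r _ s 0 sn0 hn).
by rewrite (cc_affine 0 c hn sn0) gtr0_norm// mulrA mulfV// mul1r.
Qed.

Lemma csupp_dil r s u : 0 < s -> csupp r u -> csupp (r / s) (dil s u).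
Proof.
move=> s0 h x; rewrite ltr_pdivrMr// => xr; rewrite /dil h ?mulr0//.
by rewrite normrM gtr0_norm// mulrC.
Qed.

End convolution.

(** * A reproducing formula for the local means *)

Section calderon.
Context {R : realType}.
Local Notation mu := (@lebesgue_measure R).
Implicit Types (e f g F u v w : R -> R) (r s t x : R).

Fact csub_key : unit. Proof. exact: tt. Qed.
(** Multiplication by 1 - e in the convolution algebra, with 1 the unit mass at 0. It annihilates
    integrals when [e] has integral 1. *)
Definition csub e u := locked_with csub_key (fun x => u x - conv e u x).

Lemma csubE e u : csub e u = (fun x => u x - conv e u x).
Proof. by rewrite /csub unlock. Qed.

Lemma tame_csub e u : tame e -> tame u -> tame (csub e u).
Proof. by move=> te tu; rewrite csubE; apply: tameB => //; exact: tame_conv. Qed.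

Lemma tame_iter_csub n e u : tame e -> tame u -> tame (iter n (csub e) u).
Proof. by move=> te tu; elim: n => [|n IH] //=; exact: tame_csub. Qed.

Lemma conv_csubl e u v : tame e -> tame u -> tame v ->
  conv (csub e u) v = csub e (conv u v).
Proof.
move=> te tu tv; have teu := tame_conv te tu.
rewrite convC//; last exact: tame_csub.
rewrite !csubE (convBr tv tu teu); apply/funext => x.
by rewrite (convC tv tu) (convC tv teu) convA.
Qed.

Lemma conv_iter_csubl n e u v : tame e -> tame u -> tame v ->
  conv (iter n (csub e) u) v = iter n (csub e) (conv u v).
Proof.
move=> te tu tv; elim: n => [|n IH] //=.
by rewrite conv_csubl// ?IH//; exact: tame_iter_csub.
Qed.

Lemma csubB e u v : tame e -> tame u -> tame v ->
  csub e (fun x => u x - v x) = (fun x => csub e u x - csub e v x).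
Proof.
move=> te tu tv; have teu := tame_conv te tu; have tev := tame_conv te tv.
by apply/funext => x; rewrite !csubE (convBr te tu tv); ring.
Qed.

Lemma iter_csubB n e u v : tame e -> tame u -> tame v ->
  iter n (csub e) (fun x => u x - v x) = (fun x => iter n (csub e) u x - iter n (csub e) v x).
Proof.
move=> te tu tv; elim: n => [|n IH] //=.
by rewrite IH csubB//; exact: tame_iter_csub.
Qed.

Lemma csubC e f u : tame e -> tame f -> tame u ->
  csub e (csub f u) = csub f (csub e u).
Proof.
move=> te tf tu; have teu := tame_conv te tu; have tfu := tame_conv tf tu.
rewrite !csubE (convBr te tu tfu) (convBr tf tu teu).
apply/funext => x.
rewrite -(convA te tf tu) -(convA tf te tu) (convC te tf).
by move: (conv f u x) (conv e u x) (conv _ _ x) => a b c; ring.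
Qed.

Lemma iter_csubC n e f u : tame e -> tame f -> tame u ->
  csub e (iter n (csub f) u) = iter n (csub f) (csub e u).
Proof.
move=> te tf tu; elim: n => [|n IH] //=.
by rewrite csubC// ?IH//; exact: tame_iter_csub.
Qed.

Lemma rintegral_csub e u : tame e -> tame u -> \int[mu]_x e x = 1 ->
  \int[mu]_x csub e u x = 0.
Proof.
move=> te tu e1; have teu := tame_conv te tu.
rewrite !csubE rintegralB; [|exact: tame_integrable|exact: tame_integrable].
by rewrite rintegral_conv// e1 mul1r subrr.
Qed.

Lemma is_derive_tame_prim u x : tame u -> is_derive x 1 (prim u) (u x).
Proof.
move=> tu; have [r _ h] := tame_csupp tu.
exact: is_derive_prim (tame_continuous tu) h.
Qed.

(** To the right of the support the primitive equals the full integral of [u], so the vanishing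
    integral is what keeps its support compact. *)
Lemma tame_prim u : tame u -> \int[mu]_x u x = 0 -> tame (prim u).
Proof.
move=> tu u0; have [r r0 h] := tame_csupp tu.
apply: (@tame_antiderivative _ r _ _ _ _ tu).
  by move=> x; exact: is_derive_tame_prim.
move=> x xr; have [x0|x0] := leP 0 x.
  by rewrite (primT (tame_continuous tu) h)// -(ger0_norm x0) ltW.
by rewrite (prim0 h)// ltrNr -(ltr0_norm x0).
Qed.

(** Integration by parts: the difference of the two integrands is the derivative in [y] of
    [prim u y * v (x - y)], which has compact support. *)
Lemma conv_prim u v v' : tame u -> \int[mu]_x u x = 0 -> tame v -> tame v' ->
  (forall x, is_derive x 1 v (v' x)) -> conv (prim u) v' = conv u v.
Proof.
move=> tu u0 tv tv' dv; apply/funext => x; rewrite !convE.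
have tp := tame_prim tu u0.
have i1 := conv_integrable x tp tv'; have i2 := conv_integrable x tu tv.
apply/esym/eqP; rewrite -subr_eq0 -rintegralB//; apply/eqP.
have [c1 [r1 r10 h1]] := tame_mul_cc tp (tame_translate_neg x tv').
have [c2 [r2 r20 h2]] := tame_mul_cc tu (tame_translate_neg x tv).
have [_ [r3 r30 h3]] := tame_mul_cc tp (tame_translate_neg x tv).
pose r := Num.max r1 (Num.max r2 r3) + 1.
have [r1r r2r r3r] : [/\ r1 < r, r2 < r & r3 < r].
  by rewrite /r; split; rewrite ltr_pwDr// !le_max lexx ?orbT.
have h : csupp r (fun y => u y * v (x - y) - prim u y * v' (x - y)).
  move=> y yr; rewrite (h1 y) ?(h2 y) ?subrr//; exact: lt_trans yr.
have c : continuous (fun y => u y * v (x - y) - prim u y * v' (x - y)).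
  by move=> y; apply: cvgB; [exact: c2|exact: c1].
have dF (y : R) : is_derive y (1 : R) (fun y : R => prim u y * v (x - y))
    (u y * v (x - y) - prim u y * v' (x - y)).
  have d1 := is_derive_tame_prim y tu.
  have d2 : is_derive y 1 (fun y : R => x - y) (-1).
    by apply: is_derive_eq; rewrite add0r mul1r.
  have d3 := @is_derive1_comp R v (fun y => x - y) y _ _ (dv (x - y)) d2.
  have d4 := is_deriveM d1 d3.
  apply: (is_derive_eq d4); rewrite /GRing.scale /=; ring.
rewrite (@cc_FTC R r (- r - 1) (r + 1) _ _ c h dF); [|lra|lra|lra].
by rewrite !h3 ?subrr// ltr_normr; apply/orP; [right|left]; lra.
Qed.

Definition smooth1 f := forall n x, derivable (derive1n n f) x 1.

Lemma smooth1_derive n f x : smooth1 f ->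
  is_derive x 1 (derive1n n f) (derive1n n.+1 f x).
Proof. by move=> sf; exact: is_derive_derive1n. Qed.

Lemma derive1n_dil c s f n : smooth1 f ->
  derive1n n (fun x => c * f (s * x)) = (fun x => c * s ^+ n * derive1n n f (s * x)).
Proof.
move=> sf; elim: n => [|n IH]; first by rewrite expr0 mulr1.
rewrite derive1nS IH; apply/funext => x.
have d2 : is_derive x 1 (fun x : R => s * x) s.
  by apply: is_derive_eq; rewrite /GRing.scale /= mulr1.
have d3 := @is_derive1_comp R _ (fun y => s * y) x _ _ (smooth1_derive n (s * x) sf) d2.
have d4 := is_deriveZ (c * s ^+ n) d3.
have -> : (fun x0 => c * s ^+ n * derive1n n f (s * x0)) =
  (c * s ^+ n) \*: (derive1n n f \o (fun y => s * y)) by [].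
by rewrite derive1E derive_val /GRing.scale /= exprS; ring.
Qed.

Lemma smooth1_dil c s f : smooth1 f -> smooth1 (fun x => c * f (s * x)).
Proof.
move=> sf n x; rewrite derive1n_dil//.
have d2 : is_derive x 1 (fun x : R => s * x) s.
  by apply: is_derive_eq; rewrite /GRing.scale /= mulr1.
have d3 := @is_derive1_comp R _ (fun y => s * y) x _ _ (smooth1_derive n (s * x) sf) d2.
have d4 := is_deriveZ (c * s ^+ n) d3.
exact: ex_derive.
Qed.

Lemma derive1nB f g n : smooth1 f -> smooth1 g ->
  derive1n n (fun x => f x - g x) = (fun x => derive1n n f x - derive1n n g x).
Proof.
move=> sf sg; elim: n => [|n IH] //.
rewrite derive1nS IH; apply/funext => x.
have d := is_deriveB (smooth1_derive n x sf) (smooth1_derive n x sg).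
by rewrite derive1E; exact: derive_val.
Qed.

Lemma smooth1B f g : smooth1 f -> smooth1 g -> smooth1 (fun x => f x - g x).
Proof.
move=> sf sg n x; rewrite derive1nB//.
have d := is_deriveB (smooth1_derive n x sf) (smooth1_derive n x sg).
exact: ex_derive.
Qed.

Lemma csupp_derive1n r f n : smooth1 f -> csupp r f -> csupp r (derive1n n f).
Proof.
move=> sf h; elim: n => [|n IH] //.
exact: csupp_derive (fun x => smooth1_derive n x sf) IH.
Qed.

Lemma smooth1_derive1n f n : smooth1 f -> smooth1 (derive1n n f).
Proof.
move=> sf m x; suff -> : derive1n m (derive1n n f) = derive1n (m + n) f by exact: sf.
by elim: m => [|m IH] //; rewrite addSn !derive1nS IH.
Qed.

Lemma tame_derive1n r f n : smooth1 f -> csupp r f -> tame (derive1n n f).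
Proof.
move=> sf h; apply: (@tame_smooth _ r); first exact: smooth1_derive1n.
exact: csupp_derive1n.
Qed.

(* An antiderivative of [u - e * u], compactly supported when [e] has integral 1. *)
Definition cprim e u := prim (csub e u).

Lemma tame_iter_cprim n e u : tame e -> \int[mu]_x e x = 1 -> tame u ->
  tame (iter n (cprim e) u).
Proof.
move=> te e1 tu; elim: n => [|n IH] //=.
by apply: tame_prim; [exact: tame_csub|exact: rintegral_csub].
Qed.

(** Each [cprim] absorbs one derivative of [v] and leaves behind one factor 1 - e. *)
Lemma conv_iter_cprim n m e u v r : tame e -> \int[mu]_x e x = 1 -> tame u ->
  smooth1 v -> csupp r v ->
  conv (iter n (cprim e) u) (derive1n (n + m) v) = iter n (csub e) (conv u (derive1n m v)).
Proof.
move=> te e1 tu sv h; elim: n => [|n IH] //.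
have tn := tame_iter_cprim n te e1 tu.
have tv k : tame (derive1n k v) by exact: tame_derive1n h.
have tc : tame (csub e (iter n (cprim e) u)) by exact: tame_csub.
have ic := rintegral_csub te tn e1.
rewrite addSn !iterS /cprim (@conv_prim _ _ _ tc ic (tv _) (tv _) (fun x => smooth1_derive (n + m) x sv)).
by rewrite conv_csubl// IH.
Qed.

(* In the convolution algebra, [1 - (1 - e) ^+ L.+1 = cinv L e]; so [u - cinv L e * u]
   is [L.+1] applications of [csub e]. *)
Definition cinv L e x := \sum_(a < L.+1) iter a (csub e) e x.

Lemma tame_cinv L e : tame e -> tame (cinv L e).
Proof. by move=> te; apply: tame_sum => a; exact: tame_iter_csub. Qed.

(** Writing e as 1 - (1 - e) turns each summand of [cinv] into a difference of consecutive powers,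
    so that the sum telescopes. *)
Lemma iter_csub_conv n e u x : tame e -> tame u ->
  iter n (csub e) (conv e u) x = iter n (csub e) u x - iter n.+1 (csub e) u x.
Proof.
move=> te tu; rewrite iterSr.
have -> : conv e u = (fun x => u x - csub e u x).
  by apply/funext => y; rewrite csubE opprB addrC subrK.
by rewrite iter_csubB//; exact: tame_csub.
Qed.

Lemma conv_cinv L e u : tame e -> tame u ->
  conv (cinv L e) u = (fun x => u x - iter L.+1 (csub e) u x).
Proof.
move=> te tu; rewrite convC//; last exact: tame_cinv.
rewrite /cinv conv_sumr//; last by move=> a; exact: tame_iter_csub.
apply/funext => x.
rewrite (eq_bigr (fun a : 'I_L.+1 => iter a (csub e) u x - iter a.+1 (csub e) u x)).
  elim: (L.+1) => [|n IH]; first by rewrite big_ord0 subrr.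
  by rewrite big_ord_recr /= IH; ring.
move=> a _; rewrite convC//; last exact: tame_iter_csub.
by rewrite conv_iter_csubl// iter_csub_conv.
Qed.

(** Integrals multiply under convolution, and the product of [cinv L e] with [e] differs from [e] by
    a [csub], whose integral is 0. *)
Lemma rintegral_cinv L e : tame e -> \int[mu]_x e x = 1 -> \int[mu]_x cinv L e x = 1.
Proof.
move=> te e1; have tc := tame_cinv L te.
rewrite -[LHS]mulr1 -e1 -rintegral_conv// conv_cinv//.
rewrite rintegralB; [|exact: tame_integrable|by apply: tame_integrable; exact: tame_iter_csub].
by rewrite e1 rintegral_csub ?subr0//; exact: tame_iter_csub.
Qed.

Lemma csub_dil s e u : 0 < s -> tame e -> tame u ->
  csub (dil s e) (dil s u) = dil s (csub e u).
Proof.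
by move=> s0 te tu; apply/funext => x; rewrite !csubE conv_dil// /dil mulrBr.
Qed.

Lemma cinv_dil L s e : 0 < s -> tame e -> cinv L (dil s e) = dil s (cinv L e).
Proof.
move=> s0 te; apply/funext => x; rewrite /cinv /dil mulr_sumr.
apply: eq_bigr => a _.
suff -> n : iter n (csub (dil s e)) (dil s e) = dil s (iter n (csub e) e) by [].
elim: n => [|n IH] //=.
by rewrite IH csub_dil//; exact: tame_iter_csub.
Qed.

(** Subtracting the two identities cancels [a], and the mixed products cancel by commutativity. *)
Lemma conv_difference_of_squares w0 w1 x a z0 z1 : tame w0 -> tame w1 ->
  conv w0 (fun x => w0 x + w1 x) x = a - z0 ->
  conv w1 (fun x => w0 x + w1 x) x = a - z1 ->
  z0 - z1 = conv w1 w1 x - conv w0 w0 x.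
Proof.
move=> tw0 tw1; rewrite (convDr tw0 tw0 tw1) (convDr tw1 tw0 tw1) (convC tw1 tw0).
move: (conv w0 w0 x) (conv w0 w1 x) (conv w1 w1 x) => b c d; lra.
Qed.

(* Products are convolutions.  Let e_0 = Psi0, e_1 = dil 2 Psi0, a_i = 1 - e_i and
   w_i = cinv L e_i, so that a_i^(L+1) = 1 - w_i, and chi = w_0^2, dil 2 chi = w_1^2.  Then
   w_1^2 - w_0^2 = (a_0^(L+1) - a_1^(L+1)) (w_0 + w_1), which is (e_1 - e_0) times the sum of the
   a_0^a a_1^(L-a) (w_0 + w_1); each of these has a compactly supported L-fold
   antiderivative, and the L derivatives are moved onto e_1 - e_0. *)
Lemma reproducing_pair (L : nat) (Psi0 : R -> R) : smooth1 Psi0 -> csupp 1 Psi0 ->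
  \int[mu]_x Psi0 x = 1 ->
  exists Phi0 Phi1 chi : R -> R, [/\ tame Phi0, tame Phi1, tame chi &
    [/\ \int[mu]_x chi x = 1, conv Phi0 Psi0 = chi &
    conv Phi1 (local_mean1 L Psi0) = (fun x => dil 2 chi x - chi x)]].
Proof.
move=> sP hP iP.
have te0 : tame Psi0 by exact: tame_smooth hP.
pose e0 := Psi0; pose e1 := dil 2 Psi0.
have te1 : tame e1 by exact: tame_dil.
have ie1 : \int[mu]_x e1 x = 1 by rewrite rintegral_dil.
pose w0 := cinv L e0; pose w1 := cinv L e1.
have tw0 : tame w0 by exact: tame_cinv.
have tw1 : tame w1 by exact: tame_cinv.
pose om x := w0 x + w1 x.
have tom : tame om by exact: tameD.
pose v x := 2 * Psi0 (2 * x) - Psi0 x.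
have sv : smooth1 v by exact: (smooth1B (@smooth1_dil 2 2 _ sP) sP).
have hv : csupp 1 v.
  move=> x x1; rewrite /v !hP ?mulr0 ?subrr//.
  by rewrite normrM gtr0_norm//; lra.
have tv : tame v by exact: tame_smooth hv.
pose T (a : 'I_L.+1) := iter a (cprim e0) (iter (L - a) (cprim e1) om).
have tT a : tame (T a) by do 2!apply: tame_iter_cprim => //.
(* Every summand of [cinv L e0] has a factor [e0]. Removing one such factor from the square of [w0]
   gives the first kernel, so convolving it with [Psi0] restores the square. *)
exists (fun x => \sum_(a < L.+1) iter a (csub e0) w0 x), (fun x => \sum_(a < L.+1) T a x),
  (conv w0 w0); split.
- by apply: tame_sum => a; exact: tame_iter_csub.
- exact: tame_sum.
- exact: tame_conv.
split.
- by rewrite rintegral_conv// rintegral_cinv// mulr1.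
- rewrite convC//; last by apply: tame_sum => a; exact: tame_iter_csub.
  rewrite conv_sumr//; last by move=> a; exact: tame_iter_csub.
  rewrite -[RHS]/(conv w0 (fun x => \sum_(a < L.+1) iter a (csub e0) e0 x)).
  rewrite [RHS]conv_sumr//; last by move=> a; exact: tame_iter_csub.
  apply/funext => x; apply: eq_bigr => a _.
  have ti f : tame f -> tame (iter a (csub e0) f) by exact: tame_iter_csub.
  rewrite (convC te0 (ti _ tw0)) (convC tw0 (ti _ te0)) !conv_iter_csubl//.
  by rewrite (convC tw0 te0).
- rewrite convC//; [|exact: tame_sum|exact: tame_derive1n hv].
  rewrite conv_sumr//; last exact: tame_derive1n hv.
  have key (a : 'I_L.+1) : conv (local_mean1 L Psi0) (T a) = (fun x =>
      iter a.+1 (csub e0) (iter (L.+1 - a.+1) (csub e1) om) x -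
      iter a (csub e0) (iter (L.+1 - a) (csub e1) om) x).
    rewrite convC//; last exact: tame_derive1n hv.
    have aL : (a <= L)%N by rewrite -ltnS.
    have -> : local_mean1 L Psi0 = derive1n (a + (L - a)) v by rewrite subnKC.
    rewrite /T (conv_iter_cprim _ _ te0 iP _ sv hv); last exact: tame_iter_cprim.
    rewrite -[X in derive1n X]addn0 (conv_iter_cprim _ _ te1 ie1 tom sv hv) derive1n0.
    (* Since e_1 - e_0 = (1 - e_0) - (1 - e_1), the term of index [a] becomes a difference of
       consecutive terms. *)
    have -> : conv om v = (fun x => csub e0 om x - csub e1 om x).
      have -> : v = (fun x => e1 x - e0 x) by [].
      rewrite convBr// (convC tom te1) (convC tom te0); apply/funext => x.
      by rewrite !csubE; ring.
    have ts e : tame e -> tame (csub e om) by move=> te; exact: tame_csub.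
    rewrite iter_csubB ?iter_csubB//; try exact: ts; try (apply: tame_iter_csub => //; exact: ts).
    apply/funext => x; congr (_ - _).
      by rewrite subSS iterSr -iter_csubC.
    by rewrite -iterSr subSn.
  under eq_fun => x do under eq_bigr => a _ do rewrite key.
  apply/funext => x.
  have tele n : (n <= L.+1)%N -> \sum_(i < n)
      (iter i.+1 (csub e0) (iter (L.+1 - i.+1) (csub e1) om) x -
      iter i (csub e0) (iter (L.+1 - i) (csub e1) om) x) =
      iter n (csub e0) (iter (L.+1 - n) (csub e1) om) x - iter L.+1 (csub e1) om x.
    elim: n => [|n IH] nL; first by rewrite big_ord0 subn0 subrr.
    by rewrite big_ord_recr /= IH 1?ltnW//=; ring.
  rewrite tele// subnn /=.
  have /(congr1 (@^~ x)) /= q0 := conv_cinv L te0 tom.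
  have /(congr1 (@^~ x)) /= q1 := conv_cinv L te1 tom.
  have -> : dil 2 (conv w0 w0) = conv w1 w1.
    by rewrite /w1 /e1 cinv_dil// conv_dil.
  exact: (conv_difference_of_squares tw0 tw1 q0 q1).
Qed.

(** Level 0 is undilated and level [j'.+1] is dilated by [2 ^+ j'], which is the indexing of
    [local_mean]. *)
Definition dyadic (Phi0 Phi1 : R -> R) (j : nat) : R -> R :=
  if j is j'.+1 then dil (2 ^+ j') Phi1 else Phi0.

Lemma local_mean_dyadic L Psi0 j : local_mean L Psi0 j = dyadic Psi0 (local_mean1 L Psi0) j.
Proof. by case: j. Qed.

Lemma tame_dyadic (Phi0 Phi1 : R -> R) j : tame Phi0 -> tame Phi1 -> tame (dyadic Phi0 Phi1 j).
Proof. by move=> t0 t1; case: j => // j; exact: tame_dil. Qed.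

(** Level [j.+1] contributes the dilate of [chi] by [2 ^+ j.+1] minus that by [2 ^+ j], and the sum
    telescopes. *)
Lemma sum_conv_dyadic (Phi0 Phi1 Psi0 Psi1 chi : R -> R) J :
  tame Phi0 -> tame Phi1 -> tame Psi0 -> tame Psi1 ->
  conv Phi0 Psi0 = chi -> conv Phi1 Psi1 = (fun x => dil 2 chi x - chi x) ->
  (fun x => \sum_(j < J.+1) conv (dyadic Phi0 Phi1 j) (dyadic Psi0 Psi1 j) x) =
  dil (2 ^+ J) chi.
Proof.
move=> tF0 tF1 tP0 tP1 h0 h1; apply/funext => x; elim: J => [|J IH].
  by rewrite big_ord_recl big_ord0 addr0 /= h0 /dil expr0 !mul1r.
have J0 : 0 < 2 ^+ J :> R by rewrite exprn_gt0.
rewrite big_ord_recr /= IH (conv_dil J0 tF1 tP1) h1 /dil exprSr !mulrA -(mulrC 2 (2 ^+ J)) mulrBr.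
have -> : 2 * 2 ^+ J * x = 2 * (2 ^+ J * x) by rewrite mulrA.
ring.
Qed.

End calderon.

(** * Poisson summation and exponential sums *)

Section fejer.
Context {R : realType}.
Local Notation mu := (@lebesgue_measure R).
Implicit Types (f g : R -> R) (r s t x w : R).

Lemma continuous_cos_affine a b : continuous (fun x : R => cos (a * x + b)).
Proof. exact: (@continuous_affine _ _ a b (@continuous_cos R)). Qed.

Lemma pi_bounds : 2 <= (pi : R).
Proof. exact: pi_ge2. Qed.

(** By the mean value theorem [sin x = cos c * x] with c below pi / 4, and [cos (c + c) >= 0] means
    that the square of [cos c] is at least 1/2. *)
Lemma sin_ge_quarter x : 0 <= x <= pi / 4 -> x ^+ 2 <= 2 * sin x ^+ 2.
Proof.
move=> /andP[x0 x4]; have [->|xn0] := eqVneq x 0.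
  by rewrite expr0n sin0 expr0n mulr0.
have {}x0 : 0 < x by rewrite lt_neqAle eq_sym xn0.
have p2 := pi_bounds.
have [c cx] := @MVT R sin cos 0 x x0 (fun z _ => is_derive_sin z)
  (continuous_subspaceT (@continuous_sin R)).
rewrite sin0 !subr0 => ->; rewrite exprMn mulrA -{1}[x ^+ 2]mul1r.
apply: ler_wpM2r; first exact: sqr_ge0.
move: cx; rewrite in_itv /= => /andP[c0 cx].
have : 0 <= cos (c + c).
  have := @cos_ge0_pihalf R (c + c); apply; lra.
by rewrite cosD; have := cos2Dsin2 c; rewrite !expr2; lra.
Qed.

Lemma sin_ge_half x : `|x| <= pi / 2 -> x ^+ 2 <= 4 * sin x ^+ 2.
Proof.
wlog x0 : x / 0 <= x => [H|].
  have [/H//|xn] := leP 0 x.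
  move=> hx; have := H (- x); rewrite normrN sqrrN sinN sqrrN; apply => //.
  by rewrite oppr_ge0 ltW.
rewrite ger0_norm// => x2; pose y := x / 2.
have -> : x = y + y by rewrite /y; lra.
have y0 : 0 <= y <= pi / 4 by rewrite /y; have := pi_bounds; lra.
have h := sin_ge_quarter y0.
have cy : 1 / 2 <= cos y ^+ 2.
  have : 0 <= cos (y + y).
    have := @cos_ge0_pihalf R (y + y); apply; have := pi_bounds; rewrite /y; lra.
  by rewrite cosD; have := cos2Dsin2 y; rewrite !expr2; lra.
have -> : sin (y + y) = 2 * (sin y * cos y) by rewrite sinD; ring.
rewrite !exprMn.
have s0 : 0 <= sin y ^+ 2 by exact: sqr_ge0.
have -> : (y + y) ^+ 2 = 4 * y ^+ 2 by ring.
nra.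
Qed.

Lemma sin_pi_ge x : `|x| <= 1 / 2 -> x ^+ 2 <= sin (pi * x) ^+ 2.
Proof.
move=> hx; have p2 := pi_bounds.
have p0 : 0 < (pi : R) by exact: pi_gt0.
have := @sin_ge_half (pi * x); rewrite normrM (gtr0_norm p0) => /(_ _)H.
have : pi * `|x| <= pi / 2 by nra.
move/H; rewrite exprMn => h.
have : 4 * x ^+ 2 <= pi ^+ 2 * x ^+ 2.
  apply: ler_wpM2r; first exact: sqr_ge0.
  by rewrite expr2; nra.
lra.
Qed.

(** The kernel [M^-1 * |sum_(a < M) exp (2 pi i a w)|^2], expanded over pairs so that the weights
    [M - |h|] of the frequencies stay implicit. *)
Definition fejer (M : nat) w : R :=
  M%:R^-1 * \sum_(a < M) \sum_(b < M) cos (2 * pi * (a%:R - b%:R) * w).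

Lemma fejerE M w : fejer M w = M%:R^-1 *
  ((\sum_(a < M) cos (2 * pi * a%:R * w)) ^+ 2 + (\sum_(a < M) sin (2 * pi * a%:R * w)) ^+ 2).
Proof.
rewrite /fejer; congr (_ * _); rewrite !expr2 !big_distrlr /= -big_split /=.
apply: eq_bigr => a _; rewrite -big_split /=; apply: eq_bigr => b _.
by rewrite -cosB; congr cos; ring.
Qed.

Lemma fejer_ge0 M w : 0 <= fejer M w.
Proof. by rewrite fejerE mulr_ge0// addr_ge0// sqr_ge0. Qed.

(** The factor [2 * sin (pi * w)] makes the sum telescope by the addition formulas. *)
Lemma dirichlet_cos M w : 2 * sin (pi * w) * (\sum_(a < M) cos (2 * pi * a%:R * w)) =
  sin (pi * w) + sin (2 * pi * M%:R * w - pi * w).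
Proof.
elim: M => [|M IH]; first by rewrite big_ord0 mulr0 !mulr0 mul0r sub0r sinN subrr.
rewrite big_ord_recr /= mulrDr IH.
have -> : 2 * pi * M.+1%:R * w - pi * w = 2 * pi * M%:R * w + pi * w by rewrite -natr1; ring.
by rewrite sinB sinD; ring.
Qed.

Lemma dirichlet_sin M w : 2 * sin (pi * w) * (\sum_(a < M) sin (2 * pi * a%:R * w)) =
  cos (pi * w) - cos (2 * pi * M%:R * w - pi * w).
Proof.
elim: M => [|M IH]; first by rewrite big_ord0 mulr0 !mulr0 mul0r sub0r cosN subrr.
rewrite big_ord_recr /= mulrDr IH.
have -> : 2 * pi * M.+1%:R * w - pi * w = 2 * pi * M%:R * w + pi * w by rewrite -natr1; ring.
by rewrite cosB cosD; ring.
Qed.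

(** By the closed forms, the squared modulus of the Dirichlet sum times [4 * sin (pi * w) ^+ 2]
    equals [2 - 2 * cos (2 * pi * M * w)], which is at most 4. *)
Lemma fejer_sin M w : sin (pi * w) ^+ 2 * fejer M w <= M%:R^-1.
Proof.
rewrite fejerE mulrCA -[leRHS]mulr1 ler_wpM2l//.
have hc := dirichlet_cos M w; have hs := dirichlet_sin M w.
set C := \sum_(a < M) _ in hc *; set S := \sum_(a < M) _ in hs *.
set b := 2 * pi * M%:R * w - pi * w in hc hs.
have : (2 * sin (pi * w) * C) ^+ 2 + (2 * sin (pi * w) * S) ^+ 2 <= 4.
  rewrite hc hs.
  have := cos2Dsin2 (pi * w); have := cos2Dsin2 b.
  have := cos_geN1 (pi * w + b); rewrite cosD; have := cos_le1 (pi * w + b); rewrite cosD.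
  rewrite !expr2; lra.
rewrite !expr2; lra.
Qed.

Lemma fejer_bound M w : (0 < M)%N -> `|w| <= 1 / 2 -> w ^+ 2 * fejer M w <= M%:R^-1.
Proof.
move=> M0 hw; apply: le_trans (fejer_sin M w).
by apply: ler_wpM2r; [exact: fejer_ge0|exact: sin_pi_ge].
Qed.

Lemma cos_period_int x (q : nat) : cos (x + 2 * pi * q%:R) = cos x.
Proof.
elim: q => [|q IH]; first by rewrite mulr0 addr0.
rewrite -[q.+1%:R]natr1 mulrDr mulr1 addrA -[RHS]IH.
have -> : x + 2 * pi * q%:R + 2 * pi = x + 2 * pi * q%:R + pi *+ 2 by rewrite -[pi *+ 2]mulr_natl.
by rewrite cosD2pi.
Qed.

Lemma fejer_periodic M w : fejer M (w + 1) = fejer M w.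
Proof.
rewrite /fejer; congr (_ * _); apply: eq_bigr => a _; apply: eq_bigr => b _.
have -> : 2 * pi * (a%:R - b%:R) * (w + 1) =
  2 * pi * (a%:R - b%:R) * w + 2 * pi * a%:R - 2 * pi * b%:R by ring.
by rewrite -[LHS](cos_period_int _ b) subrK cos_period_int.
Qed.

Lemma fejer_periodic_int M w (q : int) : fejer M (w + q%:~R) = fejer M w.
Proof.
have H (n : nat) v : fejer M (v + n%:R) = fejer M v.
  elim: n => [|n IH]; first by rewrite addr0.
  by rewrite -natr1 addrA fejer_periodic IH.
case: q => n; first exact: H.
by rewrite NegzE rmorphN /= -[RHS](H n.+1) -[in RHS](subrK n.+1%:R w) -{1}(H n.+1) !subrK.
Qed.

Lemma continuous_bigsum (I : Type) (s : seq I) (F : I -> R -> R) :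
  (forall i, continuous (F i)) -> continuous (fun x => \sum_(i <- s) F i x).
Proof.
move=> cF; elim: s => [|i s IH] x.
  by under eq_fun do rewrite big_nil; exact: cvg_cst.
rewrite /continuous_at big_cons; under eq_fun do rewrite big_cons.
by apply: cvgD; [exact: cF|exact: IH].
Qed.

Lemma continuous_fejer M : continuous (fejer M).
Proof.
have c : continuous (fun w : R => \sum_(a < M) \sum_(b < M) cos (2 * pi * (a%:R - b%:R) * w)).
  apply: continuous_bigsum => a; apply: continuous_bigsum => b w.
  have := @continuous_cos_affine (2 * pi * (a%:R - b%:R)) 0 w; rewrite /continuous_at addr0.
  by under eq_fun do rewrite addr0.
by move=> w; rewrite /fejer; apply: cvgMr; exact: c.
Qed.

Local Notation unit_itv := (`[- (1 / 2), 1 / 2]%classic : set R).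

Lemma unit_itv_integrable f : continuous f -> mu.-integrable unit_itv (EFin \o f).
Proof.
move=> cf; apply: continuous_compact_integrable; first exact: segment_compact.
exact: continuous_subspaceT.
Qed.

Lemma unit_itv_FTC f F : continuous f -> (forall x, is_derive x 1 F (f x)) ->
  \int[mu]_(x in unit_itv) f x = F (1 / 2) - F (- (1 / 2)).
Proof.
move=> cf dF; rewrite /Rintegral.
have cF : continuous F.
  by move=> x; apply: differentiable_continuous; apply/derivable1_diffP; exact: ex_derive.
rewrite (@continuous_FTC2 _ f F (- (1 / 2)) (1 / 2)).
- by rewrite -EFinB.
- by lra.
- exact: continuous_subspaceT.
- split.
  + by move=> x _; exact: ex_derive.
  + exact: cvg_at_right_filter (cF _).
  + exact: cvg_at_left_filter (cF _).
- by move=> x _; rewrite derive1E derive_val.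
Qed.

Lemma unit_itv_sum (I : Type) (s : seq I) (F : I -> R -> R) :
  (forall i, continuous (F i)) ->
  \int[mu]_(x in unit_itv) (\sum_(i <- s) F i x) =
  \sum_(i <- s) \int[mu]_(x in unit_itv) F i x.
Proof.
move=> cF; elim: s => [|i s IH].
  rewrite big_nil; under eq_Rintegral do rewrite big_nil.
  by rewrite /Rintegral integral0.
rewrite big_cons -IH -RintegralD//.
- by apply: eq_Rintegral => x _; rewrite big_cons.
- exact: unit_itv_integrable.
- by apply: unit_itv_integrable; exact: continuous_bigsum.
Qed.

Lemma rintegral_unit_itv_cos a b : \int[mu]_(x in unit_itv) cos (2 * pi * (a%:R - b%:R) * x)
  = (a == b)%:R.
Proof.
have [->|ab] := eqVneq a b.
  rewrite subrr mulr0; under eq_Rintegral do rewrite mul0r cos0.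
  have -> := @unit_itv_FTC (fun _ => 1) id (fun x => cvg_cst _) (fun x => is_derive_id x 1).
  by rewrite opprK (_ : true%:R = 1 :> R)//; lra.
pose c : R := 2 * pi * (a%:R - b%:R).
have c0 : c != 0.
  apply: mulf_neq0; last by rewrite subr_eq0 eqr_nat.
  by apply: mulf_neq0 => //; rewrite gt_eqF// pi_gt0.
have cc : continuous (fun x : R => cos (c * x)).
  move=> w; have := @continuous_cos_affine c 0 w; rewrite /continuous_at addr0.
  by under eq_fun do rewrite addr0.
have dF x : is_derive x 1 (fun x => c^-1 * sin (c * x)) (cos (c * x)).
  have d2 : is_derive x 1 (fun x : R => c * x) c.
    by apply: is_derive_eq; rewrite /GRing.scale /= mulr1.
  have d3 := @is_derive1_comp R sin (fun y => c * y) x _ _ (is_derive_sin (c * x)) d2.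
  have d4 := is_deriveZ c^-1 d3.
  by apply: (is_derive_eq d4); rewrite /GRing.scale /= mulrCA mulVf ?mulr1.
rewrite (@unit_itv_FTC _ (fun x => c^-1 * sin (c * x)) cc dF).
rewrite -mulrBr mulrN sinN opprK.
have -> : c * (1 / 2) = pi * a%:R - pi * b%:R by rewrite /c; lra.
rewrite sinB.
have sp (n : nat) : sin (pi * n%:R : R) = 0.
  elim: n => [|n IH]; first by rewrite mulr0 sin0.
  by rewrite -natr1 mulrDr mulr1 sinDpi IH oppr0.
by rewrite !sp mulr0 mul0r subrr addr0 mulr0.
Qed.

Lemma rintegral_fejer M : (0 < M)%N -> \int[mu]_(x in unit_itv) fejer M x = 1.
Proof.
move=> M0; have cc (a b : nat) : continuous (fun x : R => cos (2 * pi * (a%:R - b%:R) * x)).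
  move=> w; have := @continuous_cos_affine (2 * pi * (a%:R - b%:R)) 0 w; rewrite /continuous_at addr0.
  by under eq_fun do rewrite addr0.
rewrite /fejer RintegralZl//; last first.
  apply: unit_itv_integrable.
  by apply: continuous_bigsum => a; apply: continuous_bigsum => b; exact: cc.
rewrite unit_itv_sum; last by move=> a; apply: continuous_bigsum => b; exact: cc.
rewrite (eq_bigr (fun _ => 1)).
  by rewrite sumr_const card_ord -[_ *+ _]mulr_natl mulr1 mulVf// pnatr_eq0 -lt0n.
move=> a _; rewrite unit_itv_sum// (bigD1 a)//= rintegral_unit_itv_cos eqxx big1 ?addr0//.
move=> b ba; rewrite rintegral_unit_itv_cos.
by have -> : (a == b :> nat) = false by rewrite eq_sym; exact: negbTE.
Qed.

(** The [2 * T + 1] unit intervals around the integers from -T to T cover the support; with a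
    primitive the sum telescopes. *)
Lemma rintegral_unfold (T : nat) h : continuous h -> csupp T%:R h ->
  \int[mu]_x h x = \sum_(q < 2 * T + 1) \int[mu]_(x in unit_itv) h (x + (q%:R - T%:R)).
Proof.
move=> ch hh.
pose F q := prim h (q%:R - T%:R - 1 / 2).
have T0 : 0 <= T%:R :> R by [].
have -> : \int[mu]_x h x = F (2 * T + 1)%N - F 0%N.
  apply: (cc_FTC ch hh); [|rewrite natrD natrM; lra|lra|rewrite natrD natrM; lra].
  by move=> x; exact: is_derive_prim ch hh.
have step (q : nat) : \int[mu]_(x in unit_itv) h (x + (q%:R - T%:R)) = F q.+1 - F q.
  have ch' : continuous (fun x => h (x + (q%:R - T%:R))).
    move=> x; have := @continuous_affine _ _ 1 (q%:R - T%:R) ch x; rewrite /continuous_at mul1r.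
    by under eq_fun do rewrite mul1r.
  have dF x : is_derive x 1 (fun x => prim h (x + (q%:R - T%:R))) (h (x + (q%:R - T%:R))).
    have d2 : is_derive x 1 (fun x : R => x + (q%:R - T%:R)) 1.
      by apply: is_derive_eq; rewrite addr0.
    have := @is_derive1_comp R _ (fun y => y + (q%:R - T%:R)) x _ _ (@is_derive_prim _ _ h _ ch hh) d2.
    by rewrite mulr1.
  rewrite (@unit_itv_FTC _ (fun x => prim h (x + (q%:R - T%:R))) ch' dF).
  by rewrite /F -[q.+1%:R]natr1; congr (prim h _ - prim h _); lra.
under eq_bigr do rewrite step.
elim: (2 * T + 1)%N => [|n IH]; first by rewrite big_ord0 subrr.
by rewrite big_ord_recr /= -IH; ring.
Qed.

Lemma continuous_shift f t : continuous f -> continuous (fun x => f (x + t)).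
Proof.
move=> cf x; have := @continuous_affine _ _ 1 t cf x; rewrite /continuous_at mul1r.
by under eq_fun do rewrite mul1r.
Qed.

Lemma fejer_unfold (T M : nat) r g x : tame g -> csupp r g -> `|x| + r <= T%:R ->
  \int[mu]_z (g z * fejer M (x - z)) =
  \sum_(q < 2 * T + 1) \int[mu]_(z in unit_itv) (g (x - (q%:R - T%:R) - z) * fejer M z).
Proof.
move=> tg hg xT.
have cg := tame_continuous tg.
have cf := @continuous_fejer M.
have c1 : continuous (fun z => g z * fejer M (x - z)).
  by move=> z; apply: cvgM; [exact: cg|exact: (@continuous_reflect _ _ x cf)].
have h1 : csupp r (fun z => g z * fejer M (x - z)) by move=> z /hg ->; rewrite mul0r.
have c2 : continuous (fun z => g (x - z) * fejer M z).
  by move=> z; apply: cvgM; [exact: (@continuous_reflect _ _ x cg)|exact: cf].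
have h2 : csupp T%:R (fun z => g (x - z) * fejer M z).
  move=> z zT; rewrite hg ?mul0r//.
  have : `|z| <= `|x - z| + `|x| by rewrite distrC -[z in `|z| <= _](subrK x) ler_normD.
  by lra.
rewrite -(cc_reflect x c1 h1).
transitivity (\int[mu]_z (g (x - z) * fejer M z)).
  by apply: eq_rintegral => z; congr (_ * fejer M _); lra.
rewrite (rintegral_unfold c2 h2); apply: eq_bigr => q _.
apply: eq_Rintegral => z _ /=.
have -> : x - (z + (q%:R - T%:R)) = x - (q%:R - T%:R) - z by lra.
by have := fejer_periodic_int M z (q%:Z - T%:Z); rewrite rmorphB /= => ->.
Qed.

Lemma continuous_normf f : continuous f -> continuous (fun x => `|f x|).
Proof. by move=> cf x; apply: continuous_comp; [exact: cf|exact: norm_continuous]. Qed.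

(** The Lipschitz bound leaves the first absolute moment of the kernel. The inequality
    [|z| <= e + z^2 / e] splits it into the total mass 1 and the second-moment bound
    [fejer_bound]. *)
Lemma fejer_approx1 (M : nat) C e g x : (0 < M)%N -> 0 < e -> 0 < C -> continuous g ->
  (forall y z, `|g y - g z| <= C * `|y - z|) ->
  `|\int[mu]_(z in unit_itv) (g (x - z) * fejer M z) - g x| <= C * (e + (e * M%:R)^-1).
Proof.
move=> M0 e0 C0 cg hC.
have cf := @continuous_fejer M.
have c2 : continuous (fun z => g (x - z) * fejer M z).
  by move=> z; apply: cvgM; [exact: (@continuous_reflect _ _ x cg)|exact: cf].
have c3 : continuous (fun z => g x * fejer M z) by move=> z; apply: cvgMr; exact: cf.
have -> : g x = \int[mu]_(z in unit_itv) (g x * fejer M z).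
  by rewrite RintegralZl ?rintegral_fejer ?mulr1//; exact: unit_itv_integrable.
rewrite -RintegralB//; [|exact: unit_itv_integrable|exact: unit_itv_integrable].
have c4 : continuous (fun z => g (x - z) * fejer M z - g x * fejer M z).
  by move=> z; apply: cvgB; [exact: c2|exact: c3].
have c5 : continuous (fun z => C * (e * fejer M z + (e * M%:R)^-1)).
  by move=> z; apply: cvgMr; apply: cvgD; [apply: cvgMr; exact: cf|exact: cvg_cst].
have c6 : continuous (fun z => e * fejer M z + (e * M%:R)^-1).
  by move=> z; apply: cvgD; [apply: cvgMr; exact: cf|exact: cvg_cst].
have c7 : continuous (fun z : R => e * fejer M z) by move=> z; apply: cvgMr; exact: cf.
have c8 : continuous (fun _ : R => (e * M%:R)^-1) by move=> z; exact: cvg_cst.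
apply: (le_trans (le_normr_Rintegral _ (unit_itv_integrable c4))); first exact: measurable_itv.
apply: (@le_trans _ _ (\int[mu]_(z in unit_itv) (C * (e * fejer M z + (e * M%:R)^-1)))).
  apply: le_Rintegral => //.
  - have c9 : continuous (fun z => `|g (x - z) * fejer M z - g x * fejer M z|).
      exact: (continuous_normf c4).
    exact: unit_itv_integrable c9.
  - exact: unit_itv_integrable c5.
  - move=> z; rewrite /= in_itv /= -ler_norml => hz.
    rewrite -mulrBl normrM (ger0_norm (fejer_ge0 M z)).
    apply: (@le_trans _ _ (C * `|z| * fejer M z)).
      apply: ler_wpM2r; first exact: fejer_ge0.
      by have := hC (x - z) x; rewrite addrAC subrr sub0r normrN.
    rewrite -mulrA; apply: ler_wpM2l; first exact: ltW.
    have F0 := fejer_ge0 M z; have Fb := fejer_bound M0 hz.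
    have : e * (`|z| * fejer M z) <= e * e * fejer M z + M%:R^-1.
      apply: (@le_trans _ _ ((e * e + z ^+ 2) * fejer M z)); last by rewrite mulrDl lerD2l.
      rewrite mulrA; apply: ler_wpM2r => //.
      rewrite -[z ^+ 2]real_normK ?num_real// expr2.
      have := normr_ge0 z; have := sqr_ge0 (`|z| - e); rewrite expr2; nra.
    rewrite invfM; have -> : e * fejer M z + e^-1 * M%:R^-1 = e^-1 * (e * e * fejer M z + M%:R^-1).
      by rewrite mulrDr !mulrA mulVf ?mul1r// gt_eqF.
    by rewrite ler_pdivlMl.
rewrite RintegralZl; [|exact: measurable_itv|exact: unit_itv_integrable c6].
rewrite RintegralD; [|exact: measurable_itv|exact: unit_itv_integrable c7|exact: unit_itv_integrable c8].
rewrite RintegralZl; [|exact: measurable_itv|exact: unit_itv_integrable cf].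
rewrite rintegral_fejer// mulr1.
have -> : \int[mu]_(x in unit_itv) (e * M%:R)^-1 = (e * M%:R)^-1.
  rewrite Rintegral_cst//= lebesgue_measure_itv /= lte_fin.
  by rewrite ifT; [rewrite /= opprK (_ : 1 / 2 + 1 / 2 = 1) ?mulr1//; lra|lra].
exact: lexx.
Qed.

(** This is the Poisson summation used below: the Fejer means of the periodisation of [g] converge
    to it pointwise, and [T] is large enough to include all translates that meet the support. *)
Lemma fejer_cvg (T : nat) r g x : tame g -> csupp r g -> `|x| + r <= T%:R ->
  (fun M => \int[mu]_z (g z * fejer M (x - z))) @ \oo -->
  \sum_(q < 2 * T + 1) g (x - (q%:R - T%:R)).
Proof.
move=> tg hg xT; have [C C0 hC] := tame_lipschitz tg.
have cg := tame_continuous tg.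
apply/cvgrPdist_le => e e0.
pose K : R := (2 * T + 1)%:R * C.
have K0 : 0 < K by rewrite mulr_gt0// ltr0n addn1.
(* Each of the [2 * T + 1] translates is allowed the error [C * (d + d)], and [K * (d + d) = e]; the
   second [d] requires M to be at least d^-2. *)
pose d := e / (2 * K).
have d0 : 0 < d by rewrite divr_gt0// mulr_gt0.
have dd : d + d = e / K by rewrite /d invfM; field; rewrite gt_eqF.
clearbody d.
near=> M.
have M0 : (0 < M)%N by near: M; exists 1.
rewrite distrC (fejer_unfold _ tg hg xT) -sumrB (le_trans (ler_norm_sum _ _ _))//.
apply: (@le_trans _ _ (\sum_(q < 2 * T + 1) C * (d + (d * M%:R)^-1))).
  by apply: ler_sum => q _; exact: fejer_approx1.
rewrite sumr_const card_ord -[_ *+ _]mulr_natl mulrA -/K.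
have : (d * M%:R)^-1 <= d.
  rewrite -[leRHS]invrK lef_pV2 ?posrE ?invr_gt0 ?mulr_gt0 ?ltr0n//.
  rewrite mulrC -ler_pdivrMr//; near: M.
  by exists (Num.truncn (d^-1 / d)).+1 => // n /= hn; rewrite ltW// (lt_le_trans (truncnS_gt _))// ler_nat.
move=> hd; apply: (@le_trans _ _ (K * (d + d))).
  by rewrite ler_wpM2l ?lerD2l// ltW.
by rewrite dd mulrCA mulfV ?mulr1// gt_eqF.
Unshelve. all: by end_near. Qed.

End fejer.

(** * Complex exponentials *)

Section complex_exponentials.
Context {R : realType}.
Implicit Types (x y t : R) (z : R[i]).

Definition ei t : R[i] := expi (2 * pi * t).

Lemma eiD x y : ei (x + y) = ei x * ei y.
Proof.
rewrite /ei /expi mulrDr cosD sinD; congr (Complex _ _).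
by rewrite addrC [cos _ * sin _]mulrC (mulrC (sin (2 * pi * x))) addrC mulrC [sin _ * _]mulrC.
Qed.

Lemma ei0 : ei 0 = 1.
Proof. by rewrite /ei /expi mulr0 cos0 sin0. Qed.

Lemma ei_sum (I : Type) (s : seq I) (F : I -> R) :
  ei (\sum_(i <- s) F i) = \prod_(i <- s) ei (F i).
Proof.
by elim: s => [|i s IH]; rewrite ?big_nil ?ei0// !big_cons eiD IH.
Qed.

Lemma normc_sqr z : normc z ^+ 2 = complex.Re z ^+ 2 + complex.Im z ^+ 2.
Proof. by case: z => a b; rewrite /normc /= sqr_sqrtr// addr_ge0// sqr_ge0. Qed.

Lemma normc_ge0 z : 0 <= normc z.
Proof. by case: z => a b; exact: sqrtr_ge0. Qed.

Lemma normc_ei x : normc (ei x) = 1.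
Proof. by rewrite /normc /ei /expi cos2Dsin2 sqrtr1. Qed.

Lemma normc_real x : normc (x%:C)%C = `|x|.
Proof. by rewrite /normc /= expr0n /= addr0 sqrtr_sqr. Qed.

Lemma le_normc_ReIm z : normc z <= `|complex.Re z| + `|complex.Im z|.
Proof.
rewrite -(ler_pXn2r (n := 2))// ?nnegrE ?normc_ge0 ?addr_ge0//.
rewrite normc_sqr -[complex.Re z ^+ 2]real_normK ?num_real//.
rewrite -[complex.Im z ^+ 2]real_normK ?num_real// sqrrD.
have : 0 <= `|complex.Re z| * `|complex.Im z| by rewrite mulr_ge0.
by rewrite -mulr_natl; lra.
Qed.

Lemma Re_le_normc z : `|complex.Re z| <= normc z.
Proof.
rewrite -(ler_pXn2r (n := 2))// ?nnegrE ?normc_ge0//.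
by rewrite normc_sqr real_normK ?num_real// lerDl sqr_ge0.
Qed.

Lemma Im_le_normc z : `|complex.Im z| <= normc z.
Proof.
rewrite -(ler_pXn2r (n := 2))// ?nnegrE ?normc_ge0//.
by rewrite normc_sqr real_normK ?num_real// lerDr sqr_ge0.
Qed.

Lemma normc_sum (I : Type) (s : seq I) (P : pred I) (F : I -> R[i]) :
  normc (\sum_(i <- s | P i) F i) <= \sum_(i <- s | P i) normc (F i).
Proof.
elim/big_ind2: _ => [|a b c d h1 h2|i _].
- by rewrite normc0.
- by rewrite (le_trans (le_normcD _ _))// lerD.
- exact: lexx.
Qed.

Lemma normc_prod (I : Type) (s : seq I) (P : pred I) (F : I -> R[i]) :
  normc (\prod_(i <- s | P i) F i) = \prod_(i <- s | P i) normc (F i).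
Proof.
elim/big_rec2: _ => [|i a b _ <-]; first exact: normc1.
exact: normcM.
Qed.

Lemma normcX z n : normc (z ^+ n) = normc z ^+ n.
Proof. by elim: n => [|n IH]; rewrite ?expr0 ?normc1// !exprS normcM IH. Qed.

Lemma ei_nat (n : nat) : ei n%:R = 1.
Proof.
elim: n => [|n IH]; first exact: ei0.
rewrite -natr1 eiD IH mul1r /ei /expi mulr1.
have -> : 2 * pi = 0 + pi *+ 2 :> R by rewrite add0r mulr_natl.
by rewrite cosD2pi sinD2pi cos0 sin0.
Qed.

Lemma ei_int (q : int) : ei q%:~R = 1.
Proof.
case: q => n; first exact: ei_nat.
rewrite NegzE rmorphN /=.
have := eiD (- n.+1%:R) n.+1%:R; rewrite addNr ei0 ei_nat mulr1 => <-.
by [].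
Qed.

(** The modulus of [ei x - 1] is twice that of [sin (pi * (x - q))], and [sin_pi_ge] bounds it
    below. *)
Lemma normc_ei_sub1 x (q : int) : `|x - q%:~R| <= 1 / 2 ->
  2 * `|x - q%:~R| <= normc (ei x - 1).
Proof.
move=> h; set y := x - q%:~R in h *.
have -> : ei x = ei y by rewrite -[RHS]mulr1 -(ei_int q) -eiD /y subrK.
have hs := sin_pi_ge h.
rewrite -(ler_pXn2r (n := 2))// ?nnegrE ?normc_ge0 ?mulr_ge0//.
rewrite exprMn real_normK ?num_real// normc_sqr /=.
have -> : 2 * pi * y = pi * y + pi * y by ring.
rewrite cosD sinD; have := cos2Dsin2 (pi * y).
move: hs; set c := cos _; set s := sin _; rewrite !expr2 => hs h1.
have -> : (c * c - s * s - 1) * (c * c - s * s - 1) + (s * c + c * s - 0) * (s * c + c * s - 0)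
  = (c * c + s * s - 1) * (c * c + s * s - 1) + 4 * (s * s) by ring.
rewrite h1; lra.
Qed.

End complex_exponentials.

(** * Fourier transforms of compactly supported kernels *)

Section fourier_coefficients.
Context {R : realType}.
Local Notation mu := (@lebesgue_measure R).
Implicit Types (f g : R -> R) (r s t x w : R).

Definition fhat g xi : R[i] :=
  Complex (\int[mu]_z (g z * cos (2 * pi * xi * z))) (- \int[mu]_z (g z * sin (2 * pi * xi * z))).

(** With a phase [b] allowed, cosine integrals cover the sine integrals too, so estimates are proved
    only for [cos (a * z + b)]. *)
Lemma sinE x : sin x = cos (x - pi / 2) :> R.
Proof. by rewrite cosBpihalf. Qed.

Lemma cc_mul_cos g r a b : continuous g -> csupp r g ->
  continuous (fun z => g z * cos (a * z + b)) /\ csupp r (fun z => g z * cos (a * z + b)).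
Proof.
move=> cg hg; split.
  by move=> z; apply: cvgM; [exact: cg|exact: continuous_cos_affine].
by move=> z /hg ->; rewrite mul0r.
Qed.

Lemma mul_cos_integrable g r a b : continuous g -> csupp r g ->
  rintegrable mu (fun z => g z * cos (a * z + b)).
Proof. by move=> cg hg; have [c h] := cc_mul_cos a b cg hg; exact: cc_integrable c h. Qed.

Lemma mul_cos0_integrable g r a : continuous g -> csupp r g ->
  rintegrable mu (fun z => g z * cos (a * z)).
Proof.
move=> cg hg; have := mul_cos_integrable a 0 cg hg.
by under [X in rintegrable _ X -> _]eq_fun do rewrite addr0.
Qed.

Lemma mul_sin_integrable g r a : continuous g -> csupp r g ->
  rintegrable mu (fun z => g z * sin (a * z)).
Proof.
move=> cg hg; have := mul_cos_integrable a (- (pi / 2)) cg hg.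
by under [X in rintegrable _ X -> _]eq_fun do rewrite -sinE.
Qed.

Lemma fhat_conv_cos g r h x : continuous g -> csupp r g ->
  \int[mu]_z (g z * cos (2 * pi * h * (x - z))) = complex.Re (fhat g h * ei (h * x)).
Proof.
move=> cg hg; rewrite /fhat /ei /expi /=.
have e1 := mul_cos0_integrable (2 * pi * h) cg hg.
have e2 := mul_sin_integrable (2 * pi * h) cg hg.
rewrite mulNr opprK -!rintegralZr// -rintegralD.
- apply: eq_rintegral => z.
  have -> : 2 * pi * h * (x - z) = 2 * pi * (h * x) - 2 * pi * h * z by ring.
  by rewrite cosB; ring.
- by move: e1 => /(rintegrableZ (cos (2 * pi * (h * x)))); apply: eq_integrable => // z _ /=; rewrite mulrC.
- by move: e2 => /(rintegrableZ (sin (2 * pi * (h * x)))); apply: eq_integrable => // z _ /=; rewrite mulrC.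
Qed.

Lemma fhatN g r h : continuous g -> csupp r g ->
  fhat g (- h) = Complex (complex.Re (fhat g h)) (- complex.Im (fhat g h)).
Proof.
move=> cg hg; rewrite /fhat /=; congr Complex.
  by apply: eq_rintegral => z; rewrite mulrN mulNr cosN.
have e2 := mul_sin_integrable (2 * pi * h) cg hg.
rewrite opprK -[RHS]opprK -[X in - X = _]opprK; congr (- _).
rewrite -[in RHS]mulN1r -rintegralZ//.
by rewrite opprK; apply: eq_rintegral => z; rewrite mulrN mulNr sinN mulrN mulN1r.
Qed.

Lemma Re_sum (I : Type) (s : seq I) (F : I -> R[i]) :
  complex.Re (\sum_(i <- s) F i) = \sum_(i <- s) complex.Re (F i).
Proof.
elim: s => [|i s IH]; first by rewrite !big_nil.
by rewrite !big_cons -IH; move: (F i) (\sum_(_ <- _) _) => [? ?] [? ?].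
Qed.

Lemma Im_sum (I : Type) (s : seq I) (F : I -> R[i]) :
  complex.Im (\sum_(i <- s) F i) = \sum_(i <- s) complex.Im (F i).
Proof.
elim: s => [|i s IH]; first by rewrite !big_nil.
by rewrite !big_cons -IH; move: (F i) (\sum_(_ <- _) _) => [? ?] [? ?].
Qed.

(** Exchanging [a] and [b] conjugates the terms, so the double sum is real; its real part is the
    kernel integral term by term. *)
Lemma fejer_fhat (M : nat) g r x : continuous g -> csupp r g ->
  (\int[mu]_z (g z * fejer M (x - z)))%:C%C =
  (M%:R^-1)%:C%C * \sum_(a < M) \sum_(b < M)
     (fhat g (a%:R - b%:R) * ei ((a%:R - b%:R) * x)) :> R[i].
Proof.
move=> cg hg.
pose S (a b : nat) : R[i] := fhat g (a%:R - b%:R) * ei ((a%:R - b%:R) * x).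
have SJ a b : complex.Im (S b a) = - complex.Im (S a b).
  rewrite /S -[b%:R - a%:R]opprB (fhatN _ cg hg) mulNr.
  have -> y : ei (- y) = Complex (complex.Re (ei y)) (- complex.Im (ei y)).
    by rewrite /ei /expi /= mulrN cosN sinN.
  move: (fhat g _) (ei _) => [u v] [u' v'] /=; ring.
have Im0 : complex.Im (\sum_(a < M) \sum_(b < M) S a b) = 0.
  set z := complex.Im _.
  have : z = - z.
    rewrite {1}/z exchange_big /= Im_sum /z Im_sum -sumrN; apply: eq_bigr => a _.
    by rewrite !Im_sum -sumrN; apply: eq_bigr => b _; exact: SJ.
  by lra.
have Re1 : \int[mu]_z (g z * fejer M (x - z)) =
    M%:R^-1 * complex.Re (\sum_(a < M) \sum_(b < M) S a b).
  have ci (a b : nat) : rintegrable mu (fun z => g z * cos (2 * pi * (a%:R - b%:R) * (x - z))).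
    have := mul_cos_integrable (- (2 * pi * (a%:R - b%:R))) (2 * pi * (a%:R - b%:R) * x) cg hg.
    apply: eq_integrable => // z _ /=; congr (_ * cos _)%:E; ring.
  rewrite Re_sum; under eq_bigr do rewrite Re_sum.
  under eq_bigr => a _ do under eq_bigr => b _ do rewrite /S -(fhat_conv_cos _ _ cg hg).
  under eq_bigr => a _ do rewrite -rintegral_sum//.
  rewrite -rintegral_sum; last by move=> a _; exact: rintegrable_sum.
  rewrite -rintegralZ; last by apply: rintegrable_sum => a _; exact: rintegrable_sum.
  apply: eq_rintegral => z; rewrite /fejer mulrCA; congr (_ * _).
  by rewrite mulr_sumr; apply: eq_bigr => a _; rewrite mulr_sumr.
rewrite Re1 -[in RHS]/(S _ _); move: Im0.
case: (\sum_(a < M) _) => u v /= ->.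
by apply/eqP; rewrite eq_complex /= !mulr0 mul0r subr0 addr0 !eqxx.
Qed.

(** The step is half a period: translating by it changes the sign of the cosine, so each difference
    multiplies the integral by -2. This takes the place of integration by parts. *)
Lemma fdiff_cos_integral A g r xi b : continuous g -> csupp r g -> xi != 0 ->
  \int[mu]_z (iter A (fdiff (2 * xi)^-1) g z * cos (2 * pi * xi * z + b)) =
  (- 2) ^+ A * \int[mu]_z (g z * cos (2 * pi * xi * z + b)).
Proof.
move=> cg hg xi0; pose t := (2 * xi)^-1; rewrite -/t.
elim: A => [|A IH]; first by rewrite expr0 mul1r.
have cA := continuous_fdiff (A := A) (t := t) cg.
have hA : csupp (r + A%:R * `|t|) (iter A (fdiff t) g) by exact: csupp_fdiff.
have [c1 h1] := cc_mul_cos (2 * pi * xi) b cA hA.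
have i1 := cc_integrable c1 h1.
have -> I : (-2) ^+ A.+1 * I = -2 * ((-2) ^+ A * I) by rewrite exprS mulrA.
rewrite -IH.
transitivity (\int[mu]_z (- (iter A (fdiff t) g (z + t) * cos (2 * pi * xi * (z + t) + b)) -
    iter A (fdiff t) g z * cos (2 * pi * xi * z + b))).
  apply: eq_rintegral => z; rewrite fdiffS.
  have -> : 2 * pi * xi * (z + t) + b = 2 * pi * xi * z + b + pi.
    by rewrite mulrDr /t; field.
  by rewrite cosDpi; ring.
have c2 : continuous (fun z => iter A (fdiff t) g (z + t) * cos (2 * pi * xi * (z + t) + b)).
  exact: (@continuous_shift _ _ t c1).
have i2 : rintegrable mu (fun z => iter A (fdiff t) g (z + t) * cos (2 * pi * xi * (z + t) + b)).
  have := csupp_affine (t := t) (oner_neq0 R) h1.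
  under [X in csupp _ X -> _]eq_fun do rewrite mul1r.
  exact: cc_integrable.
under eq_Rintegral do rewrite -mulN1r.
rewrite rintegralB//; last exact: rintegrableZ.
rewrite rintegralZ// (cc_shift t c1 h1); ring.
Qed.

Lemma fhat_le g r b xi : continuous g -> csupp r g ->
  `|\int[mu]_z (g z * cos (2 * pi * xi * z + b))| <= \int[mu]_z `|g z|.
Proof.
move=> cg hg; have i1 := mul_cos_integrable (2 * pi * xi) b cg hg.
apply: (le_trans (norm_rintegral i1)); apply: le_rintegral.
- exact: rintegrable_norm.
- by apply: rintegrable_norm; exact: cc_integrable cg hg.
- move=> z; rewrite normrM -[leRHS]mulr1 ler_wpM2l//.
  by rewrite ler_norml cos_geN1 cos_le1.
Qed.

(** The [A]-th difference with step [(2 * xi)^-1] is bounded by tameness. For [|xi| >= 1] the step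
    is at most 1, so the support of the difference stays in a fixed interval. *)
Lemma fhat_decay A g : tame g -> exists2 C, 0 <= C & forall xi b,
  `|\int[mu]_z (g z * cos (2 * pi * xi * z + b))| <= C /\
  (1 <= `|xi| -> `|\int[mu]_z (g z * cos (2 * pi * xi * z + b))| * `|xi| ^+ A <= C).
Proof.
move=> tg; have [r r0 hg] := tame_csupp tg; have cg := tame_continuous tg.
have [C hC] := tame_fdiff A tg.
have C0 : 0 <= C by have := hC 1 0; rewrite normr1 expr1n mulr1; exact: le_trans.
pose D := C * (2 * (r + A%:R)).
have D0 : 0 <= D by rewrite /D mulr_ge0// mulr_ge0// addr_ge0.
exists (\int[mu]_z `|g z| + D); first by rewrite addr_ge0// rintegral_ge0.
move=> xi b; split; first by rewrite (le_trans (fhat_le b xi cg hg))// lerDl.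
move=> xi1; have xi0 : xi != 0 by rewrite -normr_gt0 (lt_le_trans _ xi1).
have := fdiff_cos_integral A b cg hg xi0.
set t := (2 * xi)^-1; set I := \int[mu]_z (g z * _) => e.
have t1 : `|t| <= 1.
  rewrite /t normrV ?unitfE ?mulf_neq0// normrM (ger0_norm (x := 2))//.
  by rewrite invf_le1 ?mulr_gt0 ?normr_gt0//; lra.
have cA := continuous_fdiff (A := A) (t := t) cg.
have hA : csupp (r + A%:R) (iter A (fdiff t) g).
  by apply: (@csuppW _ _ _ _ _ (@csupp_fdiff _ A r t g hg)); rewrite lerD2l ler_piMr.
have : `|(-2) ^+ A * I| <= C * `|t| ^+ A * (2 * (r + A%:R)).
  rewrite -e; apply: (le_trans (fhat_le b xi cA hA)).
  by apply: cc_norm_le => //; rewrite addr_ge0.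
rewrite normrM normrX normrN (ger0_norm (x := 2))//.
have tE : `|t| ^+ A * (2 ^+ A * `|xi| ^+ A) = 1.
  rewrite -!exprMn /t normrV ?unitfE ?mulf_neq0// normrM (ger0_norm (x := 2))//.
  by rewrite mulVf ?expr1n// mulf_neq0// normr_eq0.
have p1 : 0 <= `|xi| ^+ A by rewrite exprn_ge0.
move=> /(ler_wpM2r p1) h.
apply: (@le_trans _ _ D); last by rewrite lerDr rintegral_ge0.
have two1 : 1 <= 2 ^+ A :> R by rewrite exprn_ege1// ler1n.
have q0 : 0 < 2 ^+ A :> R by rewrite exprn_gt0.
rewrite -(ler_pM2l q0).
apply: (@le_trans _ _ (2 ^+ A * `|I| * `|xi| ^+ A)); first by rewrite mulrA.
apply: (le_trans h); rewrite -(ler_pM2l q0).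
have -> : 2 ^+ A * (C * `|t| ^+ A * (2 * (r + A%:R)) * `|xi| ^+ A) =
  D * (`|t| ^+ A * (2 ^+ A * `|xi| ^+ A)) by rewrite /D; ring.
rewrite tE mulr1 mulrA ler_peMl// -[leLHS]mulr1 ler_pM//.
Qed.

(* Bounds a quantity that decays like [X ^ - A] by a superposition of indicator
   functions of dyadic balls, which turns weighted sums into counting. *)
Lemma layer_cake (A T : nat) (C w X : R) : 0 <= C -> 0 <= w <= C ->
  (1 <= X -> w * X ^+ A <= C) -> X <= 2 ^+ T ->
  w <= C * 2 ^+ A * \sum_(t < T.+1) (2 ^+ A) ^- t * (X <= 2 ^+ t)%R%:R.
Proof.
move=> C0 /andP[w0 wC] hw.
have q1 : 1 <= 2 ^+ A :> R by rewrite exprn_ege1// ler1n.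
have q0 : 0 < 2 ^+ A :> R by rewrite exprn_gt0.
have term0 (t : nat) : 0 <= (2 ^+ A) ^- t * (X <= 2 ^+ t)%R%:R :> R.
  by rewrite mulr_ge0// invr_ge0 exprn_ge0// ltW.
elim: T => [|T IH] XT.
  rewrite big_ord_recl big_ord0 addr0 /= expr0 invr1 mul1r.
  rewrite expr0 in XT; rewrite XT mulr1.
  by rewrite (le_trans wC)// ler_peMr.
have [XT'|XT'] := leP X (2 ^+ T).
  rewrite (le_trans (IH XT'))// ler_wpM2l//; first by rewrite mulr_ge0// ltW.
  by rewrite [leRHS]big_ord_recr /= lerDl.
(* On the shell between [2 ^+ T] and [2 ^+ T.+1] the last summand alone suffices; the factor
   [2 ^+ A] pays for replacing [X] by the lower end of the shell. *)
rewrite big_ord_recr /= XT mulr1.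
have X1 : 1 <= X by rewrite (le_trans _ (ltW XT'))// exprn_ege1// ler1n.
apply: (@le_trans _ _ (C * 2 ^+ A * (2 ^+ A) ^- T.+1)); last first.
  rewrite ler_wpM2l//; first by rewrite mulr_ge0// ltW.
  by rewrite lerDr sumr_ge0.
have e : 2 ^+ A * (2 ^+ A) ^- T.+1 = (2 ^+ T) ^- A :> R.
  by rewrite exprS invfM mulrA mulfV ?mul1r ?gt_eqF// -!exprM mulnC.
rewrite -mulrA e ler_pdivlMr ?exprn_gt0// (le_trans _ (hw X1))//.
by rewrite ler_wpM2l// lerXn2r ?nnegrE ?exprn_ge0// ltW// (lt_trans _ XT')// exprn_gt0.
Qed.

Lemma fhat_layer A g : tame g -> exists2 C, 0 <= C & forall xi (T : nat), `|xi| <= 2 ^+ T ->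
  normc (fhat g xi) <= C * \sum_(t < T.+1) (2 ^+ A) ^- t * (`|xi| <= 2 ^+ t)%R%:R.
Proof.
move=> tg; have [C C0 hC] := fhat_decay A tg.
exists (C *+ 2 * 2 ^+ A); first by rewrite mulr_ge0 ?mulrn_wge0// exprn_ge0.
move=> xi T xT.
have [a1 a2] := hC xi 0; have [b1 b2] := hC xi (- (pi / 2)).
have nf : normc (fhat g xi) <= `|\int[mu]_z (g z * cos (2 * pi * xi * z + 0))| +
    `|\int[mu]_z (g z * cos (2 * pi * xi * z - pi / 2))|.
  apply: (le_trans (le_normc_ReIm _)); rewrite /fhat /= normrN.
  under [X in _ <= `|X| + _]eq_Rintegral do rewrite addr0.
  by under [X in _ <= _ + `|X|]eq_Rintegral do rewrite -sinE.
apply: layer_cake => //; first exact: mulrn_wge0.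
  by rewrite normc_ge0/= (le_trans nf)// mulr2n lerD.
move=> xi1; apply: (@le_trans _ _ ((`|\int[mu]_z (g z * cos (2 * pi * xi * z + 0))| +
    `|\int[mu]_z (g z * cos (2 * pi * xi * z - pi / 2))|) * `|xi| ^+ A)).
  by rewrite ler_wpM2r// exprn_ge0.
by rewrite mulrDl mulr2n lerD// ?a2// ?b2.
Qed.

Lemma fhat_dil g s xi : tame g -> 0 < s -> fhat (dil s g) xi = fhat g (xi / s).
Proof.
move=> tg s0; have [r _ hg] := tame_csupp tg; have cg := tame_continuous tg.
have sn0 : s != 0 by rewrite gt_eqF.
have key b : \int[mu]_z (dil s g z * cos (2 * pi * xi * z + b)) =
    \int[mu]_z (g z * cos (2 * pi * (xi / s) * z + b)).
  have [c h] := cc_mul_cos (2 * pi * (xi / s)) b cg hg.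
  transitivity (\int[mu]_z (s * (g (s * z + 0) * cos (2 * pi * (xi / s) * (s * z + 0) + b)))).
    apply: eq_rintegral => z; rewrite /dil addr0 mulrA; congr (_ * cos (_ + _)).
    by field.
  rewrite rintegralZ.
    by rewrite (cc_affine 0 c h sn0) gtr0_norm// mulVKf.
  exact: cc_integrable (@continuous_affine _ _ s 0 c) (@csupp_affine _ r _ s 0 sn0 h).
rewrite /fhat; congr (Complex _ (- _)).
  by have := key 0; under eq_Rintegral do rewrite addr0;
     under [in RHS]eq_Rintegral do rewrite addr0.
by have := key (- (pi / 2)); under eq_Rintegral do rewrite -sinE;
     under [in RHS]eq_Rintegral do rewrite -sinE.
Qed.

End fourier_coefficients.

(** * Exponential sums along an arithmetic progression *)

Section exponential_sums.
Context {R : realType}.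
Local Notation mu := (@lebesgue_measure R).
Implicit Types (f g F : R -> R) (r s t x beta : R).

(** Two counted indices differ by at most [2 * r * N], so all of them lie in an interval of integers
    that starts at the least one. *)
Lemma count_progression (W N : nat) x r : (0 < N)%N -> 0 <= r ->
  \sum_(n < W) (`|x + n%:R / N%:R| <= r)%R%:R <= 2 * r * N%:R + 1 :> R.
Proof.
move=> N0 r0; have NR : 0 < N%:R :> R by rewrite ltr0n.
pose P (n : nat) := `|x + n%:R / N%:R| <= r.
rewrite -natr_sum -(big_mkord xpredT (fun n => (P n : nat))) -big_mkcond /= sum1_count -size_filter.
set s := [seq n <- _ | _].
have [s0|[p ps]] : s = [::] \/ exists p, p \in s.
  by case: s => [|p s]; [left|right; exists p; rewrite mem_head].
  by rewrite s0 addr_ge0// mulr_ge0// mulr_ge0.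
pose k := Num.truncn (2 * r * N%:R).
have diff n m : P n -> P m -> (m <= n)%N -> (n - m <= k)%N.
  rewrite /P => hn hm mn; rewrite truncn_ge_nat; last by rewrite mulr_ge0// mulr_ge0.
  rewrite natrB//.
  have : `|(x + n%:R / N%:R) - (x + m%:R / N%:R)| <= 2 * r.
    by rewrite (le_trans (ler_normB _ _))//; lra.
  have -> : (x + n%:R / N%:R) - (x + m%:R / N%:R) = (n%:R - m%:R) / N%:R by ring.
  by rewrite -natrB// ger0_norm ?ler_pdivrMr// divr_ge0.
have ex : exists p, p \in s by exists p.
pose q := ex_minn ex.
have [qs qmin] : q \in s /\ forall n, n \in s -> (q <= n)%N by rewrite /q; case: ex_minnP.
have sub : {subset s <= iota q k.+1}.
  move=> n ns; rewrite mem_iota qmin// addnS ltnS /= -leq_subLR.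
  by apply: diff; [move: ns|move: qs|exact: qmin]; rewrite mem_filter => /andP[].
have := uniq_leq_size (filter_uniq _ (iota_uniq _ _)) sub.
rewrite size_iota -(ler_nat R) => /le_trans; apply.
by rewrite -natr1 lerD2r truncn_le mulr_ge0// mulr_ge0.
Qed.

(** Summation by parts, [A] times. The step is at most 1, so differences of order up to [A] widen
    the support by at most [A]; the window reaches beyond that on both sides and no boundary term
    survives. *)
Lemma abel_summation (W N A : nat) F r x beta : (0 < N)%N -> csupp r F ->
  x < - (r + A%:R) -> r + A%:R < x + W%:R / N%:R ->
  \sum_(n < W) (iter A (fdiff N%:R^-1) F (x + n%:R / N%:R))%:C%C * ei (n%:R * beta) =
  (ei (- beta) - 1) ^+ A * \sum_(n < W) (F (x + n%:R / N%:R))%:C%C * ei (n%:R * beta) :> R[i].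
Proof.
move=> N0 hF hx hW.
have vanish l y : (l <= A)%N -> r + A%:R < `|y| -> iter l (fdiff N%:R^-1) F y = 0.
  move=> lA hy; apply: (@csupp_fdiff _ l r _ _ hF).
  rewrite (le_lt_trans _ hy)// lerD2l ger0_norm ?invr_ge0//.
  rewrite (@le_trans _ _ l%:R)//; last by rewrite ler_nat.
  by rewrite ler_piMr// invf_le1 ?ltr0n// ler1n.
have v0 l : (l <= A)%N -> iter l (fdiff N%:R^-1) F x = 0.
  by move=> /vanish; apply; rewrite ltr_normr; apply/orP; right; lra.
have vW l : (l <= A)%N -> iter l (fdiff N%:R^-1) F (x + W%:R / N%:R) = 0.
  by move=> /vanish; apply; rewrite ltr_normr; apply/orP; left; lra.
suff H l : (l <= A)%N -> \sum_(n < W) (iter l (fdiff N%:R^-1) F (x + n%:R / N%:R))%:C%C * ei (n%:R * beta) =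
  (ei (- beta) - 1) ^+ l * \sum_(n < W) (F (x + n%:R / N%:R))%:C%C * ei (n%:R * beta) :> R[i].
  exact: H.
elim: l => [|l IH] lA; first by rewrite expr0 mul1r.
rewrite exprS -mulrA -IH 1?ltnW//.
pose u n : R[i] := (iter l (fdiff N%:R^-1) F (x + n%:R / N%:R))%:C%C.
have uS n : (iter l.+1 (fdiff N%:R^-1) F (x + n%:R / N%:R))%:C%C = u n.+1 - u n.
  rewrite fdiffS rmorphB /=; congr (_%:C%C - _); congr (iter _ _ _ _).
  by rewrite -[n.+1%:R]natr1 mulrDl mul1r addrA.
under eq_bigr do rewrite uS.
have u0 : u 0%N = 0 by rewrite /u mul0r addr0 v0// ltnW.
have uW : u W = 0 by rewrite /u vW// ltnW.
have tele n : \sum_(i < n) (u i.+1 - u i) * ei (i%:R * beta) =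
    (ei (- beta) - 1) * (\sum_(i < n) u i * ei (i%:R * beta)) + ei (- beta) * u n * ei (n%:R * beta).
  elim: n => [|n IHn]; first by rewrite !big_ord0 u0 !mulr0 mul0r addr0.
  rewrite !big_ord_recr /= IHn.
  have -> : ei (n%:R * beta) = ei (- beta) * ei (n.+1%:R * beta) :> R[i].
    by rewrite -eiD; congr ei; rewrite -[n.+1%:R]natr1; ring.
  ring.
by rewrite tele uW mulr0 mul0r addr0.
Qed.

Lemma expsum_trivial (W N : nat) F r C x : (0 < N)%N -> 0 <= r ->
  csupp r F -> (forall y, `|F y| <= C) ->
  \sum_(n < W) `|F (x + n%:R / N%:R)| <= C * (2 * r * N%:R + 1).
Proof.
move=> N0 r0 hF hC.
have C0 : 0 <= C by rewrite (le_trans _ (hC 0)).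
apply: (@le_trans _ _ (\sum_(n < W) C * (`|x + n%:R / N%:R| <= r)%R%:R)).
  apply: ler_sum => n _; have [hn|hn] := leP `|x + n%:R / N%:R| r; first by rewrite mulr1.
  by rewrite hF// normr0 mulr0.
by rewrite -mulr_sumr ler_wpM2l// count_progression.
Qed.

(** Each difference of [dil s g] with step 1/N costs a factor [s / N], and each summation by parts
    gains one of the size of the distance from [beta] to [q]. At order 0 one counts about [N / s]
    terms of size [s]; [s <= N] absorbs the extra term of the count. *)
Lemma expsum_decay A g r : tame g -> 0 <= r -> csupp r g -> exists2 C, 0 <= C &
  forall s (N W : nat) x beta (q : int), (0 < N)%N -> 1 <= s <= N%:R ->
    x < - (r + A%:R) -> r + A%:R < x + W%:R / N%:R -> `|beta - q%:~R| <= 1 / 2 ->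
  N%:R^-1 * normc (\sum_(n < W) (dil s g (x + n%:R / N%:R))%:C%C * ei (n%:R * beta)) <= C /\
  N%:R^-1 * normc (\sum_(n < W) (dil s g (x + n%:R / N%:R))%:C%C * ei (n%:R * beta)) *
    (N%:R * `|beta - q%:~R| / s) ^+ A <= C.
Proof.
move=> tg r0 hg; have [C0 C00 hC0] := tame_bounded tg.
have [CA hCA] := tame_fdiff A tg.
have CA0 : 0 <= CA by have := hCA 1 0; rewrite normr1 expr1n mulr1; exact: le_trans.
pose K : R := 2 * (r + A%:R) + 1.
have K0 : 0 <= K by rewrite /K addr_ge0// mulr_ge0// addr_ge0.
exists (Num.max C0 CA * K); first by rewrite mulr_ge0// le_max C00.
move=> s N W x beta q N0 /andP[s1 sN] hx hW hq.
have s0 : 0 < s by rewrite (lt_le_trans _ s1).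
have NR : 0 < N%:R :> R by rewrite ltr0n.
have hd : csupp (r / s) (dil s g) by exact: csupp_dil.
have rs : r / s <= r by rewrite ler_pdivrMr// ler_peMr.
have gen l Cl : 0 <= Cl -> (l <= A)%N -> (forall t y, `|iter l (fdiff t) g y| <= Cl * `|t| ^+ l) ->
    N%:R^-1 * normc (\sum_(n < W) (iter l (fdiff N%:R^-1) (dil s g) (x + n%:R / N%:R))%:C%C * ei (n%:R * beta))
    <= Cl * K * (s / N%:R) ^+ l.
  move=> Cl0 lA hCl.
  apply: (@le_trans _ _ (N%:R^-1 * \sum_(n < W) `|iter l (fdiff N%:R^-1) (dil s g) (x + n%:R / N%:R)|)).
    rewrite ler_wpM2l ?invr_ge0//; apply: (le_trans (normc_sum _ _ _)).
    by apply: ler_sum => n _; rewrite normcM normc_ei mulr1 normc_real.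
  have b y : `|iter l (fdiff N%:R^-1) (dil s g) y| <= s * Cl * (s / N%:R) ^+ l.
    have -> : dil s g = (fun y => s * g (s * y + 0)) by apply/funext => z; rewrite addr0.
    rewrite iter_fdiffZ iter_fdiff_affine normrM gtr0_norm// -mulrA ler_wpM2l ?(ltW s0)//.
    by rewrite (le_trans (hCl _ _))// normrM gtr0_norm// ger0_norm ?invr_ge0.
  have hs : csupp (r / s + l%:R * `|N%:R^-1|) (iter l (fdiff N%:R^-1) (dil s g)) by exact: csupp_fdiff.
  have rr0 : 0 <= r / s + l%:R * `|N%:R^-1| by rewrite addr_ge0// ?divr_ge0 ?mulr_ge0// ltW.
  have := @expsum_trivial W N _ _ _ x N0 rr0 hs b.
  move/(ler_wpM2l (ltW (x := 0) (y := N%:R^-1) _)) => /(_ _)h; apply: (le_trans (h _)).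
    by rewrite invr_gt0.
  rewrite ger0_norm ?invr_ge0//.
  have -> : N%:R^-1 * (s * Cl * (s / N%:R) ^+ l * (2 * (r / s + l%:R / N%:R) * N%:R + 1)) =
    (Cl * (s / N%:R) ^+ l) * (2 * r + 2 * l%:R * (s / N%:R) + s / N%:R).
    by field; rewrite !gt_eqF.
  rewrite [leRHS]mulrAC ler_wpM2l//.
    by rewrite mulr_ge0// exprn_ge0// divr_ge0// ltW.
  have sN1 : s / N%:R <= 1 by rewrite ler_pdivrMr// mul1r.
  have l0 : 0 <= l%:R :> R by [].
  have lAR : l%:R <= A%:R :> R by rewrite ler_nat.
  rewrite /K; nra.
split.
  have h0 t y : `|iter 0 (fdiff t) g y| <= C0 * `|t| ^+ 0 by rewrite expr0 mulr1; exact: hC0.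
  have := gen 0%N C0 C00 (leq0n _) h0; rewrite /= expr0 mulr1 => /le_trans; apply.
  by rewrite ler_wpM2r// le_max lexx.
have := gen A CA CA0 (leqnn _) hCA.
rewrite (abel_summation beta N0 (csuppW rs hd) hx hW) normcM normcX.
have hnorm : 2 * `|beta - q%:~R| <= normc (ei (- beta) - 1).
  have -> : `|beta - q%:~R| = `|- beta - (- q)%:~R| by rewrite rmorphN /= -opprD normrN.
  by apply: normc_ei_sub1; rewrite rmorphN /= -opprD normrN.
have hn2 : `|beta - q%:~R| ^+ A <= normc (ei (- beta) - 1) ^+ A.
  rewrite lerXn2r ?nnegrE ?normc_ge0//; have := normr_ge0 (beta - q%:~R); lra.
set S := normc (\sum_(n < W) _) => h.
have S0 : 0 <= S by exact: normc_ge0.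
have sNA : 0 < (s / N%:R) ^+ A by rewrite exprn_gt0// divr_gt0.
have e : (N%:R * `|beta - q%:~R| / s) ^+ A = `|beta - q%:~R| ^+ A / (s / N%:R) ^+ A.
  by rewrite -expr_div_n; congr (_ ^+ _); field; rewrite !gt_eqF.
rewrite e mulrA ler_pdivrMr//; apply: (@le_trans _ _ (CA * K * (s / N%:R) ^+ A)).
  apply: (le_trans _ h); rewrite -mulrA ler_wpM2l ?invr_ge0//.
  by rewrite mulrC ler_wpM2r.
by rewrite (ler_pM2r sNA) ler_wpM2r// le_max lexx orbT.
Qed.

Lemma expsum_layer A g r : tame g -> 0 <= r -> csupp r g -> exists2 C, 0 <= C &
  forall s (N W T : nat) x beta (q : int), (0 < N)%N -> 1 <= s <= N%:R ->
    x < - (r + A%:R) -> r + A%:R < x + W%:R / N%:R -> `|beta - q%:~R| <= 1 / 2 ->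
    N%:R <= 2 ^+ T :> R ->
  N%:R^-1 * normc (\sum_(n < W) (dil s g (x + n%:R / N%:R))%:C%C * ei (n%:R * beta)) <=
  C * \sum_(t < T.+1) (2 ^+ A) ^- t * (N%:R * `|beta - q%:~R| / s <= 2 ^+ t)%R%:R.
Proof.
move=> tg r0 hg; have [C C0 hC] := expsum_decay A tg r0 hg.
exists (C * 2 ^+ A); first by rewrite mulr_ge0// exprn_ge0.
move=> s N W T x beta q N0 hs hx hW hq hT.
have [h1 h2] := hC s N W x beta q N0 hs hx hW hq.
apply: layer_cake => //.
  by rewrite h1 andbT mulr_ge0 ?invr_ge0// normc_ge0.
move/andP: hs => [s1 _]; have s0 : 0 < s by rewrite (lt_le_trans _ s1).
rewrite ler_pdivrMr// (@le_trans _ _ (2 ^+ T * 1))//.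
  by rewrite ler_pM// (le_trans hq)//; lra.
by rewrite ler_wpM2l// exprn_ge0.
Qed.

End exponential_sums.

(** * Counting separated points in boxes *)

Section counting.
Context {R : realType} (I : finType) (d : nat) (X : I -> 'I_d -> R) (Y : R).
Hypotheses (Y0 : 0 < Y)
  (sep : forall a b, a != b -> forall l : 'I_d -> nat,
    (forall i, `|X a i - X b i| <= 2 ^+ l i) -> Y <= 2 ^+ (\sum_i l i)%N)
  (sep1 : forall a b, (forall i, `|X a i - X b i| < 1) -> a = b).

(** Half-open boxes bisect without overlap, and in a unit box coordinate distances are strictly
    below 1, as [sep1] demands. *)
Definition halfopen_box (c : 'I_d -> R) (l : 'I_d -> nat) : {set I} :=
  [set a | [forall i, c i <= X a i < c i + 2 ^+ l i]]%SET.

Lemma halfopen_boxP c l a : reflect (forall i, c i <= X a i < c i + 2 ^+ l i)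
  (a \in halfopen_box c l).
Proof. by rewrite inE; exact: forallP. Qed.

Lemma halfopen_box_dist c l a b i : a \in halfopen_box c l -> b \in halfopen_box c l ->
  `|X a i - X b i| < 2 ^+ l i.
Proof.
move=> /halfopen_boxP/(_ i)/andP[a1 a2] /halfopen_boxP/(_ i)/andP[b1 b2].
by rewrite ltr_norml; lra.
Qed.

(** Bisection along a side longer than 1. A box of volume below [Y] holds at most one point by
    [sep], the unit box by [sep1]; from volume [Y] on the bound doubles along with the volume. *)
Lemma halfopen_box_count n c l : (\sum_i l i = n)%N ->
  #|halfopen_box c l|%:R <= Num.max 1 (2 * 2 ^+ n / Y).
Proof.
have small l' c' : (forall a b, a \in halfopen_box c' l' -> b \in halfopen_box c' l' -> a = b) ->
    #|halfopen_box c' l'|%:R <= 1 :> R.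
  move=> h; rewrite -[leRHS]/(1%:R) ler_nat; apply/card_le1_eqP => a b ha hb.
  exact: h.
elim: n c l => [|n IH] c l ln.
  rewrite le_max; apply/orP; left; apply: small => a b ha hb; apply: sep1 => i.
  have := halfopen_box_dist i ha hb.
  by move/eqP: ln; rewrite sum_nat_eq0 => /forallP/(_ i)/eqP ->.
have [hY|hY] := ltP (2 ^+ n.+1) Y.
  rewrite le_max; apply/orP; left; apply: small => a b ha hb; apply/eqP/negPn/negP => ab.
  have := @sep a b ab l; rewrite ln => h; move: hY; rewrite ltNge h// => i.
  exact/ltW/(halfopen_box_dist i ha hb).
have [i0 hi0] : exists i0, (0 < l i0)%N.
  apply/existsP; rewrite -[X in is_true X]negbK negb_exists; apply/negP => /forallP h.
  have : (\sum_i l i = 0)%N by apply: big1 => i _; apply/eqP; rewrite -leqn0 leqNgt.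
  by rewrite ln.
pose l' i := if i == i0 then (l i0).-1 else l i.
pose c' i := if i == i0 then c i0 + 2 ^+ (l i0).-1 else c i.
have l'n : (\sum_i l' i = n)%N.
  move: ln; rewrite (bigD1 i0)//= [in X in _ -> X](bigD1 i0)//= {1}/l' eqxx.
  have -> : (\sum_(i < d | i != i0) l' i = \sum_(i < d | i != i0) l i)%N.
    by apply: eq_bigr => i /negbTE; rewrite /l' => ->.
  by case: (l i0) hi0 => //= m _; rewrite addSn => -[].
have sub : halfopen_box c l \subset halfopen_box c l' :|: halfopen_box c' l'.
  apply/fintype.subsetP => a /halfopen_boxP ha.
  have half : 2 ^+ l i0 = 2 ^+ (l i0).-1 + 2 ^+ (l i0).-1 :> R.
    by case: (l i0) hi0 => //= m _; rewrite exprS mulr_natl mulr2n.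
  rewrite finset.in_setU; have [lt|ge] := ltP (X a i0) (c i0 + 2 ^+ (l i0).-1); apply/orP; [left|right].
    apply/halfopen_boxP => i; have /andP[h1 h2] := ha i; rewrite /l'.
    by case: eqP => [->|_]; [rewrite lt andbT; have /andP[] := ha i0|rewrite h1 h2].
  apply/halfopen_boxP => i; have /andP[h1 h2] := ha i; rewrite /l' /c'.
  case: eqP => [->|_]; last by rewrite h1 h2.
  by rewrite ge /= -addrA -half; have /andP[] := ha i0.
have := leq_trans (subset_leq_card sub) (leq_card_setU _ _).
rewrite -(ler_nat R) natrD => /le_trans; apply.
apply: (le_trans (lerD (IH c l' l'n) (IH c' l' l'n))).
have e : 2 * 2 ^+ n.+1 / Y = 2 * 2 ^+ n / Y + 2 * 2 ^+ n / Y by rewrite exprS; ring.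
have h1 : 1 <= 2 * 2 ^+ n / Y by rewrite ler_pdivlMr// mul1r -exprS.
by rewrite (max_r h1) -e le_max lexx orbT.
Qed.

(** Either the box is empty, or a point in it forces its volume to be at least [Y]. Then the ratio
    is at least 1 and any power [B >= 1] dominates the first power. *)
Lemma centered_box_count B (l : 'I_d -> nat) : (0 < B)%N ->
  (forall a, (forall i, `|X a i| <= 2 ^+ l i) -> Y <= 2 ^+ (\sum_i l i)%N) ->
  #|[set a | [forall i, `|X a i| <= 2 ^+ l i]]%SET|%:R <=
    2 * 4 ^+ d * (2 ^+ (\sum_i l i)%N / Y) ^+ B.
Proof.
move=> B0 hY; set S := [set a | _]%SET.
have q0 : 0 <= 2 ^+ (\sum_i l i)%N / Y by rewrite divr_ge0// ?exprn_ge0// ltW.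
have [->|[a aS]] := set_0Vmem S.
  by rewrite cards0 mulr_ge0 ?mulr_ge0 ?exprn_ge0.
have {}hY : Y <= 2 ^+ (\sum_i l i)%N by apply: (hY a); move: aS; rewrite inE => /forallP.
have q1 : 1 <= 2 ^+ (\sum_i l i)%N / Y by rewrite ler_pdivlMr// mul1r.
(* The closed box with half-sides [2 ^+ l i] fits into a half-open box with sides [2 ^+ (l i).+2];
   this costs the factor [4 ^+ d]. *)
pose c i : R := - 2 ^+ (l i).+1; pose l2 i := (l i).+2.
have sub : S \subset halfopen_box c l2.
  apply/fintype.subsetP => b; rewrite inE => /forallP hb; apply/halfopen_boxP => i.
  have := hb i; rewrite ler_norml /c /l2 => /andP[h1 h2].
  have p : 0 < 2 ^+ l i :> R by rewrite exprn_gt0.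
  by rewrite !exprS; lra.
have := subset_leq_card sub; rewrite -(ler_nat R) => /le_trans; apply.
have sl : (\sum_i l2 i = \sum_i l i + 2 * d)%N.
  rewrite /l2 (eq_bigr (fun i => l i + 2)%N) => [|i _]; last by rewrite addn2.
  by rewrite big_split /= sum_nat_const card_ord mulnC.
apply: (le_trans (halfopen_box_count c sl)).
rewrite exprD exprM (_ : 2 ^+ 2 = 4 :> R); last by rewrite expr2 -natrM.
have d4 : 1 <= 4 ^+ d :> R by rewrite exprn_ege1// ler1n.
have e : 2 * (2 ^+ (\sum_i l i)%N * 4 ^+ d) / Y = 2 * 4 ^+ d * (2 ^+ (\sum_i l i)%N / Y) by ring.
rewrite e (max_r _); last first.
  by rewrite -[leLHS]mulr1 ler_pM//; lra.
rewrite ler_wpM2l//.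
by case: B B0 => // B _; rewrite exprS ler_peMr// exprn_ege1.
Qed.

End counting.

(** * Integration over R^n and metric Diophantine approximation *)

Section rV_topology.
Context {R : realType} {d : nat}.
Local Notation Rd := 'rV[R]_d.
Implicit Types (x y : Rd).

Lemma continuous_rV_delta (f : Rd -> R) x e : continuous f -> 0 < e ->
  exists2 del, 0 < del & forall y, (forall i, `|x ord0 i - y ord0 i| < del) -> `|f x - f y| < e.
Proof.
move=> cf e0.
have /nbhs_ballP[del /= del0 hdel] : nbhs x [set y | `|f x - f y| < e].
  have := cf x => /cvgrPdist_lt/(_ _ e0); exact.
exists del => // y hy; apply: hdel; split=> // i j.
by rewrite !ord1 /ball /=; exact: hy.
Qed.

Lemma open_rV_delta (U : set Rd) x : open U -> U x ->
  exists2 del, 0 < del & forall y, (forall i, `|x ord0 i - y ord0 i| < del) -> U y.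
Proof.
move=> oU Ux; have /nbhs_ballP[del /= del0 hdel] : nbhs x U by exact: open_nbhs_nbhs.
exists del => // y hy; apply: hdel; split=> // i j.
by rewrite !ord1 /ball /=; exact: hy.
Qed.

Definition rV_round (m : nat) x : Rd :=
  \row_i ((Num.floor (2 ^+ m * x ord0 i))%:~R / 2 ^+ m).

Lemma rV_round_dist m x i : `|x ord0 i - rV_round m x ord0 i| < 2 ^- m.
Proof.
have p : 0 < 2 ^+ m :> R by rewrite exprn_gt0.
rewrite mxE ger0_norm.
  rewrite ltrBlDr -(ltr_pM2l p) mulrDr mulfV ?gt_eqF// mulrCA mulfV ?gt_eqF// mulr1 addrC.
  by have := floorD1_gt (2 ^+ m * x ord0 i); rewrite rmorphD.
by rewrite subr_ge0 ler_pdivrMr// mulrC floor_le.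
Qed.

Lemma rV_round_cvg (f : Rd -> R) x : continuous f -> (fun m => f (rV_round m x)) @ \oo --> f x.
Proof.
move=> cf; apply/cvgrPdist_lt => e e0.
have [del del0 hdel] := continuous_rV_delta x cf e0.
have h : (fun m => (2^-1 : R) ^+ m) @ \oo --> (0 : R).
  by apply: cvg_expr; rewrite ger0_norm ?invr_ge0// invf_lt1// ltr1n.
near=> m; apply: hdel => i; apply: (lt_trans (rV_round_dist m x i)).
rewrite -exprVn -[ltLHS]subr0 -[ltLHS]ger0_norm ?subr0 ?exprn_ge0 ?invr_ge0//.
rewrite -[X in `|X|]subr0 distrC; near: m.
exact: (@cvgr_dist_lt _ _ _ _ _ _ _ h).
Unshelve. all: by end_near. Qed.

Lemma measurable_rV_round_fiber m (q : {ffun 'I_d -> int}) :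
  measurable [set x : Rd | forall i, Num.floor (2 ^+ m * x ord0 i) = q i].
Proof.
have p : 0 < 2 ^+ m :> R by rewrite exprn_gt0.
have -> : [set x : Rd | forall i, Num.floor (2 ^+ m * x ord0 i) = q i] =
  \bigcap_(i in [set: 'I_d]) ((@rV_coord R d i) @^-1` `[(q i)%:~R / 2 ^+ m, ((q i)%:~R + 1) / 2 ^+ m[).
  have key x i : (Num.floor (2 ^+ m * x ord0 i) = q i) <->
      ((@rV_coord R d i) @^-1` `[(q i)%:~R / 2 ^+ m, ((q i)%:~R + 1) / 2 ^+ m[) x.
    rewrite /rV_coord /= in_itv /= ler_pdivrMr// ltr_pdivlMr// [x ord0 i * _]mulrC.
    split=> [<-|h].
      by rewrite floor_le/= -[1]/(1%:~R) -rmorphD floorD1_gt.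
    by apply: floor_def; rewrite rmorphD.
  by apply/seteqP; split=> x /= h i => [_|]; apply/key; exact: h.
apply: fin_bigcap_measurable => // i _; rewrite -[X in measurable X]setTI.
by apply: (measurable_rV_coord i) => //; exact: measurable_itv.
Qed.

(** The sigma-algebra is generated by the coordinates, not by the open sets; hence [f] is
    approximated by functions that are constant on each of countably many dyadic cubes. *)
Lemma continuous_rV_measurable (f : Rd -> R) : continuous f -> measurable_fun [set: Rd] f.
Proof.
move=> cf; apply: (@measurable_fun_cvg _ _ _ _ (fun m x => f (rV_round m x))); last first.
  by move=> x _; exact: rV_round_cvg.
move=> m _ B mB; rewrite setTI.
pose pt (q : {ffun 'I_d -> int}) : Rd := \row_i ((q i)%:~R / 2 ^+ m).
have -> : (fun x => f (rV_round m x)) @^-1` B = \bigcup_(q in [set: {ffun 'I_d -> int}])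
   (if `[< B (f (pt q)) >] then [set x : Rd | forall i, Num.floor (2 ^+ m * x ord0 i) = q i] else set0).
  apply/seteqP; split=> x /=.
    move=> Bx; exists [ffun i => Num.floor (2 ^+ m * x ord0 i)] => //.
    case: asboolP => [_ i|]; first by rewrite ffunE.
    apply: contra_notP => _; congr (B (f _)): Bx.
    by apply/rowP => i; rewrite !mxE ffunE.
  case=> q _; case: asboolP => // Bq hq.
  suff -> : rV_round m x = pt q by [].
  by apply/rowP => i; rewrite !mxE hq.
apply: countable_bigcupT_measurable; first exact: countableP.
move=> q; case: asboolP => // _; exact: measurable_rV_round_fiber.
Qed.

End rV_topology.

Section rV_integral.
Context {R : realType}.
Local Notation mu := (@lebesgue_measure R).
Local Notation nu := (lebesgue_rV R).

Lemma rV_cons0 n (z : measurableTypeR R * 'rV[R]_n) : rV_cons z ord0 ord0 = z.1.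
Proof.
rewrite /rV_cons (_ : ord0 = lshift n ord0 :> 'I_(1 + n)); last exact/val_inj.
by rewrite (@row_mxEl _ 1 1 n) mxE.
Qed.

Lemma rV_consS n (z : measurableTypeR R * 'rV[R]_n) i : rV_cons z ord0 (lift ord0 i) = z.2 ord0 i.
Proof.
rewrite /rV_cons (_ : lift ord0 i = rshift 1 i :> 'I_(1 + n)); last exact/val_inj.
by rewrite (@row_mxEr _ 1 1 n).
Qed.

Let pm n := pushforward (mu \x nu n)%E (@rV_cons R n).

Lemma rV_integral n (f : 'rV[R]_n.+1 -> R) : measurable_fun setT f ->
  (mu \x nu n)%E.-integrable setT (fun z => (f (rV_cons z))%:E) ->
  rintegrable (nu n.+1) f /\
  \int[nu n.+1]_x f x = \int[(mu \x nu n)%E]_z f (rV_cons z).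
Proof.
move=> mf fi.
have mc := @measurable_rV_cons R n.
have mEf : measurable_fun setT (EFin \o f) by exact/measurable_EFinP.
split.
  have := integrable_pushforward mc mEf fi measurableT.
  by move=> /integrableP[_ h]; apply/integrableP.
rewrite /Rintegral; congr fine.
exact: (integral_pushforward mc mEf fi measurableT).
Qed.

Lemma ge0_rV_integral n (f : 'rV[R]_n.+1 -> \bar R) : measurable_fun setT f ->
  (forall x, 0 <= f x)%E ->
  (\int[nu n.+1]_x f x = \int[mu]_x \int[nu n]_y f (rV_cons (x, y)))%E.
Proof.
move=> mf f0; have mc := @measurable_rV_cons R n.
transitivity (\int[(mu \x nu n)%E]_z f (rV_cons z))%E.
  have f0' : {in setT, forall y, 0 <= f y}%E by move=> y _; exact: f0.
  exact: (ge0_integral_pushforward mc (mu \x nu n)%E measurableT mf f0').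
rewrite fubini_tonelli1//; exact: measurableT_comp.
Qed.

Definition tens d (u : 'I_d -> R -> R) (x : 'rV[R]_d) : R := \prod_i u i (x ord0 i).

Lemma tens_cons n (u : 'I_n.+1 -> R -> R) z :
  tens u (rV_cons z) = u ord0 z.1 * tens (fun i => u (lift ord0 i)) z.2.
Proof.
rewrite /tens big_ord_recl rV_cons0; congr (_ * _).
by apply: eq_bigr => i _; rewrite rV_consS.
Qed.

Lemma measurable_tens d (u : 'I_d -> R -> R) :
  (forall i, measurable_fun setT (u i : measurableTypeR R -> R)) -> measurable_fun setT (tens u).
Proof.
move=> mu_; apply: measurable_prod => i _.
exact: (measurableT_comp (mu_ i) (measurable_rV_coord i)).
Qed.

Lemma tens_integral d (u : 'I_d -> R -> R) : (forall i, rintegrable mu (u i)) ->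
  rintegrable (nu d) (tens u) /\ \int[nu d]_x tens u x = \prod_i \int[mu]_t u i t.
Proof.
elim: d u => [|n IH] u iu.
  have t1 x : tens u x = 1 by rewrite /tens big_ord0.
  have m1 : measurable_fun setT (fun _ : 'rV[R]_0 => (1%:E : \bar R)) by exact: measurable_cst.
  have e : (\int[nu 0]_x 1%:E = 1%:E)%E.
    transitivity (\int[\d_(0%R : 'rV[R]_0)]_x (1%:E : \bar R))%E; first exact: eq_measure_integral.
    by rewrite integral_dirac// diracT mul1e.
  split.
    apply/integrableP; split.
      by have -> : EFin \o tens u = (fun _ => 1%:E) by apply/funext => x; rewrite /= t1.
    under eq_integral do rewrite /= t1 normr1.
    by rewrite e ltry.
  rewrite big_ord0 /Rintegral; under eq_integral do rewrite t1.
  by rewrite e.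
have [i2 e2] := IH (fun i => u (lift ord0 i)) (fun i => iu _).
pose f (x : measurableTypeR R) (y : 'rV[R]_n) := u ord0 x * tens (fun i => u (lift ord0 i)) y.
have mf : measurable_fun setT (fun z : measurableTypeR R * 'rV[R]_n => f z.1 z.2).
  apply: measurable_funM.
    exact: (measurableT_comp (rintegrable_measurable (iu ord0)) measurable_fst).
  exact: (measurableT_comp (rintegrable_measurable i2) measurable_snd).
have ia := rintegrable_norm (iu ord0); have ib := rintegrable_norm i2.
have fab x y : `|f x y| <= `|u ord0 x| * `|tens (fun i => u (lift ord0 i)) y| by rewrite /f normrM.
have fi := rprod_integrable mf ia ib fab.
have mt : measurable_fun setT (tens u).
  by apply: measurable_tens => i; exact: rintegrable_measurable.
have fi' : (mu \x nu n)%E.-integrable setT (fun z => (tens u (rV_cons z))%:E).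
  by apply: eq_integrable fi => // z _; rewrite tens_cons.
have [r1 r2] := rV_integral mt fi'; split=> //.
rewrite r2; under eq_Rintegral do rewrite tens_cons.
rewrite -(rintegral12 mf ia ib fab) /f big_ord_recl -e2 -rintegralZr//.
by apply: eq_rintegral => x; rewrite rintegralZ.
Qed.

End rV_integral.

(** * Metric Diophantine approximation *)

Section diophantine.
Context {R : realType}.
Local Notation mu := (@lebesgue_measure R).
Local Notation nu := (lebesgue_rV R).

Lemma measure_bigcup_seq d (T : measurableType d) (m : {measure set T -> \bar R})
    (I : Type) (s : seq I) (F : I -> set T) : (forall i, measurable (F i)) ->
  (m (\big[setU/set0]_(i <- s) F i) <= \sum_(i <- s) m (F i))%E.
Proof.
move=> mF; elim: s => [|i s IH]; first by rewrite !big_nil measure0.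
rewrite !big_cons; apply: le_trans (measureU2 _ _ _) _ => //.
  exact: bigsetU_measurable.
by rewrite leeD2l.
Qed.

Lemma bigsetU_seqP (T : Type) (I : eqType) (s : seq I) (F : I -> set T) x i :
  i \in s -> F i x -> (\big[setU/set0]_(i <- s) F i) x.
Proof.
move=> + Fx; elim: s => [//|j s IH]; rewrite in_cons big_cons => /orP[/eqP <-|/IH]; first by left.
by right.
Qed.

Definition near_int_set (n : int) (b e : R) (K : nat) : set (measurableTypeR R) :=
  [set x | `|x| <= K%:R /\ exists q : int, `|n%:~R * x + b - q%:~R| < e].

(** The set is covered by intervals of length [2 * e / |n|] around the points [(q - b) / n]. Their
    number grows like [|n|], so the bound is independent of [n]. *)
Lemma near_int_set_le n b e (K : nat) : n != 0 -> 0 < e <= 1 ->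
  measurable (near_int_set n b e K) ->
  (mu (near_int_set n b e K) <= ((4 * K%:R + 8) * e)%:E)%E.
Proof.
move=> n0 /andP[e0 e1] mS.
have nR : 0 < `|n%:~R| :> R by rewrite normr_gt0 intr_eq0.
have n1 : 1 <= `|n%:~R| :> R.
  by rewrite -intr_norm -[1]/(1%:~R) ler_int -gtz0_ge1 normr_gt0.
pose a : R := n%:~R.
(* On [[-K, K]] the form [n * x + b] sweeps a length [2 * |n| * K]; the 4 covers the margin [e <= 1]
   at both ends and the rounding in [q0]. *)
pose J := (2 * `|n|%N * K + 4)%N.
pose q0 : int := Num.floor (b - `|a| * K%:R - 1).
pose F (j : nat) : set (measurableTypeR R) :=
  `[(((q0 + j%:Z)%:~R - b) / a - e / `|a|), (((q0 + j%:Z)%:~R - b) / a + e / `|a|)]%classic.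
have sub : near_int_set n b e K `<=` \big[setU/set0]_(j <- iota 0 J) F j.
  move=> x [xK [q hq]].
  have an : `|a * x| <= `|a| * K%:R by rewrite normrM ler_wpM2l.
  have aN : `|a| = (`|n|%N)%:R by rewrite /a -intr_norm -abszE.
  have q0le : (q0%:~R : R) <= b - `|a| * K%:R - 1 by exact: floor_le.
  have q0gt : b - `|a| * K%:R - 1 < q0%:~R + 1.
    by have := floorD1_gt (b - `|a| * K%:R - 1); rewrite rmorphD.
  move: hq; rewrite ltr_norml -/a => /andP[h1 h2]; move: an; rewrite ler_norml => /andP[a1 a2].
  have qq0 : q0 <= q by rewrite -(ler_int R); lra.
  have jE : (q0 + (`|q - q0|%N)%:Z) = q by rewrite abszE ger0_norm ?subr_ge0// [LHS]addrC subrK.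
  have jJ : (`|q - q0| < J)%N.
    rewrite -(ltr_nat R) /J natrD !natrM -aN.
    have -> : (`|q - q0|%N)%:R = q%:~R - q0%:~R :> R.
      by rewrite -[X in X = _]/((`|q - q0|%N)%:~R) abszE ger0_norm ?subr_ge0// rmorphB.
    lra.
  apply: (bigsetU_seqP (i := `|q - q0|%N)); first by rewrite mem_iota add0n.
  rewrite /F /= jE in_itv /=.
  have a0 : a != 0 by rewrite -normr_gt0.
  have : `|x - (q%:~R - b) / a| <= e / `|a|.
    rewrite ler_pdivlMr// -normrM mulrBl divfK// ler_norml; lra.
  by rewrite ler_distl.
have mF j : measurable (F j) by exact: measurable_itv.
apply: (@le_trans _ _ (\sum_(j <- iota 0 J) mu (F j))%E).
  apply: le_trans (measure_bigcup_seq mu _ mF).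
  by apply: le_measure; rewrite ?inE//; exact: bigsetU_measurable.
apply: (@le_trans _ _ (\sum_(j <- iota 0 J) (2 * e / `|a|)%:E)%E).
  apply: lee_sum => j _; rewrite /F lebesgue_measure_itv /= lte_fin.
  case: ifP => _; last by rewrite lee_fin divr_ge0// mulr_ge0// ltW.
  rewrite -EFinB lee_fin; lra.
rewrite sumEFin lee_fin big_const_seq count_predT size_iota iter_addr addr0.
rewrite -[_ *+ J]mulr_natl /J natrD !natrM.
have -> : (`|n|%N)%:R = `|a| :> R by rewrite /a -intr_norm -abszE.
have -> : (2 * `|a| * K%:R + 4) * (2 * e / `|a|) = 4 * e * K%:R + 8 * e / `|a|.
  by field; rewrite gt_eqF.
have : 8 * e / `|a| <= 8 * e by rewrite ler_pdivrMr// ler_peMr// mulr_ge0// ltW.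
by lra.
Qed.

Lemma measurable_near_int_set n b e K : measurable (near_int_set n b e K).
Proof.
have -> : near_int_set n b e K = `[- K%:R, K%:R]%classic `&`
    \bigcup_(q in [set: int]) ((fun x : measurableTypeR R => n%:~R * x + b) @^-1` `](q%:~R - e), (q%:~R + e)[).
  apply/seteqP; split=> x /=.
    move=> [h1 [q hq]]; split; first by rewrite in_itv /= -ler_norml.
    by exists q => //=; rewrite in_itv /= -ltr_distl.
  rewrite in_itv /= -ler_norml => -[h1 [q _]].
  by rewrite /= in_itv /= -ltr_distl => hq; split=> //; exists q.
apply: measurableI; first exact: measurable_itv.
apply: countable_bigcupT_measurable; first exact: countableP.
move=> q; rewrite -[X in measurable X]setTI.
have mf : measurable_fun setT (fun x : measurableTypeR R => n%:~R * x + b).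
  by apply: measurable_funD => //; apply: measurable_funM.
by apply: mf => //; exact: measurable_itv.
Qed.

Definition dot k (h : 'I_k -> int) (al : 'rV[R]_k) : R := \sum_i (h i)%:~R * al ord0 i.

(** The offset [b] serves the induction on the dimension: once the other coordinates are fixed,
    their part of [dot] acts as an offset for the remaining one. *)
Definition near_res_set k (h : 'I_k -> int) (b e : R) (K : nat) : set 'rV[R]_k :=
  [set al : 'rV[R]_k | (forall i, `|al ord0 i| <= K%:R) /\ exists q : int, `|dot h al + b - q%:~R| < e].

Definition rV_cube k (K : nat) : set 'rV[R]_k := [set al : 'rV[R]_k | forall i, `|al ord0 i| <= K%:R].

Arguments rV_cube k K : clear implicits.

Lemma measurable_rV_cube k K : measurable (rV_cube k K).
Proof.
have -> : rV_cube k K = \bigcap_(i in [set: 'I_k]) ((@rV_coord R k i) @^-1` `[- K%:R, K%:R]).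
  apply/seteqP; split=> al /= h i => [_|]; rewrite /= ?in_itv /= -?ler_norml; first exact: h.
  by have := h i I; rewrite /= in_itv /= -ler_norml.
apply: fin_bigcap_measurable => // i _; rewrite -[X in measurable X]setTI.
by apply: (measurable_rV_coord i) => //; exact: measurable_itv.
Qed.

Lemma measurable_dot k (h : 'I_k -> int) b : measurable_fun setT (fun al : 'rV[R]_k => dot h al + b).
Proof.
apply: measurable_funD => //; apply: measurable_sum => i; apply: measurable_funM => //.
exact: measurable_rV_coord.
Qed.

Lemma measurable_near_res_set k (h : 'I_k -> int) b e K : measurable (near_res_set h b e K).
Proof.
have -> : near_res_set h b e K = rV_cube k K `&`
    \bigcup_(q in [set: int]) ((fun al => dot h al + b) @^-1` `](q%:~R - e), (q%:~R + e)[).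
  apply/seteqP; split=> al /=.
    by move=> [h1 [q hq]]; split=> //; exists q => //=; rewrite in_itv /= -ltr_distl.
  by move=> [h1 [q _]]; rewrite /= in_itv /= -ltr_distl => hq; split=> //; exists q.
apply: measurableI; first exact: measurable_rV_cube.
apply: countable_bigcupT_measurable; first exact: countableP.
move=> q; rewrite -[X in measurable X]setTI.
by apply: (measurable_dot h b) => //; exact: measurable_itv.
Qed.

Lemma nu_indic k (A : set 'rV[R]_k.+1) : measurable A ->
  (nu k.+1 A = \int[mu]_x \int[nu k]_y (\1_A (rV_cons (x, y)))%:E)%E.
Proof.
move=> mA; rewrite -[in LHS](setIT A) -(integral_indic (nu k.+1))//.
apply: (@ge0_rV_integral R k (EFin \o \1_A)).
  by apply/measurable_EFinP; exact: measurable_indic.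
by move=> x; rewrite lee_fin.
Qed.

Lemma rV_cube_consE k K (x : measurableTypeR R) (y : 'rV[R]_k) :
  rV_cube k.+1 K (rV_cons (x, y)) <-> `|x| <= K%:R /\ rV_cube k K y.
Proof.
split=> [h|[hx hy] i].
  by split=> [|i]; [have := h ord0; rewrite rV_cons0|have := h (lift ord0 i); rewrite rV_consS].
by case: (unliftP ord0 i) => [j ->|->]; rewrite ?rV_consS ?rV_cons0.
Qed.

Lemma dot_cons k (h : 'I_k.+1 -> int) (x : measurableTypeR R) (y : 'rV[R]_k) :
  dot h (rV_cons (x, y)) = (h ord0)%:~R * x + dot (fun i => h (lift ord0 i)) y.
Proof.
rewrite /dot big_ord_recl rV_cons0; congr (_ + _).
by apply: eq_bigr => i _; rewrite rV_consS.
Qed.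

Definition itvK (K : nat) : set (measurableTypeR R) := `[- K%:R, K%:R]%classic.

Lemma mu_itvK K : (mu (itvK K) = (2 * K%:R)%:E)%E.
Proof.
rewrite /itvK lebesgue_measure_itv /= lte_fin; case: ltP => h; first by rewrite -EFinB; congr EFin; lra.
by congr EFin; have : 0 <= K%:R :> R by []; lra.
Qed.

Lemma integral_itvK K : (\int[mu]_x ((\1_(itvK K) x : R)%:E) = (2 * K%:R)%:E)%E.
Proof.
have m1 : measurable (itvK K) by exact: measurable_itv.
by rewrite (integral_indic mu measurableT m1) setIT; exact: mu_itvK.
Qed.

Lemma nu_rV_cube k (K : nat) : (nu k (rV_cube k K) <= ((2 * K%:R) ^+ k)%:E)%E.
Proof.
elim: k => [|k IH].
  rewrite expr0; apply: (@le_trans _ _ (nu 0 setT)).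
    apply: le_measure; rewrite ?inE//; exact: measurable_rV_cube.
  by rewrite /= diracT.
rewrite (nu_indic (@measurable_rV_cube _ _)).
have p0 : 0 <= 2 * K%:R :> R by rewrite mulr_ge0.
have m1 : measurable (itvK K) by exact: measurable_itv.
have -> : (\int[mu]_x \int[nu k]_y (\1_(rV_cube k.+1 K) (rV_cons (x, y)))%:E =
   \int[mu]_x ((\1_(itvK K) x)%:E * nu k (rV_cube k K)))%E.
  apply: eq_integral => x _.
  rewrite -[in RHS](setIT (rV_cube k K)) -(integral_indic (nu k) measurableT (@measurable_rV_cube k K)).
  rewrite -ge0_integralZl_EFin//; last by apply/measurable_EFinP; apply: measurable_indic; exact: measurable_rV_cube.
  apply: eq_integral => y _; rewrite -EFinM; congr EFin.
  rewrite !indicE -natrM mulnb; congr (_ %:R); congr nat_of_bool.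
  apply/idP/andP; rewrite !inE.
    by move=> /rV_cube_consE[hx hy]; split; rewrite // /itvK /= in_itv /= -ler_norml.
  by rewrite /itvK /= in_itv /= -ler_norml => -[hx hy]; apply/rV_cube_consE.
rewrite ge0_integralZr//; last by apply/measurable_EFinP; exact: measurable_indic.
rewrite integral_itvK exprS [leRHS]EFinM.
by apply: lee_pmul.
Qed.

(** If the first entry of [h] is nonzero, the one-dimensional estimate applies in the first variable
    with the others fixed; if it is 0, the first variable is free and the induction hypothesis
    applies. For [e > 1] the volume of the cube suffices. *)
Lemma nu_near_res_set k (h : 'I_k -> int) (b e : R) (K : nat) : (exists i, h i != 0) -> 0 < e ->
  (nu k (near_res_set h b e K) <= ((4 * K%:R + 8) ^+ k * e)%:E)%E.
Proof.
move=> hn0 e0.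
have K0 : 0 <= K%:R :> R by [].
have q0 : 0 <= 4 * K%:R + 8 :> R by lra.
have cube_le m : (2 * K%:R) ^+ m <= (4 * K%:R + 8) ^+ m :> R.
  by rewrite lerXn2r ?nnegrE ?mulr_ge0//; lra.
have [e1|e1] := leP e 1; last first.
  apply: (@le_trans _ _ (nu k (rV_cube k K))).
    apply: le_measure; rewrite ?inE; [exact: measurable_near_res_set|exact: measurable_rV_cube|].
    by move=> al [].
  apply: (le_trans (nu_rV_cube _ _)); rewrite lee_fin (le_trans (cube_le k))//.
  by rewrite ler_peMr ?exprn_ge0// ltW.
elim: k h b hn0 => [|k IH] h b [i0 hi0]; first by case: i0 hi0.
rewrite (nu_indic (@measurable_near_res_set _ _ _ _ _)).
have mE := @measurable_near_res_set k.+1 h b e K.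
have mf : measurable_fun setT (fun z : measurableTypeR R * 'rV[R]_k =>
    (\1_(near_res_set h b e K) (rV_cons z) : R)%:E).
  apply/measurable_EFinP; apply: measurableT_comp; last exact: measurable_rV_cons.
  exact: measurable_indic.
have f0 z : (0 <= (\1_(near_res_set h b e K) (rV_cons z) : R)%:E)%E by rewrite lee_fin.
have m1 : measurable (itvK K) by exact: measurable_itv.
have [h0|h0] := eqVneq (h ord0) 0.
  have hn0 : exists i, h (lift ord0 i) != 0.
    case: (unliftP ord0 i0) hi0 => [j ->|->]; first by exists j.
    by rewrite h0 eqxx.
  apply: (@le_trans _ _ (\int[mu]_x ((\1_(itvK K) x)%:E * ((4 * K%:R + 8) ^+ k * e)%:E))%E).
    apply: ge0_le_integral => //.
    - by move=> x _; apply: integral_ge0 => y _; rewrite lee_fin.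
    - exact: (@measurable_fun_fubini_tonelli_F _ _ _ _ _ _ _ mf f0).
    - apply: emeasurable_funM => //; apply/measurable_EFinP; exact: measurable_indic.
    move=> x _; apply: (@le_trans _ _ (\int[nu k]_y ((\1_(itvK K) x)%:E *
        (\1_(near_res_set (fun i => h (lift ord0 i)) b e K) y)%:E))%E).
      apply: ge0_le_integral => //.
      - exact: (measurableT_comp mf (pair1_measurable x)).
      - apply: measurable_funeM; apply/measurable_EFinP; apply: measurable_indic.
        exact: measurable_near_res_set.
      move=> y _; rewrite -EFinM lee_fin !indicE.
      case: (boolP (rV_cons (x, y) \in _)) => [|_]; last by rewrite mulr_ge0.
      rewrite inE => -[/rV_cube_consE[hx hy] [q hq]].
      rewrite !mem_set ?mulr1//.
        by split=> //; exists q; move: hq; rewrite dot_cons h0 mul0r add0r.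
      by rewrite /itvK /= in_itv /= -ler_norml.
    rewrite ge0_integralZl_EFin//; last first.
      by apply/measurable_EFinP; apply: measurable_indic; exact: measurable_near_res_set.
    rewrite integral_indic//; last exact: measurable_near_res_set.
    by rewrite setIT lee_wpmul2l ?lee_fin// IH.
  rewrite ge0_integralZr//; [|by apply/measurable_EFinP; exact: measurable_indic|].
    rewrite integral_itvK -EFinM lee_fin mulrA exprS.
    apply: ler_wpM2r; first exact: ltW.
    by apply: ler_wpM2r; [exact: exprn_ge0|lra].
  by rewrite lee_fin mulr_ge0 ?exprn_ge0// ltW.
rewrite (@fubini_tonelli _ _ _ _ _ _ _ _ mf f0).
have mQ := @measurable_rV_cube k K.
apply: (@le_trans _ _ (\int[nu k]_y ((\1_(rV_cube k K) y)%:E * ((4 * K%:R + 8) * e)%:E))%E).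
  apply: ge0_le_integral => //.
  - by move=> y _; apply: integral_ge0 => x _; exact: f0.
  - exact: (@measurable_fun_fubini_tonelli_G _ _ _ _ _ _ _ mf f0).
  - by apply: emeasurable_funM => //; apply/measurable_EFinP; exact: measurable_indic.
  move=> y _.
  have mI := @measurable_near_int_set (h ord0) (dot (fun i => h (lift ord0 i)) y + b) e K.
  apply: (@le_trans _ _ (\int[mu]_x ((\1_(rV_cube k K) y)%:E *
      (\1_(near_int_set (h ord0) (dot (fun i => h (lift ord0 i)) y + b) e K) x)%:E))%E).
    apply: ge0_le_integral => //.
    - exact: (measurableT_comp mf (pair2_measurable y)).
    - by apply: measurable_funeM; apply/measurable_EFinP; exact: measurable_indic.
    move=> x _; rewrite -EFinM lee_fin !indicE.
    case: (boolP (rV_cons (x, y) \in _)) => [|_]; last by rewrite mulr_ge0.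
    rewrite inE => -[/rV_cube_consE[hx hy] [q hq]].
    rewrite !mem_set ?mulr1//.
    by split=> //; exists q; move: hq; rewrite dot_cons addrA.
  rewrite ge0_integralZl_EFin//; last by apply/measurable_EFinP; exact: measurable_indic.
  rewrite integral_indic// setIT lee_wpmul2l ?lee_fin//.
  by apply: near_int_set_le => //; rewrite e0.
have qe : 0 <= (4 * K%:R + 8) * e by rewrite mulr_ge0// ltW.
rewrite ge0_integralZr//; last by apply/measurable_EFinP; exact: measurable_indic.
rewrite integral_indic// setIT.
apply: (@le_trans _ _ (((2 * K%:R) ^+ k)%:E * ((4 * K%:R + 8) * e)%:E)%E).
  by rewrite lee_wpmul2r ?lee_fin//; exact: nu_rV_cube.
rewrite -EFinM lee_fin exprSr -mulrA.
by apply: ler_wpM2r.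
Qed.

Definition hbar (h : int) : nat := maxn 1 `|h|%N.

Definition res_weight (psi : nat -> R) k (h : 'I_k -> int) : R :=
  \prod_i ((hbar (h i))%:R * psi (hbar (h i)))^-1.

Section convergence.
Variables (psi : nat -> R) (k : nat).
Hypotheses (psi_gt0 : forall n, (1 <= n)%N -> 0 < psi n)
  (psi_sum : (\sum_(1 <= n <oo) (1 / (n%:R * psi n))%:E < +oo)%E).

Lemma hbar_ge1 h : (1 <= hbar h)%N. Proof. exact: leq_maxl. Qed.

Lemma hbar_term_gt0 h : 0 < ((hbar h)%:R * psi (hbar h))^-1.
Proof.
by rewrite invr_gt0 mulr_gt0 ?ltr0n ?hbar_ge1// psi_gt0// hbar_ge1.
Qed.

Lemma res_weight_gt0 (h : 'I_k -> int) : 0 < res_weight psi h.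
Proof. by apply: prodr_gt0 => i _; exact: hbar_term_gt0. Qed.

Lemma psi_partial_sums : exists2 S : R, 0 < S &
  forall n, \sum_(1 <= i < n) (i%:R * psi i)^-1 <= S.
Proof.
have t0 n : (1 <= n)%N -> 0 <= (n%:R * psi n)^-1.
  by move=> n1; rewrite invr_ge0 mulr_ge0// ltW// psi_gt0.
have hfin := psi_sum; set X := (\sum_(1 <= n <oo) _)%E in hfin.
have X0 : (0 <= X)%E by apply: nneseries_ge0 => n n1 _; rewrite lee_fin mul1r t0.
have Xfin : X \is a fin_num by rewrite ge0_fin_numE.
exists (fine X + 1); first by rewrite ltr_wpDl// fine_ge0.
move=> n; apply: (@le_trans _ _ (fine X)); last by rewrite lerDl.
rewrite -lee_fin fineK// -sumEFin /X.
under eq_bigr do rewrite -[(_ * _)^-1]mul1r -/(1 / _).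
apply: (nneseries_lim_ge n) => i i1 _; rewrite lee_fin mul1r; exact: t0.
Qed.

(** The entry 0 contributes the term of index 1, and the positive and the negative entries
    contribute one partial sum each. *)
Lemma hbar_partial_sums : exists2 S : R, 0 < S &
  forall T, \sum_(j < 2 * T + 1) ((hbar (j%:Z - T%:Z))%:R * psi (hbar (j%:Z - T%:Z)))^-1 <= S.
Proof.
have [S S0 hS] := psi_partial_sums.
pose t n := (n%:R * psi n)^-1.
have t1 : 0 < t 1%N by rewrite invr_gt0 mulr_gt0// psi_gt0.
exists (t 1%N + S + S); first by rewrite !addr_gt0.
move=> T; rewrite -(big_mkord xpredT (fun j => t (hbar (j%:Z - T%:Z)))).
rewrite (big_cat_nat _ (n := T)) //=; last by rewrite mul2n -addnn -addnA leq_addr.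
rewrite (big_cat_nat _ (m := T) (n := T.+1)) //=; last by rewrite mul2n -addnn addn1 ltnS leq_addr.
rewrite big_nat1 subrr addrA [X in X <= _]addrAC.
have -> : \sum_(0 <= j < T) t (hbar (j%:Z - T%:Z)) = \sum_(1 <= j < T.+1) t j.
  rewrite big_nat_rev /= add0n [RHS]big_add1 /=.
  by apply: eq_big_nat => j /= jT; congr t; rewrite /hbar; lia.
have -> : \sum_(T.+1 <= j < 2 * T + 1) t (hbar (j%:Z - T%:Z)) = \sum_(1 <= j < T.+1) t j.
  rewrite -[X in \sum_(X <= _ < _) _]add1n big_addn.
  have -> : (2 * T + 1 - T = T.+1)%N by lia.
  by apply: eq_big_nat => j /= /andP[j1 _]; congr t; rewrite /hbar; lia.
rewrite addrC addrA; apply: lerD; last exact: hS.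
by rewrite lerD2l; exact: hS.
Qed.

Definition int_box (T : nat) (g : {ffun 'I_k -> 'I_(2 * T + 1)}) : 'I_k -> int :=
  fun i => (g i)%:Z - T%:Z.

(** The weight is a product over the coordinates, so its sum over a box is the k-th power of a
    one-dimensional sum. *)
Lemma res_weight_box_sum : exists2 S : R, 0 < S &
  forall T, \sum_(g : {ffun 'I_k -> 'I_(2 * T + 1)}) res_weight psi (int_box g) <= S.
Proof.
have [S S0 hS] := hbar_partial_sums; exists (S ^+ k); first exact: exprn_gt0.
move=> T; rewrite /res_weight /int_box.
rewrite -(bigA_distr_bigA (fun (_ : 'I_k) (j : 'I_(2 * T + 1)) =>
  ((hbar (j%:Z - T%:Z))%:R * psi (hbar (j%:Z - T%:Z)))^-1)).
rewrite prodr_const card_ord lerXn2r ?nnegrE ?(ltW S0)//.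
by apply: sumr_ge0 => j _; exact: ltW (hbar_term_gt0 _).
Qed.

Definition bad_box (e : R) (K T : nat) : set 'rV[R]_k :=
  \big[setU/set0]_(g <- enum {: {ffun 'I_k -> 'I_(2 * T + 1)}})
    (if [exists i, int_box g i != 0] then near_res_set (int_box g) 0 (e * res_weight psi (int_box g)) K
     else set0).

Lemma measurable_bad_box e K T : measurable (bad_box e K T).
Proof.
apply: bigsetU_measurable => g _; case: ifP => // _; exact: measurable_near_res_set.
Qed.

(** A union bound. The estimate of each resonant set is linear in its width, so the weights add up
    to a constant independent of [T]. *)
Lemma nu_bad_box K : exists2 C : R, 0 < C & forall e T, 0 < e ->
  (nu k (bad_box e K T) <= (C * e)%:E)%E.
Proof.
have [S S0 hS] := res_weight_box_sum.
have q0 : 0 < 4 * K%:R + 8 :> R by rewrite ltr_wpDl// mulr_ge0.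
exists ((4 * K%:R + 8) ^+ k * S); first by rewrite mulr_gt0// exprn_gt0.
move=> e T e0; apply: (le_trans (measure_bigcup_seq _ _ _)).
  by move=> g; case: ifP => // _; exact: measurable_near_res_set.
apply: (@le_trans _ _ (\sum_(g <- enum {: {ffun 'I_k -> 'I_(2 * T + 1)}})
   ((4 * K%:R + 8) ^+ k * (e * res_weight psi (int_box g)))%:E)%E).
  apply: lee_sum => g _; have w0 : 0 < e * res_weight psi (int_box g).
    by rewrite mulr_gt0// res_weight_gt0.
  case: ifPn => [/existsP hn0|_]; first exact: nu_near_res_set.
  by rewrite measure0 lee_fin mulr_ge0 ?exprn_ge0// ltW.
rewrite sumEFin lee_fin big_enum /= -mulr_sumr -mulr_sumr -mulrA.
rewrite ler_pM2l ?exprn_gt0// [S * e]mulrC ler_pM2l//.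
by apply: (le_trans _ (hS T)); rewrite (eq_bigl xpredT).
Qed.

Lemma bad_box_homo e K : {homo bad_box e K : n m / (n <= m)%N >-> (n <= m)%O}.
Proof.
move=> n m nm; apply/subsetPset => al.
rewrite /bad_box -bigcup_seq => -[g _]; case: ifPn => // /existsP[i gi] hal.
have hg j : (g j + (m - n) < 2 * m + 1)%N.
  by have := ltn_ord (g j); lia.
pose g' : {ffun 'I_k -> 'I_(2 * m + 1)} := [ffun j => Ordinal (hg j)].
have gg : int_box g' = int_box g.
  by apply/funext => j; rewrite /int_box ffunE /=; lia.
apply: (bigsetU_seqP (i := g')); first by rewrite mem_enum.
by rewrite gg ifT//; apply/existsP; exists i.
Qed.

Lemma bad_set_mem e K (h : 'I_k -> int) al : (exists i, h i != 0) ->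
  rV_cube k K al -> (exists q : int, `|dot h al - q%:~R| < e * res_weight psi h) ->
  (\bigcup_T bad_box e K T) al.
Proof.
move=> [i0 hi0] hal [q hq].
pose T := (\max_i `|h i|%N)%N; exists T => //.
have hT i : (`|h i| <= T)%N by exact: (leq_bigmax (F := fun i => `|h i|%N)).
have hb i : (`|(h i + T%:Z)%R| < 2 * T + 1)%N by have := hT i; lia.
pose g : {ffun 'I_k -> 'I_(2 * T + 1)} := [ffun j => Ordinal (hb j)].
have gh : int_box g = h.
  by apply/funext => j; rewrite /int_box ffunE /=; have := hT j; lia.
apply: (bigsetU_seqP (i := g)); first by rewrite mem_enum.
rewrite gh ifT; last by apply/existsP; exists i0.
by split=> //; exists q; rewrite addr0.
Qed.

(** Inside the cube of size [K], the set where the constant [2 ^- j] fails for some [h] has measure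
    at most [C * 2 ^- j], by continuity from below in [T]. Failing for every [j] is therefore a null
    event, and elsewhere some [2 ^- j] serves as [c]. *)
Lemma diophantine_ae : {ae nu k, forall al : 'rV[R]_k, exists2 c : R, 0 < c &
  forall h : 'I_k -> int, (exists i, h i != 0) -> forall q : int,
    c * res_weight psi h <= `|dot h al - q%:~R|}.
Proof.
pose bad K := \bigcap_(j in [set: nat]) \bigcup_(T in [set: nat]) bad_box (2 ^- j) K T.
have mU e K : measurable (\bigcup_(T in [set: nat]) bad_box e K T).
  by apply: bigcupT_measurable => T; exact: measurable_bad_box.
have badN K : (nu k).-negligible (bad K).
  have mB : measurable (bad K) by apply: bigcapT_measurable => j; exact: mU.
  exists (bad K); split => //.
  have [C C0 hC] := nu_bad_box K.
  have le j : (nu k (bad K) <= (C * 2 ^- j)%:E)%E.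
    apply: (@le_trans _ _ (nu k (\bigcup_(T in [set: nat]) bad_box (2 ^- j) K T))).
      by apply: le_measure; rewrite ?inE; [exact: mB|exact: mU|move=> al; apply].
    have := @nondecreasing_cvg_mu _ _ _ (nu k) _ (measurable_bad_box (2 ^- j) K) (mU _ _)
      (@bad_box_homo (2 ^- j) K).
    move/cvg_lim => <- //; apply: lime_le.
      apply: ereal_nondecreasing_is_cvgn => n m nm; apply: le_measure; rewrite ?inE.
      - exact: measurable_bad_box.
      - exact: measurable_bad_box.
      - by apply/subsetPset; exact: bad_box_homo.
    by apply: nearW => T; apply: hC; rewrite invr_gt0 exprn_gt0.
  apply/eqP; rewrite eq_le measure_ge0 andbT.
  apply/lee_addgt0Pr => e e0; rewrite add0e.
  have [j hj] : exists j, C * 2 ^- j <= e.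
    exists (Num.truncn (C / e)).+1; rewrite ler_pdivrMr ?exprn_gt0//.
    rewrite mulrC -ler_pdivrMr// (le_trans (ltW (truncnS_gt _)))//.
    by rewrite -natrX ler_nat ltnW// ltn_expl.
  by rewrite (le_trans (le j))// lee_fin.
have : (nu k).-negligible (\bigcup_K bad K) by exact: negligible_bigcup.
apply: negligibleS => al /= nal.
pose K := Num.truncn (\sum_i `|al ord0 i|); exists K.+1 => //.
have hal : rV_cube k K.+1 al.
  move=> i; rewrite (le_trans _ (ltW (truncnS_gt _)))//.
  by rewrite (bigD1 i)//= lerDl sumr_ge0.
move=> j _; apply: contrapT => nj; apply: nal.
exists (2 ^- j); first by rewrite invr_gt0 exprn_gt0.
move=> h hn0 q; rewrite leNgt; apply/negP => hq; apply: nj.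
by apply: (bad_set_mem hn0 hal); exists q.
Qed.

End convergence.

End diophantine.

(** * Sums of products of dyadic layers *)

Section layers.
Context {R : realType}.

Definition layer (A T : nat) (x : R) : R :=
  \sum_(t < T.+1) (2 ^+ A) ^- t * (x <= 2 ^+ t)%R%:R.

Lemma layer_ge0 A T x : 0 <= layer A T x.
Proof. by apply: sumr_ge0 => t _; rewrite mulr_ge0// invr_ge0 !exprn_ge0. Qed.

Lemma geometric_half_le T : \sum_(t < T.+1) 2 ^- t <= 2 :> R.
Proof.
suff -> : \sum_(t < T.+1) 2 ^- t = 2 - 2 ^- T :> R.
  by rewrite gerBl invr_ge0 exprn_ge0.
elim: T => [|T IH]; first by rewrite big_ord1 expr0 invr1; ring.
by rewrite big_ord_recr /= IH exprS invfM; field; rewrite expf_neq0.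
Qed.

(** Expanding the product of layers leaves one box count for each vector [f] of exponents. Of the
    decay of order [B.+1], the power [B] pays for the growth of the count and one power leaves a
    convergent geometric series. The factor [8 ^+ d] is [4 ^+ d] from the count times [2 ^+ d] from
    the series. *)
Lemma layer_box_sum (I : finType) (d : nat) (X : I -> 'I_d -> R) (Y : R) (B T : nat)
    (j : 'I_d -> nat) : 0 < Y -> (0 < B)%N ->
  (forall a b, a != b -> forall l : 'I_d -> nat,
    (forall i, `|X a i - X b i| <= 2 ^+ l i) -> Y <= 2 ^+ (\sum_i l i)%N) ->
  (forall a b, (forall i, `|X a i - X b i| < 1) -> a = b) ->
  (forall a (l : 'I_d -> nat), (forall i, `|X a i| <= 2 ^+ l i) -> Y <= 2 ^+ (\sum_i l i)%N) ->
  \sum_a \prod_i layer B.+1 T (`|X a i| / 2 ^+ j i) <=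
    2 * 8 ^+ d * (2 ^+ (\sum_i j i)%N / Y) ^+ B.
Proof.
move=> Y0 B0 sep sep1 hY.
have p2 n : 0 < 2 ^+ n :> R by rewrite exprn_gt0.
have q0 n : 0 <= 2 ^+ n / Y by rewrite divr_ge0// ltW.
have ex a : \prod_i layer B.+1 T (`|X a i| / 2 ^+ j i) = \sum_(f : {ffun 'I_d -> 'I_T.+1})
    \prod_i ((2 ^+ B.+1) ^- f i * (`|X a i| / 2 ^+ j i <= 2 ^+ f i)%R%:R).
  exact: (bigA_distr_bigA (fun i (t : 'I_T.+1) => (2 ^+ B.+1) ^- t * (`|X a i| / 2 ^+ j i <= 2 ^+ t)%R%:R)).
rewrite (eq_bigr _ (fun a _ => ex a)) exchange_big /=.
apply: (@le_trans _ _ (\sum_(f : {ffun 'I_d -> 'I_T.+1})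
   2 * 4 ^+ d * (2 ^+ (\sum_i j i)%N / Y) ^+ B * \prod_i 2 ^- f i)).
  apply: ler_sum => f _.
  have e a : \prod_i ((2 ^+ B.+1) ^- f i * (`|X a i| / 2 ^+ j i <= 2 ^+ f i)%R%:R) =
     (\prod_i (2 ^+ B.+1) ^- f i) * (a \in [set a | [forall i, `|X a i| <= 2 ^+ (f i + j i)]]%SET)%:R :> R.
    rewrite big_split /=; congr (_ * _).
    under eq_bigr do rewrite ler_pdivrMr// -exprD.
    rewrite inE; case: (boolP [forall i, _]) => [/forallP h|/forallPn[i hi]].
      by apply: big1 => i _; rewrite h.
    by rewrite (bigD1 i)//= (negbTE hi) mul0r.
  rewrite (eq_bigr _ (fun a _ => e a)) -mulr_sumr -natr_sum -big_mkcond /= sum1_card.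
  have := @centered_box_count R I d X Y Y0 sep sep1 B (fun i => (f i + j i)%N) B0.
  move=> /(_ (fun a => hY a _)) h.
  apply: (le_trans (ler_wpM2l _ h)).
    by apply: prodr_ge0 => i _; rewrite invr_ge0 exprn_ge0// ltW.
  rewrite big_split /= exprD -mulrA expr_div_n exprMn.
  rewrite (_ : \prod_(i < d) (2 ^+ B.+1) ^- f i = (2 ^+ (\sum_i f i)%N) ^- B * \prod_i 2 ^- f i); last first.
    rewrite expr_sum -prodrXl -prodfV -big_split /=; apply: eq_bigr => i _.
    by rewrite -!exprM -invfM -exprD mulSn mulnC addnC.
  rewrite le_eqVlt; apply/orP; left; apply/eqP.
  by rewrite expr_div_n; field; rewrite !expf_neq0// gt_eqF.
rewrite -mulr_sumr -(bigA_distr_bigA (fun (_ : 'I_d) (t : 'I_T.+1) => 2 ^- t)) prodr_const card_ord.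
set Q := (_ / Y) ^+ B; have Q0 : 0 <= Q by exact: exprn_ge0.
have -> : 2 * 8 ^+ d * Q = 2 * 4 ^+ d * Q * 2 ^+ d.
  by rewrite (_ : 8 = 4 * 2) ?exprMn; ring.
apply: ler_wpM2l; first by rewrite !mulr_ge0// exprn_ge0.
apply: lerXn2r; rewrite ?nnegrE//; last exact: geometric_half_le.
by apply: sumr_ge0 => t _; rewrite invr_ge0 exprn_ge0.
Qed.

End layers.

(** * Riemann sums of dilated kernels *)

Section riemann.
Context {R : realType}.
Local Notation mu := (@lebesgue_measure R).
Implicit Types (g : R -> R) (r s x : R).

Lemma pow2_unbounded (x : R) : exists T, x <= 2 ^+ T.
Proof.
exists (Num.truncn x).+1; rewrite (le_trans (ltW (truncnS_gt _)))//.
by rewrite -natrX ler_nat ltnW// ltn_expl.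
Qed.

Lemma complexB (x y : R) : (x - y)%:C%C = x%:C%C - y%:C%C :> R[i].
Proof. exact: rmorphB. Qed.

(** Used to subtract a constant term by term from an average over [b]. *)
Lemma complex_average (I : finType) (z : R[i]) : (0 < #|I|)%N ->
  (#|I|%:R^-1)%:C%C * \sum_(i : I) z = z.
Proof.
move=> I0; rewrite sumr_const.
have -> : z *+ #|I| = (#|I|%:R)%:C%C * z by rewrite (rmorph_nat (real_complex R)) mulr_natl.
rewrite mulrA; have -> : (#|I|%:R^-1)%:C%C * (#|I|%:R)%:C%C = 1 :> R[i].
  by rewrite -(rmorphM (real_complex R)) mulVf ?pnatr_eq0 -?lt0n// rmorph1.
exact: mul1r.
Qed.

Lemma ler_sum_card (I : finType) (F : I -> R) K : (forall i, F i <= K) ->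
  \sum_i F i <= K * #|I|%:R.
Proof. by move=> h; rewrite mulr_natr -sumr_const; apply: ler_sum => i _. Qed.

Lemma cvg_dist_le (u : nat -> R) l a K : u @ \oo --> l ->
  (forall M, (0 < M)%N -> `|u M - a| <= K) -> `|l - a| <= K.
Proof.
move=> ul h.
have c : (fun M => `|u M - a|) @ \oo --> `|l - a| by apply: cvg_norm; apply: cvgB => //; exact: cvg_cst.
rewrite -(cvg_lim (@Rhausdorff R) c); apply: limr_le; first by apply/cvg_ex; exists `|l - a|.
by near=> M; apply: h; near: M; exact: nbhs_infty_gt.
Unshelve. all: by end_near.
Qed.

Lemma natr_dist (a b : nat) : a != b -> 1 <= `|a%:R - b%:R| :> R.
Proof.
wlog ab : a b / (a < b)%N.
  move=> H h; have [ab|ba|e] := ltngtP a b; first exact: H.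
  - by rewrite distrC; apply: H => //; rewrite eq_sym.
  - by rewrite e eqxx in h.
move=> _; rewrite distrC; apply: le_trans (ler_norm _).
by rewrite lerBrDr addrC natr1 ler_nat.
Qed.

Lemma sum_window (W T : nat) (F : R -> R) : (W <= T)%N ->
  (forall u, u < 0 \/ W%:R <= u -> F u = 0) ->
  \sum_(q < 2 * T + 1) F (- (q%:R - T%:R)) = \sum_(n < W) F n%:R.
Proof.
move=> WT F0.
rewrite -(big_mkord xpredT (fun q => F (- (q%:R - T%:R)))) big_nat_rev /= add0n.
have e1 : (T <= 2 * T + 1)%N by lia.
have e2 : (T + W <= 2 * T + 1)%N by lia.
rewrite (big_cat_nat (leq0n T) e1) /= (big_cat_nat (leq_addr W T) e2) /=.
rewrite big1_seq ?add0r; last first.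
  move=> q; rewrite mem_index_iota => /andP[_ qT]; apply: F0; left.
  by rewrite opprB subr_lt0 ltr_nat; lia.
rewrite [X in _ + X]big1_seq ?addr0; last first.
  move=> q; rewrite mem_index_iota => /andP[_ qT]; apply: F0; right.
  by rewrite opprB lerBrDr -natrD ler_nat; lia.
rewrite -[X in \sum_(X <= _ < _) _]add0n big_addn addKn big_mkord.
apply: eq_bigr => n _; congr F; rewrite opprB.
by have -> : (2 * T + 1 - (n + T).+1 = T - n)%N by [lia]; rewrite natrB ?subKr; [|have := ltn_ord n; lia].
Qed.

Lemma fhat_at0 g : fhat g 0 = (\int[mu]_z g z)%:C%C.
Proof.
rewrite /fhat; congr Complex.
  by apply: eq_Rintegral => z _; rewrite mulr0 mul0r cos0 mulr1.
apply/eqP; rewrite oppr_eq0; apply/eqP; transitivity (\int[mu]_z (0 : R)); last exact: rintegral0.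
by apply: eq_Rintegral => z _; rewrite mulr0 mul0r sin0 mulr0.
Qed.

(* The Fejer frequencies a, b < M with a != b contribute the tail of the Poisson summation formula. *)
Lemma riemann_dil B g r : tame g -> 0 <= r -> csupp r g -> (0 < B)%N ->
  exists2 C, 0 <= C & forall (j N W : nat) x, (0 < N)%N -> 2 ^+ j <= N%:R :> R ->
    x < - r -> r < x + W%:R / N%:R ->
    `|N%:R^-1 * \sum_(n < W) dil (2 ^+ j) g (x + n%:R / N%:R) - \int[mu]_z g z| <=
      C * (2 ^+ j / N%:R) ^+ B.
Proof.
move=> tg r0 hg B0; have [C C0 hC] := fhat_layer B.+1 tg.
exists (C * (2 * 8)); first by rewrite mulr_ge0.
move=> j N W x N0 sN hx hW.
have NR : 0 < N%:R :> R by rewrite ltr0n.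
have s0 : 0 < 2 ^+ j :> R by rewrite exprn_gt0.
have s1 : 1 <= 2 ^+ j :> R by rewrite exprn_ege1// ler1n.
(* After scaling by [N] the nodes are consecutive integers, and the Riemann sum becomes a
   periodisation of [dil c g]. *)
pose c : R := 2 ^+ j / N%:R; have c0 : 0 < c by rewrite divr_gt0.
have tG := tame_dil c tg; have hG := csupp_dil c0 hg.
have cG := tame_continuous tG.
pose T := maxn W (Num.truncn (`|N%:R * x| + r / c)).+1.
have xT : `|N%:R * x| + r / c <= T%:R.
  by rewrite (le_trans (ltW (truncnS_gt _)))// ler_nat leq_maxr.
have sumE : \sum_(q < 2 * T + 1) dil c g (N%:R * x - (q%:R - T%:R)) =
    N%:R^-1 * \sum_(n < W) dil (2 ^+ j) g (x + n%:R / N%:R).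
  have rc : r / c <= r * N%:R.
    rewrite ler_pdivrMr// (_ : r * N%:R * c = r * 2 ^+ j); last by rewrite /c; field; rewrite gt_eqF.
    by rewrite ler_peMr.
  have hz (u : R) : u < 0 \/ W%:R <= u -> dil c g (N%:R * x + u) = 0.
    move=> hu; apply: hG; apply: (le_lt_trans rc).
    have e : N%:R * (x + W%:R / N%:R) = N%:R * x + W%:R by field; rewrite gt_eqF.
    have h1 : N%:R * r < N%:R * (x + W%:R / N%:R) by rewrite ltr_pM2l.
    have h2 : N%:R * x < N%:R * - r by rewrite ltr_pM2l.
    rewrite e in h1.
    by case: hu => hu; rewrite ltr_normr; apply/orP; [right|left]; lra.
  rewrite (sum_window (W := W) (F := fun u => dil c g (N%:R * x + u)) _ hz) ?leq_maxl//.
  rewrite mulr_sumr; apply: eq_bigr => n _; rewrite /dil /c.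
  have -> : 2 ^+ j / N%:R * (N%:R * x + n%:R) = 2 ^+ j * (x + n%:R / N%:R).
    by field; rewrite gt_eqF.
  by rewrite mulrA [_ / _]mulrC.
have lim := fejer_cvg tG hG xT; rewrite sumE in lim.
have key M : (0 < M)%N ->
    `|\int[mu]_z (dil c g z * fejer M (N%:R * x - z)) - \int[mu]_z g z| <= C * (2 * 8) * c ^+ B.
  move=> M0.
  have [T' hT'] := pow2_unbounded (M%:R / c).
  have cE (h : R) : `|h / c| = `|N%:R * h| / 2 ^+ j.
    rewrite /c invfM invrK mulrCA !normrM (ger0_norm (x := N%:R))// (ger0_norm (x := _^-1)) ?invr_ge0 ?ltW//.
    by rewrite mulrC [`|h| * _]mulrC.
  have hb a b : (a < M)%N -> (b < M)%N -> normc (fhat (dil c g) (a%:R - b%:R)) <=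
      C * layer B.+1 T' (`|N%:R * (a%:R - b%:R)| / 2 ^+ j).
    move=> aM bM; rewrite (fhat_dil _ tg c0) -cE; apply: hC; apply: le_trans hT'.
    rewrite normrM (gtr0_norm (x := c^-1)) ?invr_gt0// ler_wpM2r ?invr_ge0 ?(ltW c0)//.
    have : 0 <= a%:R :> R by []. have : 0 <= b%:R :> R by [].
    have : a%:R <= M%:R :> R by rewrite ler_nat ltnW.
    have : b%:R <= M%:R :> R by rewrite ler_nat ltnW.
    by rewrite ler_norml => *; apply/andP; split; lra.
  rewrite -normc_real complexB (fejer_fhat M _ cG hG).
  have -> : (\int[mu]_z g z)%:C%C = (M%:R^-1)%:C%C * \sum_(b < M) (\int[mu]_z g z)%:C%C :> R[i].
    by have := @complex_average 'I_M (\int[mu]_z g z)%:C%C; rewrite card_ord => ->.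
  rewrite exchange_big /= -mulrBr -sumrB normcM normc_real.
  rewrite ger0_norm ?invr_ge0// mulrC ler_pdivrMr ?ltr0n//.
  apply: (le_trans (normc_sum _ _ _)).
  rewrite -[in X in _ <= X](card_ord M); apply: ler_sum_card => b.
  rewrite (bigD1 b) //= subrr mul0r fhat_at0 ei0 mulr1 (rintegral_dil c0 tg) addrAC subrr add0r.
  apply: (le_trans (normc_sum _ _ _)).
  apply: (@le_trans _ _ (\sum_(a < M | a != b) C * layer B.+1 T' (`|N%:R * (a%:R - b%:R)| / 2 ^+ j))).
    by apply: ler_sum => a _; rewrite normcM normc_ei mulr1; exact: hb.
  rewrite -mulr_sumr -mulrA ler_wpM2l// (big_sub [pred a | a != b]) /=.
  (* For [a != b] the points are [N]-separated and at distance at least [N] from 0, so the count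
     applies in dimension 1 with [Y = N]. *)
  pose X (a : {x in [pred a : 'I_M | a != b]}) (_ : 'I_1) : R := N%:R * ((val a)%:R - b%:R).
  have XB a a' i : X a i - X a' i = N%:R * ((val a)%:R - (val a')%:R) by rewrite /X; ring.
  have big1 (h : R) : 1 <= `|h| -> N%:R <= `|N%:R * h|.
    by move=> h1; rewrite normrM ger0_norm// ler_peMr.
  have Xd a a' i : a != a' -> N%:R <= `|X a i - X a' i|.
    by move=> aa; rewrite XB; apply/big1/natr_dist; apply: contraNneq aa => e; apply/eqP/val_inj/val_inj.
  have h1 := @layer_box_sum R _ 1 X N%:R B T' (fun _ => j) NR B0.
  rewrite big_ord1 expr1 in h1; apply: le_trans (h1 _ _ _); last 3 first.
  - move=> a a' aa l /(_ ord0); rewrite big_ord1; apply: le_trans; exact: Xd.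
  - move=> a a' /(_ ord0) h; apply/eqP; apply: contraTT h => aa; rewrite -leNgt.
    by rewrite (le_trans _ (Xd _ _ _ aa))// ler1n.
  - move=> a l /(_ ord0); rewrite big_ord1; apply: le_trans; apply/big1/natr_dist.
    by have := valP a; rewrite inE.
  by apply: ler_sum => a _; rewrite big_ord1.
exact: cvg_dist_le lim key.
Qed.

End riemann.

(** * The quadrature error of the dual kernels *)

Section kronecker_kernel.
Context {R : realType}.
Local Notation mu := (@lebesgue_measure R).
Implicit Types (r x : R).

(* [l ord0] is the dyadic size of the frequency belonging to the coordinate [n / N]; the
   other entries of [l] are those of [h]. *)
Definition resonance_free k (N : nat) (alpha : 'rV[R]_k) (Y : R) :=
  forall (h : 'I_k -> int), (exists i, h i != 0) -> forall (q : int) (l : 'I_k.+1 -> nat),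
  (forall i, `|(h i)%:~R| <= 2 ^+ l (lift ord0 i) :> R) ->
  N%:R * `|dot h alpha - q%:~R| <= 2 ^+ l ord0 -> Y <= 2 ^+ (\sum_i l i)%N.

Lemma ei_frac (h : int) (t v : R) : ei (h%:~R * (Defs.frac t - v)) = ei (h%:~R * (t - v)).
Proof.
have -> : h%:~R * (Defs.frac t - v) = h%:~R * (t - v) + (- (h * Num.floor t))%:~R.
  by rewrite /Defs.frac rmorphN rmorphM /=; ring.
by rewrite eiD ei_int mulr1.
Qed.

Lemma cvg_bigsum (I : Type) (s : seq I) (u : I -> nat -> R) (l : I -> R) :
  (forall i, u i @ \oo --> l i) -> (fun M => \sum_(i <- s) u i M) @ \oo --> \sum_(i <- s) l i.
Proof. by move=> h; apply: cvg_big => // -[x y]; exact: add_continuous. Qed.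

Lemma cvg_bigprod (I : Type) (s : seq I) (u : I -> nat -> R) (l : I -> R) :
  (forall i, u i @ \oo --> l i) -> (fun M => \prod_(i <- s) u i M) @ \oo --> \prod_(i <- s) l i.
Proof. by move=> h; apply: cvg_big => // -[x y]; exact: mul_continuous. Qed.

(* The product of the Fejer means over all coordinates, as a single sum over pairs of frequency vectors. *)
Lemma fejer_fhat_prod k M (g : 'I_k -> R -> R) (r x : 'I_k -> R) :
  (forall i, continuous (g i)) -> (forall i, csupp (r i) (g i)) ->
  (\prod_i \int[mu]_z (g i z * fejer M (x i - z)))%:C%C =
  (#|{ffun 'I_k -> 'I_M}|%:R^-1)%:C%C * \sum_(a : {ffun 'I_k -> 'I_M}) \sum_(b : {ffun 'I_k -> 'I_M})
    \prod_i (fhat (g i) ((a i)%:R - (b i)%:R) * ei (((a i)%:R - (b i)%:R) * x i)) :> R[i].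
Proof.
move=> cg hg; rewrite (rmorph_prod (real_complex R)) /=.
under eq_bigr do rewrite (fejer_fhat M _ (cg _) (hg _)).
rewrite big_split /= prodr_const card_ord card_ffun !card_ord; congr (_ * _).
  by rewrite -(rmorphXn (real_complex R)) /= exprVn natrX.
rewrite bigA_distr_bigA; apply: eq_bigr => a _.
exact: (bigA_distr_bigA (fun i (b : 'I_M) => fhat (g i) ((a i)%:R - b%:R) * ei (((a i)%:R - b%:R) * x i))).
Qed.

Section ocons.
Variables (T : Type) (k : nat).
Implicit Types (a : T) (u : 'I_k -> T).

Definition ocons a u (i : 'I_k.+1) : T := if unlift ord0 i is Some i' then u i' else a.

Lemma ocons0 a u : ocons a u ord0 = a.
Proof. by rewrite /ocons unlift_none. Qed.

Lemma oconsS a u i : ocons a u (lift ord0 i) = u i.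
Proof. by rewrite /ocons liftK. Qed.

End ocons.

Section twisted_mean.
Variables (k B N W M : nat) (alpha : 'rV[R]_k) (Y r C1 C2 x0 t : R) (f0 : R -> R)
  (f : 'I_k -> R -> R) (j0 : nat) (j : 'I_k -> nat) (v : 'I_k -> R).
Hypotheses (N0 : (0 < N)%N) (B0 : (0 < B)%N) (Y0 : 0 < Y) (C10 : 0 <= C1) (C20 : 0 <= C2)
  (tf : forall i, tame (f i)) (hf : forall i, csupp r (f i))
  (h1 : forall i (x : R) (T : nat), `|x| <= 2 ^+ T -> normc (fhat (f i) x) <= C1 * layer B.+1 T `|x|)
  (h2 : forall (T : nat) beta (q : int), `|beta - q%:~R| <= 1 / 2 -> N%:R <= 2 ^+ T :> R ->
    N%:R^-1 * normc (\sum_(n < W) (dil (2 ^+ j0) f0 (x0 + n%:R / N%:R))%:C%C * ei (n%:R * beta)) <=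
    C2 * layer B.+1 T (N%:R * `|beta - q%:~R| / 2 ^+ j0))
  (res : resonance_free N alpha Y).
Local Notation I := {ffun 'I_k -> 'I_M}.
Let phi (n : nat) : R := dil (2 ^+ j0) f0 (x0 + n%:R / N%:R).
Let fd i := dil (2 ^+ j i) (f i).
Let x i (n : nat) : R := Defs.frac ((n%:R - t) * alpha ord0 i) - v i.
Let h (a b : I) i : int := (a i)%:Z - (b i)%:Z.
Let U (a b : I) : R[i] := \prod_i (fhat (fd i) (h a b i)%:~R * ei ((h a b i)%:~R * (- t * alpha ord0 i - v i))).
Let V (a b : I) : R[i] := U a b * ((N%:R^-1)%:C%C * \sum_(n < W) (phi n)%:C%C * ei (n%:R * dot (h a b) alpha)).

Let hE a b i : (h a b i)%:~R = (a i)%:R - (b i)%:R :> R.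
Proof. by rewrite /h rmorphB. Qed.

Let h_neq0 (a b : I) : a != b -> exists i, h a b i != 0.
Proof.
move=> ab; apply/existsP; apply: contraNT ab => /existsPn hh.
apply/eqP/ffunP => i; apply: val_inj; have /negPn/eqP := hh i.
by move/eqP; rewrite subr_eq0 => /eqP[].
Qed.

(** The frequencies are integers, so the fractional parts may be dropped; all dependence on [n] then
    merges into one exponential with slope [dot (h a b) alpha]. *)
Let frequency_term (a b : I) n : \prod_i (fhat (fd i) ((a i)%:R - (b i)%:R) * ei (((a i)%:R - (b i)%:R) * x i n)) =
  U a b * ei (n%:R * dot (h a b) alpha).
Proof.
rewrite /dot mulr_sumr ei_sum -big_split /=; apply: eq_bigr => i _.
rewrite -mulrA -eiD -hE /x ei_frac; congr (_ * ei _); ring.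
Qed.

Let p2 n : 0 < 2 ^+ n :> R. Proof. exact: exprn_gt0. Qed.

Lemma twisted_mean_expansion :
  (N%:R^-1 * \sum_(n < W) phi n * \prod_i \int[mu]_z (fd i z * fejer M (x i n - z)))%:C%C =
  (#|I|%:R^-1)%:C%C * \sum_(b : I) \sum_(a : I) V a b.
Proof.
have cg i : continuous (fd i) by exact: tame_continuous (tame_dil _ (tf i)).
have hg i : csupp (r / 2 ^+ j i) (fd i) by exact: csupp_dil.
rewrite rmorphM rmorph_sum /=.
transitivity (\sum_(n < W) \sum_b \sum_a (#|I|%:R^-1)%:C%C * (U a b * ((N%:R^-1)%:C%C *
   ((phi n)%:C%C * ei (n%:R * dot (h a b) alpha))))).
  rewrite mulr_sumr; apply: eq_bigr => n _.
  rewrite rmorphM /= (fejer_fhat_prod (r := fun i => r / 2 ^+ j i) M (fun i => x i n) cg hg) exchange_big /=.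
  rewrite !mulrA mulr_sumr; apply: eq_bigr => b _.
  rewrite mulr_sumr; apply: eq_bigr => a _; rewrite frequency_term; ring.
rewrite exchange_big mulr_sumr; apply: eq_bigr => b _ /=.
rewrite exchange_big mulr_sumr; apply: eq_bigr => a _ /=.
by rewrite /V -mulr_sumr -mulr_sumr -mulr_sumr.
Qed.

Lemma twisted_mean_diagonal b :
  V b b = (\prod_i (\int[mu]_z f i z) * (N%:R^-1 * \sum_(n < W) phi n))%:C%C.
Proof.
have hb i : (h b b i)%:~R = 0 :> R by rewrite hE subrr.
rewrite !rmorphM rmorph_sum rmorph_prod /=; congr (_ * (_ * _)).
  apply: eq_bigr => i _.
  by rewrite hb mul0r ei0 mulr1 fhat_at0 (rintegral_dil (p2 _) (tf i)).
apply: eq_bigr => n _; rewrite /dot big1 ?mulr0 ?ei0 ?mulr1// => i _.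
by rewrite hb mul0r.
Qed.

(** The pairs with [a = b] give exactly the subtracted main term. For fixed [b] each other pair is
    bounded by a product of [k.+1] layers: [k] from the decay of the Fourier transforms, one from
    the exponential sum over [n]. Then [layer_box_sum] applies. *)
Lemma twisted_mean_bound : (0 < M)%N ->
  `|N%:R^-1 * \sum_(n < W) phi n * \prod_i \int[mu]_z (fd i z * fejer M (x i n - z)) -
    (\prod_i \int[mu]_z f i z) * (N%:R^-1 * \sum_(n < W) phi n)| <=
  C2 * C1 ^+ k * (2 * 8 ^+ k.+1) * (2 ^+ (j0 + \sum_i j i)%N / Y) ^+ B.
Proof.
move=> M0; rewrite -normc_real complexB twisted_mean_expansion.
have I0 : (0 < #|I|)%N by rewrite card_ffun !card_ord expn_gt0 M0.
have IR : 0 < #|I|%:R :> R by rewrite ltr0n.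
rewrite -[X in normc (_ - X)](complex_average _ I0) -mulrBr -sumrB normcM normc_real.
rewrite ger0_norm ?invr_ge0// mulrC ler_pdivrMr//.
apply: (le_trans (normc_sum _ _ _)); apply: ler_sum_card => b.
rewrite -(twisted_mean_diagonal b) (bigD1 b) //= addrAC subrr add0r.
apply: (le_trans (normc_sum _ _ _)).
have [T' hT'] := pow2_unbounded (M%:R + N%:R : R).
have NT : N%:R <= 2 ^+ T' :> R by apply: le_trans hT'; rewrite lerDr.
pose beta a := dot (h a b) alpha; pose q a : int := Num.floor (beta a + 1 / 2).
have hq a : `|beta a - (q a)%:~R| <= 1 / 2.
  have := floor_le (beta a + 1 / 2); have := floorD1_gt (beta a + 1 / 2).
  by rewrite -/(q a) rmorphD /= ler_norml => *; lra.
(* The first entry is the signed distance of [beta a] to a nearest integer, scaled by [N]. The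
   difference of two such points has the same form for the frequency of the pair [a], [a'] and some
   integer, not necessarily the nearest; hence [resonance_free] is stated for every [q]. *)
pose X (a : I) := ocons (N%:R * (beta a - (q a)%:~R)) (fun i => (h a b i)%:~R : R).
pose jj := ocons j0 j.
apply: (@le_trans _ _ (\sum_(a : I | a != b) C2 * C1 ^+ k * \prod_i layer B.+1 T' (`|X a i| / 2 ^+ jj i))).
  apply: ler_sum => a _; rewrite /V normcM.
  rewrite big_ord_recl /X /jj !ocons0 mulrACA [leRHS]mulrC.
  apply: ler_pM; rewrite ?normc_ge0//.
    rewrite (_ : C1 ^+ k * _ = \prod_i (C1 * layer B.+1 T' (`|(h a b i)%:~R| / 2 ^+ j i))); last first.
      rewrite big_split /= prodr_const card_ord; congr (_ * _).
      by apply: eq_bigr => i _; rewrite !oconsS.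
    rewrite /U normc_prod.
    apply: ler_prod => i _; apply/andP; split; first exact: normc_ge0.
    rewrite normcM normc_ei mulr1.
    rewrite (fhat_dil _ (tf i) (p2 _)).
    have -> : `|(h a b i)%:~R| / 2 ^+ j i = `|(h a b i)%:~R / 2 ^+ j i| :> R.
      by rewrite normrM (ger0_norm (x := _^-1))// invr_ge0 ltW.
    apply: h1; apply: le_trans hT'; rewrite normrM (ger0_norm (x := _^-1)) ?invr_ge0 ?(ltW (p2 _))//.
    rewrite -[leRHS]mulr1; apply: ler_pM; rewrite ?invr_ge0 ?(ltW (p2 _))//; last first.
      by rewrite invf_le1// exprn_ege1// ler1n.
    have aM : (a i)%:R <= M%:R :> R by rewrite ler_nat ltnW.
    have bM : (b i)%:R <= M%:R :> R by rewrite ler_nat ltnW.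
    have a0 : 0 <= (a i)%:R :> R by []. have b0 : 0 <= (b i)%:R :> R by [].
    have nN : 0 <= N%:R :> R by [].
    by rewrite hE ler_norml; apply/andP; split; lra.
  rewrite normcM normc_real ger0_norm ?invr_ge0// normrM (ger0_norm (x := N%:R))//.
  exact: (h2 (hq a) NT).
rewrite -mulr_sumr -[leRHS]mulrA ler_wpM2l ?mulr_ge0 ?exprn_ge0// (big_sub [pred a | a != b]) /=.
have -> : (j0 + \sum_i j i = \sum_i jj i)%N.
  by rewrite big_ord_recl /jj ocons0; congr (_ + _)%N; apply: eq_bigr => i _; rewrite oconsS.
apply: (@layer_box_sum R _ k.+1 (fun a : {a in [pred a | a != b]} => X (val a))) => //.
- move=> a a' aa l hl.
  have hB i : (h (val a) b i - h (val a') b i = h (val a) (val a') i)%R by rewrite /h; ring.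
  apply: (@res (fun i => h (val a) b i - h (val a') b i) _ (q (val a) - q (val a'))).
  + by have [|i hi] := @h_neq0 (val a) (val a'); [|exists i; rewrite hB].
  + by move=> i; have := hl (lift ord0 i); rewrite /X !oconsS -(rmorphB intr).
  + have := hl ord0; rewrite /X !ocons0 -mulrBr normrM ger0_norm//.
    have -> : beta (val a) - (q (val a))%:~R - (beta (val a') - (q (val a'))%:~R) =
      dot (fun i => h (val a) b i - h (val a') b i) alpha - (q (val a) - q (val a'))%:~R.
      rewrite /beta /dot rmorphB /=.
      have -> : \sum_i (h (val a) b i - h (val a') b i)%:~R * alpha ord0 i =
        \sum_i (h (val a) b i)%:~R * alpha ord0 i - \sum_i (h (val a') b i)%:~R * alpha ord0 i.
        by rewrite -sumrB; apply: eq_bigr => i _; rewrite rmorphB mulrBl.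
      by ring.
    by [].
- move=> a a' hl; apply: val_inj; apply/ffunP => i; apply: val_inj; apply/eqP.
  have := hl (lift ord0 i); rewrite /X !oconsS !hE => hi.
  apply: contraTT hi => hi; rewrite -leNgt.
  by have := @natr_dist R _ _ hi; rewrite opprB addrA subrK.
- move=> a l hl; apply: (@res (h (val a) b) _ (q (val a))).
  + by apply: h_neq0; have := valP a; rewrite inE.
  + by move=> i; have := hl (lift ord0 i); rewrite /X !oconsS.
  + by have := hl ord0; rewrite /X !ocons0 normrM ger0_norm.
Qed.

End twisted_mean.

End kronecker_kernel.

(** * Bounds for the quadrature error of product kernels *)

Section kappa.
Context {R : realType}.
Local Notation mu := (@lebesgue_measure R).
Implicit Types (r x : R).

(* The integer translates of the Kronecker points: [n] runs over [0 .. 2 T N) and stands for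
   the index [n - T N], [q] for the integer vector [q - T]. *)
Definition shifted_node k (N T : nat) (alpha : 'rV[R]_k) (n : nat) (q : {ffun 'I_k -> 'I_(2 * T + 1)}) :
    'I_k.+1 -> R :=
  ocons (n%:R / N%:R - T%:R)
    (fun i => Defs.frac ((n%:R - (T * N)%:R) * alpha ord0 i) - ((q i)%:R - T%:R)).

Arguments shifted_node {k} N T alpha n q.

Definition kappa k (N T : nat) (alpha : 'rV[R]_k) (phi : 'I_k.+1 -> R -> R) (y : 'I_k.+1 -> R) : R :=
  N%:R^-1 * (\sum_(n < 2 * T * N) \sum_q \prod_i phi i (shifted_node N T alpha n q i - y i)) -
  \prod_i \int[mu]_z phi i z.

(** Only two generators occur among all levels, so a bound for each gives a bound uniform in the
    level. In [dyadicE] the scale is [2 ^+ m.-1], which is 1 for both levels 0 and 1. *)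
Definition gen (Phi0 Phi1 : R -> R) (m : nat) := if m is _.+1 then Phi1 else Phi0.

Lemma dyadicE (Phi0 Phi1 : R -> R) m :
  dyadic Phi0 Phi1 m = dil (2 ^+ m.-1) (gen Phi0 Phi1 m).
Proof. by case: m => //=; apply/funext => x; rewrite /dil expr0 !mul1r. Qed.

Lemma sum_node_prod k (N T : nat) (alpha : 'rV[R]_k) (phi : 'I_k.+1 -> R -> R) (y : 'I_k.+1 -> R) n :
  \sum_q \prod_i phi i (shifted_node N T alpha n q i - y i) =
  phi ord0 (- T%:R - y ord0 + n%:R / N%:R) *
  \prod_(i < k) \sum_(q < 2 * T + 1) phi (lift ord0 i)
    (Defs.frac ((n%:R - (T * N)%:R) * alpha ord0 i) - y (lift ord0 i) - (q%:R - T%:R)).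
Proof.
rewrite bigA_distr_bigA mulr_sumr; apply: eq_bigr => q _.
rewrite big_ord_recl /shifted_node ocons0; congr (phi _ _ * _); first by ring.
by apply: eq_bigr => i _; rewrite oconsS; congr (phi _ _); ring.
Qed.

Lemma prod_le_expr k (F : 'I_k -> R) C : (forall i, 0 <= F i <= C) -> \prod_i F i <= C ^+ k.
Proof.
move=> h; apply: (@le_trans _ _ (\prod_(i < k) C)); first by apply: ler_prod => i _; exact: h.
by rewrite prodr_const card_ord.
Qed.

Lemma frac_ge0_lt1 (x : R) : 0 <= Defs.frac x < 1.
Proof.
rewrite /Defs.frac; have := floor_le x; have := floorD1_gt x.
by rewrite rmorphD /= => *; apply/andP; split; lra.
Qed.

Section bounds.
Variables (k B T : nat) (r : R) (Phi0 Phi1 : R -> R).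
Hypotheses (t0 : tame Phi0) (t1 : tame Phi1) (r0 : 0 <= r) (h0 : csupp r Phi0)
  (h1 : csupp r Phi1) (B0 : (0 < B)%N) (rT : r + B%:R + 4 <= T%:R).
Local Notation gen := (gen Phi0 Phi1).

Lemma gen_uniform (P : (R -> R) -> R -> Prop) :
  (forall F C D, C <= D -> P F C -> P F D) ->
  (exists2 C, 0 <= C & P Phi0 C) -> (exists2 C, 0 <= C & P Phi1 C) ->
  exists2 C, 0 <= C & forall m, P (gen m) C.
Proof.
move=> mono [C C0 hC] [D D0 hD]; exists (C + D); first by rewrite addr_ge0.
by case=> [|m]; [apply: mono hC|apply: mono hD]; rewrite ?lerDl ?lerDr.
Qed.

Lemma tame_gen m : tame (gen m). Proof. by case: m. Qed.
Lemma csupp_gen m : csupp r (gen m). Proof. by case: m. Qed.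

Lemma gen_fhat_layer : exists2 C, 0 <= C & forall m (x : R) (T' : nat), `|x| <= 2 ^+ T' ->
  normc (fhat (gen m) x) <= C * layer B.+1 T' `|x|.
Proof.
apply: (gen_uniform (P := fun F C => forall (x : R) (T' : nat), `|x| <= 2 ^+ T' ->
  normc (fhat F x) <= C * layer B.+1 T' `|x|)).
- by move=> F C D CD h x T' xT; rewrite (le_trans (h _ _ xT))// ler_wpM2r// layer_ge0.
- exact: fhat_layer.
- exact: fhat_layer.
Qed.

Lemma gen_expsum_layer : exists2 C, 0 <= C & forall m s (N W T' : nat) x beta (q : int),
  (0 < N)%N -> 1 <= s <= N%:R ->
  x < - (r + B.+1%:R) -> r + B.+1%:R < x + W%:R / N%:R -> `|beta - q%:~R| <= 1 / 2 ->
  N%:R <= 2 ^+ T' :> R ->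
  N%:R^-1 * normc (\sum_(n < W) (dil s (gen m) (x + n%:R / N%:R))%:C%C * ei (n%:R * beta)) <=
  C * layer B.+1 T' (N%:R * `|beta - q%:~R| / s).
Proof.
apply: (gen_uniform (P := fun F C => forall s (N W T' : nat) x beta (q : int),
  (0 < N)%N -> 1 <= s <= N%:R ->
  x < - (r + B.+1%:R) -> r + B.+1%:R < x + W%:R / N%:R -> `|beta - q%:~R| <= 1 / 2 ->
  N%:R <= 2 ^+ T' :> R ->
  N%:R^-1 * normc (\sum_(n < W) (dil s F (x + n%:R / N%:R))%:C%C * ei (n%:R * beta)) <=
  C * layer B.+1 T' (N%:R * `|beta - q%:~R| / s))).
- move=> F C D CD h s N W T' x beta q N0 sN x0 xW hq hT.
  by rewrite (le_trans (h _ _ _ _ _ _ _ N0 sN x0 xW hq hT))// ler_wpM2r// layer_ge0.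
- exact: expsum_layer.
- exact: expsum_layer.
Qed.

Lemma gen_riemann : exists2 C, 0 <= C & forall m (j N W : nat) x, (0 < N)%N -> 2 ^+ j <= N%:R :> R ->
    x < - r -> r < x + W%:R / N%:R ->
    `|N%:R^-1 * \sum_(n < W) dil (2 ^+ j) (gen m) (x + n%:R / N%:R) - \int[mu]_z gen m z| <=
      C * (2 ^+ j / N%:R) ^+ B.
Proof.
apply: (gen_uniform (P := fun F C => forall (j N W : nat) x, (0 < N)%N -> 2 ^+ j <= N%:R :> R ->
    x < - r -> r < x + W%:R / N%:R ->
    `|N%:R^-1 * \sum_(n < W) dil (2 ^+ j) F (x + n%:R / N%:R) - \int[mu]_z F z| <=
      C * (2 ^+ j / N%:R) ^+ B)).
- move=> F C D CD h j N W x N0 jN x0 xW; rewrite (le_trans (h _ _ _ _ N0 jN x0 xW))//.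
  by rewrite ler_wpM2r// exprn_ge0// divr_ge0// exprn_ge0.
- exact: riemann_dil.
- exact: riemann_dil.
Qed.

Lemma gen_bounded : exists2 C, 0 <= C & forall m, (forall x, `|gen m x| <= C) /\ `|\int[mu]_z gen m z| <= C.
Proof.
have H F : tame F -> exists2 C, 0 <= C & (forall x, `|F x| <= C) /\ `|\int[mu]_z F z| <= C.
  move=> tF; have [C C0 hC] := tame_bounded tF; exists (C + `|\int[mu]_z F z|).
    by rewrite addr_ge0.
  split=> [x|]; last by rewrite lerDr.
  by rewrite (le_trans (hC x))// lerDl.
apply: (gen_uniform (P := fun F C => (forall x, `|F x| <= C) /\ `|\int[mu]_z F z| <= C)); [|exact: H|exact: H].
by move=> F C D CD [a b]; split=> [x|]; [exact: le_trans (a x) CD|exact: le_trans b CD].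
Qed.

Lemma sum_node_dyadic N (alpha : 'rV[R]_k) (m : 'I_k.+1 -> nat) y n :
  \sum_q \prod_i dyadic Phi0 Phi1 (m i) (shifted_node N T alpha n q i - y i) =
  dil (2 ^+ (m ord0).-1) (gen (m ord0)) (- T%:R - y ord0 + n%:R / N%:R) *
  \prod_(i < k) \sum_(q < 2 * T + 1) dil (2 ^+ (m (lift ord0 i)).-1) (gen (m (lift ord0 i)))
    (Defs.frac ((n%:R - (T * N)%:R) * alpha ord0 i) - y (lift ord0 i) - (q%:R - T%:R)).
Proof.
have := sum_node_prod N T alpha (fun i => dyadic Phi0 Phi1 (m i)) y n => /= ->.
rewrite dyadicE; congr (_ * _); apply: eq_bigr => i _; apply: eq_bigr => q _.
by rewrite dyadicE.
Qed.

Lemma sum_ord_recl_leq (m : 'I_k.+1 -> nat) :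
  ((m ord0).-1 + \sum_i (m (lift ord0 i)).-1 <= \sum_i m i)%N.
Proof.
by rewrite [leqRHS]big_ord_recl leq_add ?leq_pred// leq_sum// => i _; exact: leq_pred.
Qed.

(** The first kernel is at a scale no larger than the spacing 1/N, so no cancellation is sought: the
    kernels are replaced by their suprema and the nodes in the support are counted. Only the first
    power of the ratio results. *)
Lemma kappa_large_scale : exists2 C, 0 <= C & forall N (alpha : 'rV[R]_k) (m : 'I_k.+1 -> nat) (y : 'I_k.+1 -> R),
  (0 < N)%N -> N%:R <= 2 ^+ (m ord0).-1 :> R ->
  `|kappa N T alpha (fun i => dyadic Phi0 Phi1 (m i)) y| <= C * (2 ^+ (\sum_i m i)%N / N%:R).
Proof.
have [D D0 hD] := gen_bounded.
pose E := D * (2 * r + 1) * ((2 * T + 1)%:R * D) ^+ k.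
have E0 : 0 <= E by rewrite !mulr_ge0 ?addr_ge0 ?mulr_ge0// exprn_ge0// mulr_ge0.
exists (E + D ^+ k.+1); first by rewrite addr_ge0// exprn_ge0.
move=> N alpha m y N0 Nm; set X := 2 ^+ _ / _.
have NR : 0 < N%:R :> R by rewrite ltr0n.
have p2 n : 0 < 2 ^+ n :> R by exact: exprn_gt0.
have X1 : 1 <= X.
  rewrite /X ler_pdivlMr// mul1r (le_trans Nm)// ler_weXn2l ?ler1n//.
  by rewrite (leq_trans _ (sum_ord_recl_leq m))// leq_addr.
rewrite /kappa mulrDl (le_trans (ler_normB _ _))//; apply: lerD; last first.
  rewrite normr_prod (@le_trans _ _ (D ^+ k.+1))//; last by rewrite ler_peMr// exprn_ge0.
  apply: prod_le_expr => i; rewrite normr_ge0 /= dyadicE (rintegral_dil (p2 _) (tame_gen _)); exact: (hD _).2.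
rewrite (eq_bigr _ (fun (n : 'I_(2 * T * N)) _ => sum_node_dyadic N alpha m y n)).
rewrite normrM ger0_norm ?invr_ge0// mulrC ler_pdivrMr// -mulrA divfK ?gt_eqF//.
apply: (le_trans (ler_norm_sum _ _ _)).
set j0 := (m ord0).-1; pose j (i : 'I_k) := (m (lift ord0 i)).-1.
apply: (@le_trans _ _ (\sum_(n < 2 * T * N) `|dil (2 ^+ j0) (gen (m ord0)) (- T%:R - y ord0 + n%:R / N%:R)| *
    (((2 * T + 1)%:R * D) ^+ k * 2 ^+ (\sum_i j i)%N))).
  apply: ler_sum => n _; rewrite normrM ler_wpM2l// normr_prod.
  rewrite (_ : ((2 * T + 1)%:R * D) ^+ k * _ = \prod_(i < k) ((2 * T + 1)%:R * D * 2 ^+ j i)); last first.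
    by rewrite big_split /= prodr_const card_ord expr_sum.
  apply: ler_prod => i _; rewrite normr_ge0 /=; apply: (le_trans (ler_norm_sum _ _ _)).
  apply: (@le_trans _ _ (\sum_(q < 2 * T + 1) (D * 2 ^+ j i))).
    apply: ler_sum => q _; rewrite /dil normrM gtr0_norm// mulrC.
    by apply: ler_wpM2r; [exact: ltW|exact: (hD _).1].
  by rewrite sumr_const card_ord -[_ *+ _]mulr_natl mulrA.
rewrite -mulr_suml.
have := @expsum_trivial R (2 * T * N) N (dil (2 ^+ j0) (gen (m ord0))) (r / 2 ^+ j0) (2 ^+ j0 * D)
  (- T%:R - y ord0) N0 (divr_ge0 r0 (ltW (p2 _))) (csupp_dil (p2 _) (csupp_gen _)).
move=> /(_ _)h; apply: (le_trans (ler_wpM2r _ (h _))).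
- by rewrite mulr_ge0 ?exprn_ge0 ?mulr_ge0// ltW.
- by move=> x; rewrite /dil normrM gtr0_norm//; apply: ler_wpM2l; [exact: ltW|exact: (hD _).1].
apply: (@le_trans _ _ (E * 2 ^+ (j0 + \sum_i j i)%N)); last first.
  by rewrite ler_wpM2l// ler_weXn2l ?ler1n//; exact: sum_ord_recl_leq.
rewrite exprD /E.
have e : 2 ^+ j0 * D * (2 * (r / 2 ^+ j0) * N%:R + 1) = D * (2 * r * N%:R + 2 ^+ j0).
  by field; rewrite gt_eqF.
rewrite e.
have -> : D * (2 * r + 1) * ((2 * T + 1)%:R * D) ^+ k * (2 ^+ j0 * 2 ^+ (\sum_i j i)%N) =
  D * ((2 * r + 1) * 2 ^+ j0) * (((2 * T + 1)%:R * D) ^+ k * 2 ^+ (\sum_i j i)%N) by ring.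
apply: ler_wpM2r; first by rewrite mulr_ge0 ?exprn_ge0 ?mulr_ge0// ltW.
apply: ler_wpM2l => //; rewrite [leRHS]mulrDl mul1r; apply: lerD => //.
by apply: ler_wpM2l => //; rewrite mulr_ge0.
Qed.

(** Two errors add up: the nonzero frequencies of the last k coordinates, measured against [Y], and
    the error of the Riemann sum in the first coordinate, measured against [N] and multiplied by the
    integrals of the other kernels. *)
Lemma kappa_small_scale : exists2 C, 0 <= C & forall N (alpha : 'rV[R]_k) (Y : R) (m : 'I_k.+1 -> nat) (y : 'I_k.+1 -> R),
  (0 < N)%N -> 0 < Y -> resonance_free N alpha Y ->
  (forall i, -1 <= y i <= 2) -> 2 ^+ (m ord0).-1 <= N%:R :> R ->
  `|kappa N T alpha (fun i => dyadic Phi0 Phi1 (m i)) y| <=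
    C * ((2 ^+ (\sum_i m i)%N / Y) ^+ B + (2 ^+ (\sum_i m i)%N / N%:R) ^+ B).
Proof.
have [D D0 hD] := gen_bounded.
have [C1 C10 hC1] := gen_fhat_layer.
have [C2 C20 hC2] := gen_expsum_layer.
have [C3 C30 hC3] := gen_riemann.
pose K := C2 * C1 ^+ k * (2 * 8 ^+ k.+1).
have K0 : 0 <= K by rewrite !mulr_ge0// exprn_ge0.
exists (K + D ^+ k * C3); first by rewrite addr_ge0// mulr_ge0// exprn_ge0.
move=> N alpha Y m y N0 Y0 res hy Nm.
have NR : 0 < N%:R :> R by rewrite ltr0n.
have p2 n : 0 < 2 ^+ n :> R by exact: exprn_gt0.
set j0 := (m ord0).-1 in Nm *; pose j (i : 'I_k) := (m (lift ord0 i)).-1.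
pose f (i : 'I_k) := gen (m (lift ord0 i)).
pose x0 : R := - T%:R - y ord0.
have B1 : B.+1%:R = B%:R + 1 :> R by rewrite natr1.
have /andP[y1 y2] := hy ord0.
have b0 : 0 <= B%:R :> R by [].
(* The coordinates of [y] lie in [[-1, 2]] and the differences have order [B.+1]; the 4 in [rT]
   leaves room for both. *)
have x0r : x0 < - (r + B.+1%:R).
  rewrite /x0 B1; clear - rT y1 b0; move: rT y1 b0; move: (y ord0) (T%:R : R) (B%:R : R) => a b c *; lra.
have x0W : r + B.+1%:R < x0 + (2 * T * N)%:R / N%:R.
  have -> : (2 * T * N)%:R / N%:R = 2 * T%:R :> R by rewrite !natrM; field; rewrite gt_eqF.
  rewrite /x0 B1; clear - rT y2 b0; move: rT y2 b0; move: (y ord0) (T%:R : R) (B%:R : R) => a b c *; lra.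
set G := gen (m ord0).
pose Z := N%:R^-1 * \sum_(n < 2 * T * N) dil (2 ^+ j0) G (x0 + n%:R / N%:R).
have hZ : `|Z - \int[mu]_z G z| <= C3 * (2 ^+ j0 / N%:R) ^+ B.
  apply: hC3 => //; first by apply: (lt_le_trans x0r); rewrite lerN2 lerDl.
  by apply: le_lt_trans x0W; rewrite lerDl.
pose A := \prod_i \int[mu]_z f i z.
have hA : `|A| <= D ^+ k.
  rewrite /A normr_prod; apply: prod_le_expr => i.
  by rewrite normr_ge0 /=; exact: (hD _).2.
pose S := N%:R^-1 * (\sum_(n < 2 * T * N) \sum_q \prod_i
  dyadic Phi0 Phi1 (m i) (shifted_node N T alpha n q i - y i)).
have s1 : 1 <= 2 ^+ j0 :> R by rewrite exprn_ege1// ler1n.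
have hS : `|S - A * Z| <= K * (2 ^+ (j0 + \sum_i j i)%N / Y) ^+ B.
  pose xi (i : 'I_k) (n : nat) : R := Defs.frac ((n%:R - (T * N)%:R) * alpha ord0 i) - y (lift ord0 i).
  pose u M := N%:R^-1 * \sum_(n < 2 * T * N) dil (2 ^+ j0) G (x0 + n%:R / N%:R) *
    \prod_i \int[mu]_z (dil (2 ^+ j i) (f i) z * fejer M (xi i n - z)).
  have lim : u @ \oo --> S.
    rewrite /S (eq_bigr _ (fun (n : 'I_(2 * T * N)) _ => sum_node_dyadic N alpha m y n)).
    apply: cvgMr; apply: cvg_bigsum => n; apply: cvgMr; apply: cvg_bigprod => i.
    apply: (@fejer_cvg R T (r / 2 ^+ j i)).
    - exact: tame_dil (tame_gen _).
    - exact: csupp_dil (csupp_gen _).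
    have /andP[f0 f1] := frac_ge0_lt1 ((n%:R - (T * N)%:R) * alpha ord0 i).
    have /andP[z1 z2] := hy (lift ord0 i).
    have hx : `|xi i n| <= 2 by rewrite /xi ler_norml; apply/andP; split; lra.
    have hr : r / 2 ^+ j i <= r by rewrite ler_pdivrMr// ler_peMr// exprn_ege1// ler1n.
    apply: (le_trans (lerD hx hr)); move: rT b0; move: (T%:R : R) (B%:R : R) => a b *; lra.
  apply: (cvg_dist_le lim) => M M0.
  apply: (twisted_mean_bound (r := r)) => //.
  - by move=> i; exact: tame_gen.
  - by move=> i; exact: csupp_gen.
  - by move=> i x T'; exact: hC1.
  - by move=> T' beta q hq hT; apply: hC2 => //; rewrite s1.
have X0 n : 0 <= 2 ^+ n / Y by rewrite divr_ge0// ltW.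
have XN n : 0 <= 2 ^+ n / N%:R :> R by rewrite divr_ge0// ltW.
have -> : kappa N T alpha (fun i => dyadic Phi0 Phi1 (m i)) y = (S - A * Z) + A * (Z - \int[mu]_z G z).
  rewrite /kappa -/S big_ord_recl dyadicE (rintegral_dil (p2 _) (tame_gen _)) -/G.
  have -> : \prod_(i < k) \int[mu]_z dyadic Phi0 Phi1 (m (lift ord0 i)) z = A.
    by apply: eq_bigr => i _; rewrite dyadicE (rintegral_dil (p2 _) (tame_gen _)).
  by ring.
apply: (le_trans (ler_normD _ _)); rewrite normrM.
apply: (@le_trans _ _ (K * (2 ^+ (\sum_i m i)%N / Y) ^+ B + D ^+ k * (C3 * (2 ^+ (\sum_i m i)%N / N%:R) ^+ B))).
  apply: lerD.
    apply: (le_trans hS); rewrite ler_wpM2l// lerXn2r ?nnegrE// ler_pM2r ?invr_gt0//.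
    by rewrite ler_weXn2l ?ler1n//; exact: sum_ord_recl_leq.
  apply: ler_pM => //; apply: (le_trans hZ); rewrite ler_wpM2l// lerXn2r ?nnegrE//.
  rewrite ler_pM2r ?invr_gt0// ler_weXn2l ?ler1n//.
  by rewrite (leq_trans _ (sum_ord_recl_leq m))// leq_addr.
rewrite mulrA mulrDr !mulrDl -!addrA lerD2l.
rewrite addrCA addrA [leRHS]addrC lerDl addr_ge0// !mulr_ge0 ?exprn_ge0//.
Qed.

(** When the first scale exceeds [N], the ratio to [Y <= N] is at least 1, so the first power from
    [kappa_large_scale] is below the [B]-th. *)
Lemma kappa_bound : exists2 C, 0 <= C & forall N (alpha : 'rV[R]_k) (Y : R) (m : 'I_k.+1 -> nat)
    (y : 'I_k.+1 -> R),
  (0 < N)%N -> 0 < Y <= N%:R -> resonance_free N alpha Y -> (forall i, -1 <= y i <= 2) ->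
  `|kappa N T alpha (fun i => dyadic Phi0 Phi1 (m i)) y| <= C * (2 ^+ (\sum_i m i)%N / Y) ^+ B.
Proof.
have [C C0 hC] := kappa_large_scale; have [D D0 hD] := kappa_small_scale.
exists (C + 2 * D); first by rewrite addr_ge0// mulr_ge0.
move=> N alpha Y m y N0 /andP[Y0 YN] res hy.
have NR : 0 < N%:R :> R by rewrite ltr0n.
set X := 2 ^+ (\sum_i m i)%N.
have X0 : 0 < X by rewrite exprn_gt0.
have XY : X / N%:R <= X / Y by rewrite ler_pM2l// lef_pV2 ?posrE.
have XY0 : 0 <= X / Y by rewrite divr_ge0// ltW.
have XN0 : 0 <= X / N%:R by rewrite divr_ge0// ltW.
have XB0 : 0 <= (X / Y) ^+ B by exact: exprn_ge0.
have [small|large] := leP (2 ^+ (m ord0).-1) (N%:R : R).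
  apply: (le_trans (hD _ _ _ _ _ N0 Y0 res hy small)); rewrite -/X.
  have h : (X / N%:R) ^+ B <= (X / Y) ^+ B by rewrite lerXn2r ?nnegrE.
  rewrite (_ : (C + 2 * D) * _ = C * (X / Y) ^+ B + D * ((X / Y) ^+ B + (X / Y) ^+ B)); last by ring.
  apply: (@le_trans _ _ (D * ((X / Y) ^+ B + (X / Y) ^+ B))).
    by apply: ler_wpM2l => //; rewrite lerD2l.
  by rewrite lerDr; exact: mulr_ge0.
apply: (le_trans (hC _ _ _ _ N0 (ltW large))); rewrite -/X.
have X1 : 1 <= X / Y.
  rewrite ler_pdivlMr// mul1r (le_trans YN)// (le_trans (ltW large))// ler_weXn2l ?ler1n//.
  by rewrite (leq_trans _ (sum_ord_recl_leq m))// leq_addr.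
have X2 : X / Y <= (X / Y) ^+ B by case: B B0 => // b _; rewrite exprS ler_peMr// exprn_ege1.
rewrite mulrDl (@le_trans _ _ (C * (X / Y) ^+ B))//; last by rewrite lerDl !mulr_ge0.
by apply: ler_wpM2l => //; exact: le_trans X2.
Qed.

End bounds.

(** An entry of [h] larger than [N] already forces the volume above [Y], because the condition on
    [c] makes [Y <= N]. Otherwise monotonicity replaces every value of [psi] in the weight by
    [psi N], which produces the power [psi N ^+ k]. *)
Lemma resonance_free_of_diophantine k (psi : nat -> R) (alpha : 'rV[R]_k) (c : R) (N : nat) :
  (forall n, (1 <= n)%N -> 0 < psi n) ->
  (forall m n, (1 <= m)%N -> (m <= n)%N -> psi m <= psi n) ->
  0 < c <= psi 1%N ^+ k -> (0 < N)%N ->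
  (forall h : 'I_k -> int, (exists i, h i != 0) -> forall q : int,
    c * res_weight psi h <= `|dot h alpha - q%:~R|) ->
  0 < c * N%:R / psi N ^+ k <= N%:R /\ resonance_free N alpha (c * N%:R / psi N ^+ k).
Proof.
move=> psi0 psim /andP[c0 c1] N0 dioph.
have NR : 0 < N%:R :> R by rewrite ltr0n.
have pN : 0 < psi N ^+ k by rewrite exprn_gt0// psi0.
have YN : c * N%:R / psi N ^+ k <= N%:R.
  rewrite ler_pdivrMr// mulrC ler_wpM2l// (le_trans c1)// lerXn2r ?nnegrE ?(ltW (psi0 _ _))//.
  exact: psim.
split; first by rewrite YN andbT divr_gt0// mulr_gt0.
move=> h hn0 q l hl hq.
have p2 n : 0 < 2 ^+ n :> R by exact: exprn_gt0.
have hb i : (hbar (h i))%:R <= 2 ^+ l (lift ord0 i) :> R.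
  rewrite /hbar natr_max ge_max exprn_ege1 ?ler1n//=.
  by have := hl i; rewrite -intr_norm -abszE.
have [big|small] := pselect (exists i, (N < hbar (h i))%N).
  have [i hi] := big; apply: (le_trans YN).
  rewrite (@le_trans _ _ (hbar (h i))%:R) ?ler_nat ?(ltnW hi)//.
  by rewrite (le_trans (hb i))// ler_weXn2l ?ler1n// (bigD1 (lift ord0 i)) //= leq_addr.
have {}small i : (hbar (h i) <= N)%N by rewrite leqNgt; apply/negP => hi; apply: small; exists i.
have w : (2 ^+ (\sum_i l (lift ord0 i))%N * psi N ^+ k)^-1 <= res_weight psi h.
  rewrite /res_weight prodfV lef_pV2 ?posrE ?mulr_gt0//; last first.
    by apply: prodr_gt0 => i _; rewrite mulr_gt0 ?psi0 ?ltr0n ?hbar_ge1.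
  rewrite (_ : 2 ^+ _ * _ = \prod_i (2 ^+ l (lift ord0 i) * psi N)); last first.
    by rewrite expr_sum big_split /= prodr_const card_ord.
  apply: ler_prod => i _; rewrite mulr_ge0 ?(ltW (psi0 _ _)) ?hbar_ge1//=.
  by rewrite ler_pM ?(ltW (psi0 _ _)) ?hbar_ge1// psim ?hbar_ge1.
have := dioph h hn0 q; move/(le_trans (ler_wpM2l (ltW c0) w)).
move/(ler_wpM2l (ltW NR)) => /le_trans/(_ hq).
rewrite invfM big_ord_recl exprD => hfin.
rewrite ler_pdivrMr//; have := ler_wpM2r (ltW (p2 (\sum_i l (lift ord0 i))%N)) hfin.
move/(ler_wpM2r (ltW pN)).
have -> : N%:R * (c * ((2 ^+ (\sum_i l (lift ord0 i))%N)^-1 / psi N ^+ k)) *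
   2 ^+ (\sum_i l (lift ord0 i))%N * psi N ^+ k = c * N%:R.
  by field; rewrite !gt_eqF.
by [].
Qed.
End kappa.

Arguments shifted_node {R k} N T alpha n q.

(** * The error as a sum over dyadic blocks *)

Section block_identities.
Context {R : realType} {d : nat}.
Local Notation mu := (@lebesgue_measure R).
Local Notation nu := (lebesgue_rV R d).
Implicit Types (P F : 'I_d -> R -> R) (u : 'rV[R]_d -> R) (lam : 'I_d -> R).

Definition tensB P (y z : 'rV[R]_d) : R := \prod_i P i (y ord0 i - z ord0 i).

(** For the local means as [P] and a real or imaginary part as [u], this is the corresponding part
    of the convolution in the Besov norm ([block_dconvolution]). *)
Definition block u P (y : 'rV[R]_d) : R := \int[nu]_z (u z * tensB P y z).

Lemma measurable_tensB P : (forall i, tame (P i)) ->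
  measurable_fun setT (fun w : 'rV[R]_d * 'rV[R]_d => tensB P w.1 w.2).
Proof.
move=> tP; apply: measurable_prod => i _.
have m1 : measurable_fun setT (fun w : 'rV[R]_d * 'rV[R]_d => w.1 ord0 i : R).
  exact: (measurableT_comp (measurable_rV_coord i) measurable_fst).
have m2 : measurable_fun setT (fun w : 'rV[R]_d * 'rV[R]_d => w.2 ord0 i : R).
  exact: (measurableT_comp (measurable_rV_coord i) measurable_snd).
exact: (measurableT_comp (tame_measurable (tP i)) (measurable_funB m1 m2)).
Qed.

Lemma tensB_bounded P : (forall i, tame (P i)) -> exists2 C, 0 <= C & forall y z, `|tensB P y z| <= C.
Proof.
move=> tP; have /choice[C hC] : forall i, exists C, 0 <= C /\ forall x, `|P i x| <= C.
  by move=> i; have [C C0 h] := tame_bounded (tP i); exists C.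
exists (\prod_i C i); first by apply: prodr_ge0 => i _; exact: (hC i).1.
move=> y z; rewrite /tensB normr_prod; apply: ler_prod => i _.
by rewrite normr_ge0; exact: (hC i).2.
Qed.

Lemma reflect_tame_integrable F lam i : tame (F i) ->
  rintegrable mu (fun t => F i (lam i - t)).
Proof.
move=> tF; have t := tame_translate_neg (lam i) tF.
exact: tame_integrable.
Qed.

Lemma tens_reflect_integral F lam : (forall i, tame (F i)) ->
  rintegrable nu (tens (fun i t => F i (lam i - t))) /\
  \int[nu]_y tens (fun i t => F i (lam i - t)) y = \prod_i \int[mu]_t F i t.
Proof.
move=> tF; have [h1 h2] := tens_integral (fun i => reflect_tame_integrable lam (tF i)).
split=> //; rewrite h2; apply: eq_bigr => i _.
have [r _ hr] := tame_csupp (tF i).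
by rewrite (cc_reflect (lam i) (tame_continuous (tF i)) hr).
Qed.

Lemma conv_reflect (f g : R -> R) l t : tame f -> tame g ->
  \int[mu]_y (f (l - y) * g (y - t)) = conv f g (l - t).
Proof.
move=> tf tg; rewrite convE.
have [c [r _ h]] := tame_mul_cc tf (tame_translate_neg (l - t) tg).
rewrite -(cc_reflect l c h); apply: eq_rintegral => y.
by have -> : l - t - (l - y) = y - t by ring.
Qed.

Definition boxf (a b : R) : 'rV[R]_d -> R := tens (fun _ => \1_(`[a, b]%classic : set (measurableTypeR R))).

Lemma boxf_integral a b : a <= b -> rintegrable nu (boxf a b) /\ \int[nu]_y boxf a b y = (b - a) ^+ d.
Proof.
move=> ab; have h (i : 'I_d) : rintegrable mu (\1_(`[a, b]%classic : set (measurableTypeR R))).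
  exact: integrable_indic_itv.
have [h1 h2] := tens_integral h; split=> //; rewrite h2 prodr_const card_ord; congr (_ ^+ _).
have mI : measurable (`[a, b]%classic : set (measurableTypeR R)) by exact: measurable_itv.
have e : (mu (`[a, b]%classic : set (measurableTypeR R)) = (b - a)%:E)%E.
  rewrite lebesgue_measure_itv /= lte_fin; case: ltP => // ba.
  by rewrite (le_anti (_ : a <= b <= a)) ?ab// subrr.
rewrite /Rintegral -[RHS]/(fine (b - a)%:E) -e; congr fine.
by rewrite (integral_indic mu measurableT mI) setIT.
Qed.

Lemma boxf_ge0 a b y : 0 <= boxf a b y.
Proof. by apply: prodr_ge0 => i _; rewrite indicE. Qed.

Lemma boxf_le1 a b y : boxf a b y <= 1.
Proof.
by rewrite -[leRHS](expr1n _ d); apply: prod_le_expr => i; rewrite indicE; case: (_ \in _); rewrite ?lexx ler01.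
Qed.

Lemma boxf1 a b (y : 'rV[R]_d) : (forall i, a <= y ord0 i <= b) -> boxf a b y = 1.
Proof.
move=> h; rewrite /boxf /tens big1// => i _; rewrite indicE mem_set//=.
by rewrite in_itv /=; exact: h.
Qed.

Lemma boxf0 a b (y : 'rV[R]_d) i : ~~ (a <= y ord0 i <= b) -> boxf a b y = 0.
Proof.
move=> h; rewrite /boxf /tens (bigD1 i)//= indicE memNset ?mul0r//=.
by rewrite in_itv /=; exact/negP.
Qed.

Section kernels.
Variables (u : 'rV[R]_d -> R) (P F : 'I_d -> R -> R) (lam : 'I_d -> R).
Hypotheses (iu : rintegrable nu u) (tP : forall i, tame (P i)) (tF : forall i, tame (F i)).

Let measurable_kernel : measurable_fun setT (fun w : 'rV[R]_d * 'rV[R]_d => u w.2 * tensB P w.1 w.2).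
Proof.
apply: measurable_funM; last exact: measurable_tensB.
exact: (measurableT_comp (rintegrable_measurable iu) measurable_snd).
Qed.

Lemma rintegrable_mul_tensB y : rintegrable nu (fun z => u z * tensB P y z).
Proof.
have [C C0 hC] := tensB_bounded tP.
apply: (@rintegrable_le _ _ _ _ _ (fun z => C * `|u z|)).
- exact: (measurableT_comp measurable_kernel (pair1_measurable y)).
- by apply: rintegrableZ; exact: rintegrable_norm.
- by move=> z; rewrite normrM mulrC ler_wpM2r.
Qed.

(** By Fubini, integrating first in [y] combines each dual kernel with its local mean into a
    one-dimensional convolution at [lam i - z ord0 i]. *)
Lemma block_conv :
  rintegrable nu (fun y => block u P y * tens (fun i t => F i (lam i - t)) y) /\
  \int[nu]_y (block u P y * tens (fun i t => F i (lam i - t)) y) =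
  \int[nu]_z (u z * \prod_i conv (F i) (P i) (lam i - z ord0 i)).
Proof.
have [C C0 hC] := tensB_bounded tP.
have [iF _] := tens_reflect_integral lam tF.
pose f (y z : 'rV[R]_d) := u z * tensB P y z * tens (fun i t => F i (lam i - t)) y.
have mf : measurable_fun setT (fun w : 'rV[R]_d * 'rV[R]_d => f w.1 w.2).
  apply: measurable_funM => //.
  exact: (measurableT_comp (rintegrable_measurable iF) measurable_fst).
have ia : rintegrable nu (fun y => C * `|tens (fun i t => F i (lam i - t)) y|).
  by apply: rintegrableZ; exact: rintegrable_norm.
have ib := rintegrable_norm iu.
have fab y z : `|f y z| <= C * `|tens (fun i t => F i (lam i - t)) y| * `|u z|.
  rewrite /f !normrM [leRHS]mulrAC [C * _]mulrC.
  by apply: ler_wpM2r => //; apply: ler_wpM2l.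
have fE y : \int[nu]_z f y z = block u P y * tens (fun i t => F i (lam i - t)) y.
  by rewrite /f rintegralZr//; exact: rintegrable_mul_tensB.
split.
  have := rintegrable_F mf ia ib fab.
  by apply: eq_integrable => // y _; rewrite /= fE.
rewrite -(eq_rintegral _ fE) (rfubini mf ia ib fab).
apply: eq_rintegral => z.
transitivity (\int[nu]_y (u z * tens (fun i t => F i (lam i - t) * P i (t - z ord0 i)) y)).
  apply: eq_rintegral => y; rewrite /f /tens /tensB -mulrA; congr (_ * _).
  by rewrite -big_split /=; apply: eq_bigr => i _; rewrite mulrC.
have iFP i : rintegrable mu (fun t => F i (lam i - t) * P i (t - z ord0 i)).
  have tFi := tame_translate_neg (lam i) (tF i).
  have tPi : tame (fun t => P i (t - z ord0 i)).
    have := tame_affine (- z ord0 i) (oner_neq0 R) (tP i).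
    by under eq_fun do rewrite mul1r.
  have [c [r _ h]] := tame_mul_cc tFi tPi.
  exact: cc_integrable c h.
have [i1 e1] := tens_integral iFP.
rewrite rintegralZ// e1; congr (_ * _); apply: eq_bigr => i _.
exact: conv_reflect.
Qed.

Lemma block_integral r : 0 <= r -> (forall i, csupp r (P i)) -> 
  (forall z, u z != 0 -> forall i, 0 <= z ord0 i <= 1) ->
  [/\ rintegrable nu (block u P),
   \int[nu]_y block u P y = (\int[nu]_z u z) * \prod_i \int[mu]_t P i t &
   forall y, block u P y != 0 -> forall i, - r <= y ord0 i <= 1 + r].
Proof.
move=> r0 hP u0; have [C C0 hC] := tensB_bounded tP.
have supp (y z : 'rV[R]_d) : (exists i, ~~ (- r <= y ord0 i <= 1 + r)) -> u z * tensB P y z = 0.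
  move=> [i hi]; have [->|uz] := eqVneq (u z) 0; first by rewrite mul0r.
  have /andP[z0 z1] := u0 z uz i.
  rewrite /tensB (bigD1 i) //= hP ?mul0r ?mulr0//.
  by move: hi; rewrite negb_and -!ltNge ltr_normr => /orP[] h; apply/orP; [right|left]; lra.
pose Q := boxf (- r) (1 + r).
have iQ : rintegrable nu Q by have [] := @boxf_integral (- r) (1 + r); last by []; lra.
have ia : rintegrable nu (fun y => C * Q y) by exact: rintegrableZ.
have ib := rintegrable_norm iu.
have fab y z : `|u z * tensB P y z| <= C * Q y * `|u z|.
  have [h|h] := pselect (exists i, ~~ (- r <= y ord0 i <= 1 + r)).
    by rewrite supp// normr0 !mulr_ge0// boxf_ge0.
  rewrite /Q boxf1 ?mulr1; last first.
    by move=> i; apply/negPn/negP => hi; apply: h; exists i.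
  by rewrite normrM mulrC ler_wpM2r.
split.
- exact: (rintegrable_F measurable_kernel ia ib fab).
- rewrite /block (rfubini measurable_kernel ia ib fab) -rintegralZr//.
  apply: eq_rintegral => z.
  have tPi i : tame (fun t => P i (t - z ord0 i)).
    have := tame_affine (- z ord0 i) (oner_neq0 R) (tP i).
    by under eq_fun do rewrite mul1r.
  have [i1 e1] := tens_integral (fun i => tame_integrable (tPi i)).
  rewrite -[X in X = _]/(\int[nu]_y (u z * tens (fun i t => P i (t - z ord0 i)) y)) rintegralZ// e1.
  congr (_ * _); apply: eq_bigr => i _.
  exact: (cc_shift _ (tame_continuous (tP i)) (hP i)).
- move=> y; apply: contraNP => /existsNP[i /negP hi].
  by apply/eqP; rewrite /block -(rintegral0 nu); apply: eq_rintegral => z; apply: supp; exists i.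
Qed.

End kernels.
End block_identities.

(** * The reproducing identity in several variables *)

Section reproducing_identity.
Context {R : realType}.
Local Notation mu := (@lebesgue_measure R).
Local Notation nu := (lebesgue_rV R).
Variables (k : nat) (u : 'rV[R]_k.+1 -> R) (Phi0 Phi1 Psi0 Psi1 chi : R -> R) (r : R) (J : nat).
Hypotheses (iu : rintegrable (nu k.+1) u)
  (u0 : forall z : 'rV[R]_k.+1, u z != 0 -> forall i, 0 <= z ord0 i <= 1)
  (tF0 : tame Phi0) (tF1 : tame Phi1) (tP0 : tame Psi0) (tP1 : tame Psi1) (tchi : tame chi)
  (r0 : 0 <= r) (hP0 : csupp r Psi0) (hP1 : csupp r Psi1)
  (chi1 : \int[mu]_x chi x = 1) (e0 : conv Phi0 Psi0 = chi)
  (e1 : conv Phi1 Psi1 = (fun x => dil 2 chi x - chi x)).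
Local Notation I := {ffun 'I_k.+1 -> 'I_J.+1}.
Let P (m : I) (i : 'I_k.+1) := dyadic Psi0 Psi1 (m i).
Let F (m : I) (i : 'I_k.+1) := dyadic Phi0 Phi1 (m i).

Let tP m i : tame (P m i). Proof. exact: tame_dyadic. Qed.
Let tF m i : tame (F m i). Proof. exact: tame_dyadic. Qed.
Let tchiJ : tame (dil (2 ^+ J) chi). Proof. exact: tame_dil. Qed.
Let J0 : 0 < 2 ^+ J :> R. Proof. exact: exprn_gt0. Qed.

Let hP m i : csupp r (P m i).
Proof.
rewrite /P; case: (val (m i)) => [|j] //=.
apply: csuppW (csupp_dil _ hP1); last exact: exprn_gt0.
by rewrite ler_pdivrMr ?exprn_gt0// ler_peMr// exprn_ege1// ler1n.
Qed.

(** The sum over all [m] of a product is a product of one-dimensional sums, and each of these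
    telescopes to a dilate of [chi]. *)
Lemma sum_block_conv lam :
  \sum_(m : I) \int[nu k.+1]_y (block u (P m) y * tens (fun i t => F m i (lam i - t)) y) =
  \int[nu k.+1]_z (u z * \prod_i dil (2 ^+ J) chi (lam i - z ord0 i)).
Proof.
under eq_bigr do rewrite (block_conv lam iu (tP _) (tF _)).2.
have iz (m : I) : rintegrable (nu k.+1) (fun z => u z * \prod_i conv (F m i) (P m i) (lam i - z ord0 i)).
  have tC i : tame (fun t => conv (F m i) (P m i) t) by exact: tame_conv.
  have := @rintegrable_mul_tensB R k.+1 u (fun i t => conv (F m i) (P m i) t) iu tC (\row_i lam i).
  by apply: eq_integrable => // z _; rewrite /= /tensB; congr (_ * _)%:E; apply: eq_bigr => i _; rewrite mxE.
rewrite -(rintegral_sum _ (fun m _ => iz m)); apply: eq_rintegral => z.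
rewrite -mulr_sumr; congr (_ * _).
rewrite -(bigA_distr_bigA (fun i (j : 'I_J.+1) =>
  conv (dyadic Phi0 Phi1 j) (dyadic Psi0 Psi1 j) (lam i - z ord0 i))).
apply: eq_bigr => i _; have := sum_conv_dyadic J tF0 tF1 tP0 tP1 e0 e1.
by move/(congr1 (@^~ (lam i - z ord0 i))).
Qed.

Lemma sum_block_integral :
  \sum_(m : I) (\int[nu k.+1]_y block u (P m) y) * \prod_i (\int[mu]_t F m i t) = \int[nu k.+1]_z u z.
Proof.
have h m := block_integral iu (tP m) r0 (hP m) u0.
transitivity (\sum_(m : I) (\int[nu k.+1]_z u z) * \prod_i (\int[mu]_t F m i t * \int[mu]_t P m i t)).
  apply: eq_bigr => m _; have [_ -> _] := h m.
  by rewrite -mulrA -big_split /=; congr (_ * _); apply: eq_bigr => i _; rewrite mulrC.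
rewrite -mulr_sumr -[RHS]mulr1; congr (_ * _).
rewrite -(bigA_distr_bigA (fun (_ : 'I_k.+1) (j : 'I_J.+1) =>
  \int[mu]_t dyadic Phi0 Phi1 j t * \int[mu]_t dyadic Psi0 Psi1 j t)).
rewrite big1// => _ _.
have tD j := tame_dyadic j tF0 tF1; have tD' j := tame_dyadic j tP0 tP1.
under eq_bigr do rewrite -(rintegral_conv (tD _) (tD' _)).
rewrite -rintegral_sum; last by move=> j _; exact: tame_integrable (tame_conv _ _).
rewrite (_ : (fun x => _) = dil (2 ^+ J) chi); last exact: sum_conv_dyadic.
by rewrite (rintegral_dil J0 tchi).
Qed.

Lemma sum_block_kappa N T (alpha : 'rV[R]_k) :
  \sum_(m : I) \int[nu k.+1]_y (block u (P m) y * kappa N T alpha (F m) (fun i => y ord0 i)) =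
  N%:R^-1 * (\sum_(n < 2 * T * N) \sum_q
    \int[nu k.+1]_z (u z * \prod_i dil (2 ^+ J) chi (shifted_node N T alpha n q i - z ord0 i))) -
  \int[nu k.+1]_z u z.
Proof.
rewrite -sum_block_integral.
have ib m : rintegrable (nu k.+1) (block u (P m)) by have [] := block_integral iu (tP m) r0 (hP m) u0.
have ic m lam := (block_conv lam iu (tP m) (tF m)).1.
transitivity (\sum_(m : I) (N%:R^-1 * (\sum_(n < 2 * T * N) \sum_q
    \int[nu k.+1]_y (block u (P m) y * tens (fun i t => F m i (shifted_node N T alpha n q i - t)) y)) -
    (\int[nu k.+1]_y block u (P m) y) * \prod_i (\int[mu]_t F m i t))).
  apply: eq_bigr => m _.
  rewrite -rintegralZr; last exact: ib.
  pose f n q y := block u (P m) y * tens (fun i t => F m i (shifted_node N T alpha n q i - t)) y.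
  have if1 n q : rintegrable (nu k.+1) (f n q) by exact: ic.
  have if2 n : rintegrable (nu k.+1) (fun y => \sum_q f n q y) by apply: rintegrable_sum => q _; exact: if1.
  have if3 : rintegrable (nu k.+1) (fun y => \sum_(n < 2 * T * N) \sum_q f n q y).
    by apply: rintegrable_sum => n _; exact: if2.
  have -> : \sum_(n < 2 * T * N) \sum_q \int[nu k.+1]_y f n q y =
      \int[nu k.+1]_y \sum_(n < 2 * T * N) \sum_q f n q y.
    rewrite rintegral_sum; last by move=> n _; exact: if2.
    by apply: eq_bigr => n _; rewrite rintegral_sum// => q _; exact: if1.
  rewrite -(rintegralZ _ if3).
  rewrite -rintegralB.
  - apply: eq_rintegral => y; rewrite /kappa mulrBr mulrCA mulr_sumr.
    by congr (_ * _ - _); apply: eq_bigr => n _; rewrite mulr_sumr.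
  - exact: rintegrableZ.
  - by have := rintegrableZ (\prod_i \int[mu]_t F m i t) (ib m); under eq_fun do rewrite mulrC.
rewrite sumrB -mulr_sumr; congr (_ * _ - _).
rewrite exchange_big /=; apply: eq_bigr => n _; rewrite exchange_big /=; apply: eq_bigr => q _.
exact: sum_block_conv.
Qed.

End reproducing_identity.

(** * Approximate identities *)

Section approximate_identity.
Context {R : realType}.
Local Notation mu := (@lebesgue_measure R).
Local Notation nu := (lebesgue_rV R).

(** The kernel [chi] may change sign, which is why its L_1 norm, to the power [d], multiplies the
    modulus of continuity. *)
Lemma approximate_identity d (u : 'rV[R]_d -> R) (chi : R -> R) r (x : 'rV[R]_d) e :
  continuous u -> tame chi -> 0 <= r -> csupp r chi -> \int[mu]_t chi t = 1 -> 0 < e ->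
  exists2 s0, 0 < s0 & forall s, s0 <= s ->
    `|\int[nu d]_z (u z * \prod_i dil s chi (x ord0 i - z ord0 i)) - u x| <=
      e * (\int[mu]_t `|chi t|) ^+ d.
Proof.
move=> cu tchi r0 hchi chi1 e0.
have [del del0 hdel] := continuous_rV_delta x cu e0.
exists ((r + 1) / del); first by rewrite divr_gt0// ltr_wpDl.
move=> s hs; have s0 : 0 < s by rewrite (lt_le_trans _ hs)// divr_gt0// ltr_wpDl.
have rs : r / s < del.
  by rewrite ltr_pdivrMr// mulrC -ltr_pdivrMr//; apply: lt_le_trans hs; rewrite ltr_pM2r ?invr_gt0// ltrDl.
have tD : tame (dil s chi) by exact: tame_dil.
have hD := csupp_dil s0 hchi.
pose D (z : 'rV[R]_d) := \prod_i dil s chi (x ord0 i - z ord0 i).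
have [iD eD] : rintegrable (nu d) D /\ \int[nu d]_z D z = 1.
  have [h1 h2] := @tens_reflect_integral R d (fun _ => dil s chi) (fun i => x ord0 i) (fun _ => tD).
  split; first exact: h1.
  by rewrite [LHS]h2 big1// => i _; rewrite (rintegral_dil s0 tchi).
have nD : \int[nu d]_z `|D z| = (\int[mu]_t `|chi t|) ^+ d.
  have i1 (i : 'I_d) : rintegrable mu (fun t => `|dil s chi (x ord0 i - t)|).
    by apply: rintegrable_norm; exact: tame_integrable (tame_translate_neg _ tD).
  have [_ h] := tens_integral i1.
  transitivity (\int[nu d]_z tens (fun i t => `|dil s chi (x ord0 i - t)|) z).
    by apply: eq_rintegral => z; rewrite /D /tens normr_prod.
  rewrite h -[d in RHS]card_ord -prodr_const; apply: eq_bigr => i _.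
  have cN : continuous (fun t => `|dil s chi t|) by exact: continuous_normf (tame_continuous tD).
  have hN : csupp (r / s) (fun t => `|dil s chi t|) by move=> t /hD ->; rewrite normr0.
  by rewrite (cc_reflect (x ord0 i) cN hN) (rintegral_norm_dil s0 tchi).
have key z : `|(u z - u x) * D z| <= e * `|D z|.
  have [[i hi]|near] := pselect (exists i, r / s < `|x ord0 i - z ord0 i|).
    by rewrite /D (bigD1 i) //= hD// mul0r mulr0 normr0 mulr_ge0// ltW.
  rewrite normrM ler_wpM2r// distrC ltW//; apply: hdel => i.
  by rewrite (le_lt_trans _ rs)// leNgt; apply/negP => hi; apply: near; exists i.
have mB : measurable_fun setT (fun z : 'rV[R]_d => (u z - u x) * D z).
  apply: measurable_funM; last exact: rintegrable_measurable iD.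
  by apply: measurable_funB => //; exact: continuous_rV_measurable.
have ie : rintegrable (nu d) (fun z => e * `|D z|) by apply: rintegrableZ; exact: rintegrable_norm.
have iB : rintegrable (nu d) (fun z => (u z - u x) * D z) := rintegrable_le mB ie key.
have -> : \int[nu d]_z (u z * D z) - u x = \int[nu d]_z ((u z - u x) * D z).
  have -> : \int[nu d]_z (u z * D z) = \int[nu d]_z ((u z - u x) * D z + u x * D z).
    by apply: eq_rintegral => z; rewrite -mulrDl subrK.
  rewrite rintegralD//; last exact: rintegrableZ.
  by rewrite rintegralZ// eD mulr1 addrK.
apply: (le_trans (norm_rintegral iB)).
rewrite -nD -rintegralZ; last exact: rintegrable_norm.
by apply: le_rintegral => //; exact: rintegrable_norm.
Qed.

Lemma approximate_identity_cvg d (u : 'rV[R]_d -> R) (chi : R -> R) (x : 'rV[R]_d) :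
  continuous u -> tame chi -> \int[mu]_t chi t = 1 ->
  (fun J : nat => \int[nu d]_z (u z * \prod_i dil (2 ^+ J) chi (x ord0 i - z ord0 i))) @ \oo --> u x.
Proof.
move=> cu tchi chi1; have [r r0 hchi] := tame_csupp tchi.
pose K := (\int[mu]_t `|chi t|) ^+ d + 1.
have K0 : 0 < K by rewrite ltr_wpDl// exprn_ge0// rintegral_ge0.
apply/cvgrPdist_le => e e0.
have [s0 s00 hs] := approximate_identity x cu tchi r0 hchi chi1 (divr_gt0 e0 K0).
have [J0 hJ0] := pow2_unbounded s0.
near=> J; rewrite distrC; apply: (le_trans (hs (2 ^+ J) _)).
  apply: (le_trans hJ0); rewrite ler_weXn2l ?ler1n//.
  by near: J; exact: nbhs_infty_ge.
by rewrite mulrAC ler_pdivrMr// ler_pM2l// /K lerDl.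
Unshelve. all: by end_near.
Qed.

End approximate_identity.

(** * The quadrature error as a limit of sums over levels *)

Section cubature.
Context {R : realType}.
Local Notation mu := (@lebesgue_measure R).
Local Notation nu := (lebesgue_rV R).
Variables (k : nat) (u : 'rV[R]_k.+1 -> R).
Hypotheses (cu : continuous u)
  (u0 : forall z : 'rV[R]_k.+1, u z != 0 -> forall i, 0 <= z ord0 i <= 1).

(** A point on a face can be pushed out of the cube, so by continuity [u] vanishes there. Hence
    translated nodes that land on a face contribute nothing. *)
Lemma cube_supported_interior (z : 'rV[R]_k.+1) : u z != 0 -> forall i, 0 < z ord0 i < 1.
Proof.
move=> uz i; have /andP[z0 z1] := u0 uz i.
have un : 0 < `|u z| by rewrite normr_gt0.
have [del del0 hdel] := continuous_rV_delta z cu un.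
have push (t : R) : `|t| < del -> ~~ (0 <= z ord0 i + t <= 1) -> False.
  move=> ht hb; pose y : 'rV[R]_k.+1 := \row_j (z ord0 j + t * (j == i)%:R).
  have uy : u y = 0.
    apply/eqP/negPn/negP => uy; have := u0 uy i; rewrite mxE eqxx mulr1.
    exact/negP.
  have /hdel : forall j, `|z ord0 j - y ord0 j| < del.
    move=> j; rewrite mxE opprD addrA subrr add0r normrN.
    by case: eqP => _; rewrite ?mulr1// mulr0 normr0.
  by rewrite uy subr0 ltxx.
rewrite !lt_neqAle z0 z1 !andbT; apply/andP; split; apply/eqP => e.
  apply: (push (- (del / 2))); first by rewrite normrN gtr0_norm; lra.
  by rewrite -e negb_and -!ltNge; apply/orP; left; lra.
apply: (push (del / 2)); first by rewrite gtr0_norm; lra.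
by rewrite e negb_and -!ltNge; apply/orP; right; lra.
Qed.

Lemma cube_supported_integrable : rintegrable (nu k.+1) u.
Proof.
pose A : 'I_k.+1 -> set R := fun=> `[0, 1]%classic.
have cpt := @rV_compact R k.+1 A (fun=> @segment_compact R 0 1).
have : bounded_set (u @` [set z : 'rV[R]_k.+1 | forall i, A i (z ord0 i)]).
  by apply: compact_bounded; apply: continuous_compact => //; exact: continuous_subspaceT.
move=> [M [_ hM]].
have [iQ _] := @boxf_integral R k.+1 0 1 ler01.
apply: (@rintegrable_le _ _ _ _ _ (fun z => (`|M| + 1) * boxf 0 1 z)).
- exact: continuous_rV_measurable.
- exact: rintegrableZ.
move=> z; have [->|uz] := eqVneq (u z) 0.
  by rewrite normr0 mulr_ge0 ?addr_ge0// boxf_ge0.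
rewrite boxf1 ?mulr1; last exact: u0.
apply: (hM (`|M| + 1)); first by rewrite ltr_pwDr// ler_norm.
by exists z => // i; rewrite /A /= in_itv /=; exact: u0.
Qed.

(** A node lies in the open cube only if [n] is within [N] steps after [T * N] and [q] is constantly
    [T], the zero translation; those nodes are the original points. *)
Lemma sum_shifted_node N T (alpha : 'rV[R]_k) : (0 < N)%N -> (0 < T)%N ->
  \sum_(n < 2 * T * N) \sum_q u (\row_i shifted_node N T alpha n q i) =
  \sum_(n < N) u (kronecker alpha n).
Proof.
move=> N0 T0; have NR : 0 < N%:R :> R by rewrite ltr0n.
pose G n := \sum_q u (\row_i shifted_node N T alpha n q i).
have G0 n : ~~ (T * N <= n < T * N + N)%N -> G n = 0.
  move=> hn; apply: big1 => q _; apply/eqP/negPn/negP => /cube_supported_interior/(_ ord0).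
  rewrite mxE /shifted_node ocons0 subr_gt0 ltrBlDr ltr_pdivlMr// ltr_pdivrMr//.
  rewrite -natrM ltr_nat mulrDl mul1r -natrM -natrD ltr_nat => /andP[h1 h2].
  by move/negP: hn; apply; rewrite (ltnW h1) addnC.
transitivity (\sum_(T * N <= n < T * N + N) G n).
  rewrite -(big_mkord xpredT G).
  have e1 : (T * N <= 2 * T * N)%N by rewrite leq_mul2r leq_pmull ?orbT.
  have e2 : (T * N + N <= 2 * T * N)%N by rewrite -mulSnr leq_mul2r; apply/orP; right; lia.
  rewrite (big_cat_nat (leq0n _) e1) /= (big_cat_nat (leq_addr N (T * N)) e2) /=.
  rewrite big1_seq ?add0r; last first.
    move=> n; rewrite mem_index_iota => /andP[_ /andP[_ hn]]; apply: G0.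
    by rewrite negb_and -ltnNge hn.
  rewrite [X in _ + X]big1_seq ?addr0// => n; rewrite mem_index_iota => /andP[_ /andP[hn _]]; apply: G0.
  by rewrite negb_and -!leqNgt hn orbT.
rewrite -[X in \sum_(X <= _ < _) _]add0n big_addn addKn big_mkord; apply: eq_bigr => n _.
have hT : (T < 2 * T + 1)%N by lia.
pose q0 : {ffun 'I_k -> 'I_(2 * T + 1)} := [ffun _ => Ordinal hT].
rewrite /G (bigD1 q0) //= big1 ?addr0.
  congr u; apply/rowP => i; rewrite !mxE /shifted_node /ocons.
  case: unliftP => [j _|_]; last by rewrite natrD natrM; field; rewrite gt_eqF.
  by rewrite ffunE /= subrr subr0 natrD addrK.
move=> q qq0; have [i hi] : exists i, q i != Ordinal hT.
  apply/existsP; apply: contraNT qq0 => /existsPn h; apply/eqP/ffunP => i.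
  by rewrite ffunE; have /negPn/eqP := h i.
apply/eqP/negPn/negP => /cube_supported_interior/(_ (lift ord0 i)).
rewrite mxE /shifted_node oconsS; set t := Defs.frac _.
have /andP[t0 t1] : 0 <= t < 1 by exact: frac_ge0_lt1.
have := @natr_dist R _ _ (hi : (q i : nat) != T).
by rewrite ler_normr => /orP[] h /andP[h1 h2]; lra.
Qed.

(** The truncated sum over levels is the quadrature error of [u] smoothed at scale [2 ^- J]. At the
    finitely many nodes the smoothing converges to [u], and the bound survives the limit. *)
Lemma cubature_error_le N T (alpha : 'rV[R]_k) (Phi0 Phi1 Psi0 Psi1 chi : R -> R) (r B : R) :
  (0 < N)%N -> (0 < T)%N ->
  tame Phi0 -> tame Phi1 -> tame Psi0 -> tame Psi1 -> tame chi ->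
  0 <= r -> csupp r Psi0 -> csupp r Psi1 ->
  \int[mu]_x chi x = 1 -> conv Phi0 Psi0 = chi ->
  conv Phi1 Psi1 = (fun x => dil 2 chi x - chi x) ->
  (forall J, `|\sum_(m : {ffun 'I_k.+1 -> 'I_J.+1}) \int[nu k.+1]_y
    (block u (fun i => dyadic Psi0 Psi1 (m i)) y *
     kappa N T alpha (fun i => dyadic Phi0 Phi1 (m i)) (fun i => y ord0 i))| <= B) ->
  `|N%:R^-1 * (\sum_(n < N) u (kronecker alpha n)) - \int[nu k.+1]_z u z| <= B.
Proof.
move=> N0 T0 tF0 tF1 tP0 tP1 tchi r0 hP0 hP1 chi1 e0 e1 hB.
have iu := cube_supported_integrable.
rewrite -(sum_shifted_node alpha N0 T0).
pose w (J : nat) := N%:R^-1 * (\sum_(n < 2 * T * N) \sum_q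
    \int[nu k.+1]_z (u z * \prod_i dil (2 ^+ J) chi (shifted_node N T alpha n q i - z ord0 i))) -
  \int[nu k.+1]_z u z.
have lim : w @ \oo --> N%:R^-1 * (\sum_(n < 2 * T * N) \sum_q u (\row_i shifted_node N T alpha n q i)) -
    \int[nu k.+1]_z u z.
  apply: cvgB; last exact: cvg_cst.
  apply: cvgMr; apply: cvg_bigsum => n; apply: cvg_bigsum => q.
  have := @approximate_identity_cvg R k.+1 u chi (\row_i shifted_node N T alpha n q i) cu tchi chi1.
  set f := (fun J : nat => _) => h; set g := (fun J : nat => _); suff -> : g = f by [].
  apply/funext => J; apply: eq_rintegral => z; congr (_ * _).
  by apply: eq_bigr => i _; rewrite mxE.
rewrite -[X in `|X|]subr0; apply: (cvg_dist_le lim) => J _; rewrite subr0.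
have := @sum_block_kappa R k u Phi0 Phi1 Psi0 Psi1 chi r J iu u0 tF0 tF1 tP0 tP1 tchi r0 hP0 hP1 chi1 e0 e1
  N T alpha.
by rewrite -/(w J) => <-.
Qed.

End cubature.

(** * Smoothness of tensor products *)

Section tensor_smoothness.
Context {R : realType} {k : nat}.
Local Notation Rd := 'rV[R]_k.+1.
Implicit Types (v : 'I_k.+1 -> R -> R) (x : Rd).

Lemma continuous_tens v : (forall i, continuous (v i)) -> continuous (tens v).
Proof.
move=> cv.
have gen (s : seq 'I_k.+1) : continuous (fun x : Rd => \prod_(i <- s) v i (x ord0 i)).
  elim: s => [|i s IH].
    have -> : (fun x : Rd => \prod_(i <- [::]) v i (x ord0 i)) = (fun=> 1).
      by apply/funext => x; rewrite big_nil.
    exact: cst_continuous.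
  have -> : (fun x : Rd => \prod_(j <- i :: s) v j (x ord0 j)) =
      (fun x => v i (x ord0 i) * \prod_(j <- s) v j (x ord0 j)).
    by apply/funext => x; rewrite big_cons.
  move=> x; apply: (@continuousM R Rd (fun x : Rd => v i (x ord0 i)) _ x); last exact: IH.
  apply: (@continuous_comp _ _ _ (fun y : Rd => y ord0 i) (v i)); first exact: coord_continuous.
  exact: cv.
exact: gen.
Qed.

Lemma is_derive_tens v i x (dv : R -> R) : (forall t : R, is_derive t (1 : R) (v i) (dv t)) ->
  is_derive x (delta_mx ord0 i : Rd) (tens v) (tens (fun j => if j == i then dv else v j) x).
Proof.
move=> hdv; pose c := \prod_(j | j != i) v j (x ord0 j).
have dE : tens (fun j => if j == i then dv else v j) x = c * dv (x ord0 i).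
  rewrite /tens (bigD1 i) //= eqxx mulrC; congr (_ * _).
  by apply: eq_bigr => j /negbTE ->.
have tE (h : R) : tens v (h *: (delta_mx ord0 i : Rd) + x) = c * v i (h *: 1 + x ord0 i).
  rewrite /tens (bigD1 i) //= mulrC; congr (_ * v i _); last by rewrite !mxE !eqxx.
  by apply: eq_bigr => j /negbTE ji; rewrite !mxE ji andbF mulr0 add0r.
have hd := hdv (x ord0 i).
have lim : (fun h : R => h^-1 *: (tens v (h *: (delta_mx ord0 i : Rd) + x) - tens v x)) @ 0^' -->
    c * dv (x ord0 i).
  have e0 : tens v x = c * v i (x ord0 i).
    by have := tE 0; rewrite !scale0r !add0r.
  have -> : (fun h : R => h^-1 *: (tens v (h *: (delta_mx ord0 i : Rd) + x) - tens v x)) =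
    (fun h => c * (h^-1 *: (v i (h *: 1 + x ord0 i) - v i (x ord0 i)))).
    by apply/funext => h; rewrite tE e0 -mulrBr /GRing.scale /=; ring.
  apply: cvgMr; have /cvg_ex[l hl] := @ex_derive _ _ _ _ _ _ _ hd.
  have <- : l = dv (x ord0 i).
    rewrite -(@derive_val _ _ _ _ _ _ _ hd); apply/esym; exact: (cvg_lim _ hl).
  exact: hl.
rewrite dE; apply: DeriveDef; first by apply/cvg_ex; exists (c * dv (x ord0 i)).
exact: (cvg_lim _ lim).
Qed.

(** Partial derivatives of a tensor product are tensor products again; the list of directions
    matters only through how often each index occurs. *)
Lemma smooth_tens v : (forall i, smooth1 (v i)) -> smooth (tens v).
Proof.
move=> sv.
have pE l : partials l (tens v) = tens (fun j => derive1n (count_mem j l) (v j)).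
  elim: l => [|i l IH] //=.
  rewrite IH; apply/funext => x.
  have h := @is_derive_tens (fun j => derive1n (count_mem j l) (v j)) i x
    (derive1n (count_mem i l).+1 (v i)) (fun t => smooth1_derive _ t (sv i)).
  rewrite (@derive_val _ _ _ _ _ _ _ h); congr (tens _ x); apply/funext => j /=.
  by rewrite eq_sym; case: eqP => [->|]; rewrite ?add1n ?add0n.
move=> l; rewrite pE; split.
  apply: continuous_tens => i t.
  have := smooth1_derive (count_mem i l) t (sv i) => h.
  by apply: differentiable_continuous; apply/derivable1_diffP; exact: ex_derive.
move=> i x.
have h := @is_derive_tens (fun j => derive1n (count_mem j l) (v j)) i x
    (derive1n (count_mem i l).+1 (v i)) (fun t => smooth1_derive _ t (sv i)).
exact: ex_derive.
Qed.

Lemma smooth_cst0 : smooth (fun _ : Rd => 0 : R).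
Proof.
have pE l : partials l (fun _ : Rd => 0 : R) = (fun _ => 0).
  by elim: l => [|i l IH] //=; rewrite IH; apply/funext => x; exact: derive_cst.
by move=> l; rewrite pE; split=> [x|i x]; [exact: cst_continuous|exact: derivable_cst].
Qed.

End tensor_smoothness.

(** * Besov norms *)

Section distributions.
Context {R : realType}.
Local Notation mu := (@lebesgue_measure R).
Local Notation nu := (lebesgue_rV R).

Lemma smooth1_affine (c a b : R) (f : R -> R) : smooth1 f -> smooth1 (fun x => c * f (a * x + b)).
Proof.
move=> sf.
have dn m (x : R) : is_derive x (1 : R) (fun x => c * a ^+ m * derive1n m f (a * x + b))
    (c * a ^+ m.+1 * derive1n m.+1 f (a * x + b)).
  have d2 : is_derive x 1 (fun x : R => a * x + b) a.
    by apply: is_derive_eq; rewrite addr0 /GRing.scale /= mulr1.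
  have d3 := @is_derive1_comp R _ (fun y => a * y + b) x _ _ (smooth1_derive m (a * x + b) sf) d2.
  have d4 := is_deriveZ (c * a ^+ m) d3.
  have -> : (fun x0 => c * a ^+ m * derive1n m f (a * x0 + b)) =
    (c * a ^+ m) \*: (derive1n m f \o (fun y => a * y + b)) by [].
  by apply: (is_derive_eq d4); rewrite /GRing.scale /= exprS; ring.
have dE n : derive1n n (fun x => c * f (a * x + b)) = (fun x => c * a ^+ n * derive1n n f (a * x + b)).
  elim: n => [|n IH]; first by apply/funext => x; rewrite expr0 mulr1.
  by rewrite derive1nS IH; apply/funext => x; rewrite derive1E (@derive_val _ _ _ _ _ _ _ (dn n x)).
by move=> n x; rewrite dE; have hx := dn n x; exact: ex_derive.
Qed.

Lemma up_smooth1 (Psi0 : R -> R) : is_up_function Psi0 -> smooth1 Psi0.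
Proof. by case. Qed.

Lemma up_csupp (Psi0 : R -> R) : is_up_function Psi0 -> csupp 1 Psi0.
Proof.
case=> _ hs _ x x1; apply/eqP/negPn/negP => px.
have : closure [set x | Psi0 x != 0] x by exact: subset_closure.
by rewrite hs /= in_itv /= -ler_norml leNgt x1.
Qed.

(** The integral is the Fourier transform at frequency 0, where every factor [sinc] is 1. *)
Lemma up_integral (Psi0 : R -> R) : is_up_function Psi0 -> \int[mu]_x Psi0 x = 1.
Proof.
case=> _ _ /(_ 0)[l hl]; rewrite /fourier /Cintegral => e.
have l1 : l = 1.
  have c1 : (fun n => \prod_(k < n) sinc (2 ^- k * 0 : R)) = (fun _ : nat => 1).
    by apply/funext => n; apply: big1 => i _; rewrite mulr0 /sinc eqxx.
  rewrite c1 in hl; apply/esym.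
  by apply: (@cvg_unique _ (@Rhausdorff R) _ _ _ _ _ hl); exact: cvg_cst.
move: e => /(congr1 (@complex.Re R)) /=; rewrite l1 => <-.
apply: eq_rintegral => y; rewrite mulr0 mul0r oppr0 /expi cos0 sin0 /=; ring.
Qed.

Lemma tame_up (Psi0 : R -> R) : is_up_function Psi0 -> tame Psi0.
Proof. by move=> h; exact: tame_smooth (up_smooth1 h) (up_csupp h). Qed.

Lemma Re_mulr_real (z : R[i]) (c : R) : complex.Re (z * c%:C%C) = complex.Re z * c.
Proof. by case: z => a b /=; rewrite mulr0 subr0. Qed.

Lemma Im_mulr_real (z : R[i]) (c : R) : complex.Im (z * c%:C%C) = complex.Im z * c.
Proof. by case: z => a b /=; rewrite mulr0 add0r. Qed.

Lemma bump_test_function k (Psi0 : R -> R) (U : set 'rV[R]_k.+1) (x : 'rV[R]_k.+1) (s : R) :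
  smooth1 Psi0 -> csupp 1 Psi0 -> 0 < s ->
  (forall y : 'rV[R]_k.+1, (forall i, `|x ord0 i - y ord0 i| <= s^-1) -> U y) ->
  test_function U (fun z => (\prod_i dil s Psi0 (x ord0 i - z ord0 i))%:C%C).
Proof.
move=> sP hP s0 hU; split; first split.
- have -> : (fun y : 'rV[R]_k.+1 => complex.Re (\prod_i dil s Psi0 (x ord0 i - y ord0 i))%:C%C) =
    tens (fun i t => s * Psi0 (- s * t + s * x ord0 i)).
    apply/funext => y; apply: eq_bigr => i _; rewrite /dil; congr (_ * Psi0 _); ring.
  by apply: smooth_tens => i; exact: smooth1_affine.
- exact: smooth_cst0.
pose A (i : 'I_k.+1) : set R := `[x ord0 i - s^-1, x ord0 i + s^-1]%classic.
have cA : compact [set z : 'rV[R]_k.+1 | forall i, A i (z ord0 i)].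
  by apply: (@rV_compact R k.+1 A) => i; exact: segment_compact.
have clA : closed [set z : 'rV[R]_k.+1 | forall i, A i (z ord0 i)].
  by apply: compact_closed => //; exact: norm_hausdorff.
have sub : closure [set z : 'rV[R]_k.+1 | (\prod_i dil s Psi0 (x ord0 i - z ord0 i))%:C%C != 0 :> R[i]] `<=`
    [set z : 'rV[R]_k.+1 | forall i, A i (z ord0 i)].
  rewrite [X in _ `<=` X](iffLR (closure_id _) clA); apply: closure_subset => z /= hz i.
  rewrite /A /= in_itv /= -ler_distlC; rewrite leNgt; apply/negP => hi.
  move/negP: hz; apply; rewrite (bigD1 i) //= /dil hP ?mulr0 ?mul0r//.
  by rewrite normrM gtr0_norm// mulrC -ltr_pdivrMr// div1r.
split; first exact: (subclosed_compact (@closed_closure _ _) cA sub).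
move=> z /sub hz; apply: hU => i; have := hz i.
by rewrite /A /= in_itv /= -ler_distlC.
Qed.

(* Outside the support, [f] integrates to 0 against bumps that shrink to the point. *)
Lemma dsupport_vanish k (Psi0 : R -> R) (f : 'rV[R]_k.+1 -> R[i]) : is_up_function Psi0 ->
  Ccontinuous f -> dsupport (regular_distribution f) `<=` @unit_cube R k.+1 ->
  forall x, ~ unit_cube x -> complex.Re (f x) = 0 /\ complex.Im (f x) = 0.
Proof.
move=> hup [cRe cIm] hs x hx.
have tP := tame_up hup; have hP := up_csupp hup; have P1 := up_integral hup.
have [U [oU hU] Ux] : (\bigcup_(U in [set U : set 'rV[R]_k.+1 | open U /\
    forall phi, test_function U phi -> regular_distribution f phi = 0]) U) x.
  by apply: contrapT => nx; apply: hx; exact: hs.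
have [del del0 hdel] := open_rV_delta oU Ux.
have zero s : del^-1 < s ->
    \int[nu k.+1]_z (complex.Re (f z) * \prod_i dil s Psi0 (x ord0 i - z ord0 i)) = 0 /\
    \int[nu k.+1]_z (complex.Im (f z) * \prod_i dil s Psi0 (x ord0 i - z ord0 i)) = 0.
  move=> hds; have s0 : 0 < s by apply: lt_trans hds; rewrite invr_gt0.
  have sd : s^-1 < del by rewrite -[del]invrK ltf_pV2 ?posrE ?invr_gt0.
  have := hU _ (bump_test_function (up_smooth1 hup) hP s0 _ (x := x)).
  move=> /(_ _)h; have {}h : regular_distribution f
      (fun z => (\prod_i dil s Psi0 (x ord0 i - z ord0 i))%:C%C) = 0.
    by apply: h => y hy; apply: hdel => i; apply: le_lt_trans sd.
  rewrite /regular_distribution /Cintegral in h.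
  move: h => /eqP; rewrite eq_complex /= => /andP[/eqP h1 /eqP h2].
  split.
    by rewrite -h1; apply: eq_rintegral => z; rewrite Re_mulr_real.
  by rewrite -h2; apply: eq_rintegral => z; rewrite Im_mulr_real.
have lim0 (u : 'rV[R]_k.+1 -> R) : continuous u -> (forall s, del^-1 < s ->
    \int[nu k.+1]_z (u z * \prod_i dil s Psi0 (x ord0 i - z ord0 i)) = 0) -> u x = 0.
  move=> cu hz.
  have lim := @approximate_identity_cvg R k.+1 u Psi0 x cu tP P1.
  have lim2 : (fun J : nat => \int[nu k.+1]_z (u z * \prod_i dil (2 ^+ J) Psi0 (x ord0 i - z ord0 i)))
      @ \oo --> (0 : R).
    have [J0 hJ0] := pow2_unbounded (del^-1 + 1 : R).
    apply: cvg_near_cst; near=> J; apply/eqP; rewrite hz//.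
    apply: (lt_le_trans (_ : _ < del^-1 + 1)); first by rewrite ltrDl.
    apply: (le_trans hJ0); rewrite ler_weXn2l ?ler1n//.
    by near: J; exact: nbhs_infty_ge.
  exact: (@cvg_unique _ (@Rhausdorff R) _ _ _ _ lim lim2).
split.
  by apply: (lim0 (fun z => complex.Re (f z)) cRe) => s /zero[].
by apply: (lim0 (fun z => complex.Im (f z)) cIm) => s /zero[].
Unshelve. all: by end_near.
Qed.

Lemma block_dconvolution k L (Psi0 : R -> R) (f : 'rV[R]_k.+1 -> R[i]) (m : {ffun 'I_k.+1 -> nat}) y :
  dconvolution (tensor_mean L Psi0 m) (regular_distribution f) y =
  Complex (block (fun z => complex.Re (f z)) (fun i => local_mean L Psi0 (m i)) y)
          (block (fun z => complex.Im (f z)) (fun i => local_mean L Psi0 (m i)) y).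
Proof.
rewrite /dconvolution /regular_distribution /Cintegral.
have e (z : 'rV[R]_k.+1) : tensor_mean L Psi0 m (y - z) = tensB (fun i => local_mean L Psi0 (m i)) y z.
  by apply: eq_bigr => i _; rewrite !mxE.
congr Complex; apply: eq_rintegral => z; rewrite e.
  exact: Re_mulr_real.
exact: Im_mulr_real.
Qed.

End distributions.

(** * Weighted forms of the Hoelder inequality *)

Section weighted_hoelder.
Context {R : realType}.
Implicit Types (a b lam r C K : R).

(** Young's inequality for the factors [a * lam ^ (- 1/q)] and [lam ^ (1/q)], with q conjugate to
    [r]; the case [r = 1], where q is infinite, is separate. The parameter stays free so that it can
    be optimised after summation or integration. *)
Lemma young_weight r a lam : 1 <= r -> 0 <= a -> 0 < lam ->
  a <= r^-1 * (a `^ r * lam `^ (1 - r)) + (1 - r^-1) * lam.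
Proof.
move=> r1 a0 lam0; have r0 : 0 < r by exact: lt_le_trans r1.
have rn0 : r != 0 by rewrite gt_eqF.
have [->|rn1] := eqVneq r 1.
  by rewrite subrr powRr0 mulr1 powRr1// invr1 mul1r subrr mul0r addr0.
have r1' : 1 < r by rewrite lt_neqAle eq_sym rn1.
pose q := (1 - r^-1)^-1.
have q0 : 0 < q by rewrite invr_gt0 subr_gt0 invf_lt1.
have conj : r^-1 + q^-1 = 1 by rewrite invrK addrC subrK.
have := @conjugate_powR R (a * lam `^ (- q^-1)) (lam `^ q^-1) r q.
move=> /(_ (mulr_ge0 a0 (powR_ge0 _ _)) (powR_ge0 _ _) r0 q0 conj).
rewrite -mulrA -powRD ?(gt_eqF lam0) ?implybT// addNr powRr0 mulr1.
have -> : (lam `^ q^-1) `^ q = lam by rewrite -powRrM mulVf ?gt_eqF// (powRr1 (ltW lam0)).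
have -> : (a * lam `^ (- q^-1)) `^ r = a `^ r * lam `^ (1 - r).
  rewrite powRM ?powR_ge0// -[in LHS]powRrM; congr (_ * _ `^ _).
  by rewrite /q invrK; field.
by rewrite [lam / q]mulrC /q invrK [_ / r]mulrC.
Qed.

(* With [lam] the optimal value, both terms of Young's inequality are multiples of [b * K^(1/r) * C^(1-1/r)]. *)
Lemma young_optimal r b K C : 1 <= r -> 0 < b -> 0 < K -> 0 < C ->
  exists2 lam, 0 < lam &
    r^-1 * lam `^ (1 - r) * K * b `^ r + (1 - r^-1) * lam * C = b * K `^ r^-1 * C `^ (1 - r^-1).
Proof.
move=> r1 b0 K0 C0; have r0 : 0 < r by exact: lt_le_trans r1.
have rn0 : r != 0 by rewrite gt_eqF.
exists (b * K `^ r^-1 * C `^ (- r^-1)); first by rewrite !mulr_gt0// powR_gt0.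
set lam := b * _ * _.
have lam0 : 0 < lam by rewrite !mulr_gt0// powR_gt0.
have eC : C `^ (1 - r^-1) = C `^ (- r^-1) * C.
  by rewrite -[X in _ * X](powRr1 (ltW C0)) -powRD ?(gt_eqF C0) ?implybT// addrC.
have eK : K = (K `^ r^-1) `^ r by rewrite -powRrM mulVf// powRr1// ltW.
have e1 : lam `^ (1 - r) * K * b `^ r = lam * C.
  have lr : lam `^ r = b `^ r * K * C^-1.
    rewrite /lam !powRM ?powR_ge0 ?mulr_ge0 ?powR_ge0 ?(ltW b0)// -eK -powRrM.
    by rewrite mulNr mulVf// powR_inv1// ltW.
  rewrite powRB ?(gt_eqF lam0) ?implybT// (powRr1 (ltW lam0)) lr.
  by field; rewrite !gt_eqF ?powR_gt0.
transitivity (r^-1 * (lam `^ (1 - r) * K * b `^ r) + (1 - r^-1) * lam * C); first by ring.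
by rewrite e1 eC /lam; ring.
Qed.

(** In Young's inequality times [w i], the weight is bounded by 1 next to the power of [g i], and
    summed in the other term. *)
Lemma sum_hoelder (I : finType) (g w : I -> R) r C : 1 <= r -> (forall i, 0 <= g i) ->
  (forall i, 0 <= w i <= 1) -> 0 < C -> \sum_i w i <= C -> \sum_i g i `^ r <= 1 ->
  \sum_i g i * w i <= C `^ (1 - r^-1).
Proof.
move=> r1 g0 w01 C0 hC hg.
have r0 : 0 < r by exact: lt_le_trans r1.
have [lam lam0 e] := young_optimal r1 ltr01 ltr01 C0.
rewrite !powR1 !mulr1 mul1r in e; rewrite -e.
have ri : 0 <= 1 - r^-1 by rewrite subr_ge0 invf_le1.
apply: (@le_trans _ _ (\sum_i (r^-1 * lam `^ (1 - r) * g i `^ r + (1 - r^-1) * lam * w i))).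
  apply: ler_sum => i _; have /andP[w0 w1] := w01 i.
  have := ler_wpM2r w0 (young_weight r1 (g0 i) lam0) => /le_trans; apply.
  rewrite mulrDl; apply: lerD => //.
  rewrite -!mulrA; apply: ler_wpM2l; first by rewrite invr_ge0 ltW.
  rewrite mulrCA; apply: ler_wpM2l; first exact: powR_ge0.
  by rewrite ler_piMr// powR_ge0.
rewrite big_split /= -!mulr_sumr; apply: lerD.
  by rewrite ler_piMr// mulr_ge0 ?powR_ge0// invr_ge0 ltW.
by apply: ler_wpM2l => //; rewrite mulr_ge0// ltW.
Qed.

Section integral.
Context d (T : measurableType d) (nu : {measure set T -> \bar R}).
Implicit Types (g w : T -> R).

(** The interpolation that yields the exponent 1/p: next to the power of [g] the weight is bounded
    by its supremum [K], in the other term by its integral [C]. *)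
Lemma weighted_hoelder_fin g w r b K C : 1 <= r -> 0 < b -> 0 < K -> 0 < C ->
  measurable_fun setT g -> (forall x, 0 <= g x) -> (forall x, 0 <= w x <= K) ->
  rintegrable nu w -> rintegrable nu (fun x => g x * w x) -> \int[nu]_x w x <= C ->
  (\int[nu]_x (g x `^ r)%:E <= (b `^ r)%:E)%E ->
  \int[nu]_x (g x * w x) <= b * K `^ r^-1 * C `^ (1 - r^-1).
Proof.
move=> r1 b0 K0 C0 mg g0 wK iw igw hC hg.
have r0 : 0 < r by exact: lt_le_trans r1.
have [lam lam0 <-] := young_optimal r1 b0 K0 C0.
have ri : 0 <= 1 - r^-1 by rewrite subr_ge0 invf_le1.
have mgr : measurable_fun setT (fun x => g x `^ r) by exact: (measurableT_comp (measurable_powR r) mg).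
have igr : rintegrable nu (fun x => g x `^ r).
  apply/integrableP; split; first exact/measurable_EFinP.
  under eq_integral do rewrite gee0_abs ?lee_fin ?powR_ge0//.
  by apply: (le_lt_trans hg); rewrite ltry.
have igr' : \int[nu]_x (g x `^ r) <= b `^ r by rewrite -lee_fin EFin_Rintegral.
pose c1 := r^-1 * lam `^ (1 - r) * K; pose c2 := (1 - r^-1) * lam.
have c10 : 0 <= c1 by rewrite !mulr_ge0 ?powR_ge0 ?invr_ge0 ?(ltW r0)// ltW.
have c20 : 0 <= c2 by rewrite mulr_ge0// ltW.
have i1 := rintegrableZ c1 igr; have i2 := rintegrableZ c2 iw.
apply: (@le_trans _ _ (\int[nu]_x (c1 * g x `^ r + c2 * w x))).
  apply: le_rintegral => [//||x]; first exact: rintegrableD.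
  have /andP[w0 w1] := wK x.
  have := ler_wpM2r w0 (young_weight r1 (g0 x) lam0) => /le_trans; apply.
  rewrite mulrDl; apply: lerD => //; rewrite /c1.
  rewrite -!mulrA; apply: ler_wpM2l; first by rewrite invr_ge0 ltW.
  rewrite mulrCA; apply: ler_wpM2l; first exact: powR_ge0.
  by rewrite mulrC ler_wpM2r// powR_ge0.
rewrite rintegralD// !rintegralZ//; apply: lerD; first exact: ler_wpM2l.
by rewrite /c2 ler_wpM2l.
Qed.

Lemma weighted_hoelder_sup g w b C : 0 <= b -> 
  measurable_fun setT g -> (forall x, 0 <= g x) -> (forall x, 0 <= w x) ->
  rintegrable nu w -> rintegrable nu (fun x => g x * w x) -> \int[nu]_x w x <= C ->
  {ae nu, forall x, g x <= b} -> \int[nu]_x (g x * w x) <= b * C.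
Proof.
move=> b0 mg g0 w0 iw igw hC hg.
apply: (@le_trans _ _ (\int[nu]_x (b * w x))); last first.
  by rewrite rintegralZ// ler_wpM2l.
have ibw := rintegrableZ b iw.
rewrite -lee_fin !EFin_Rintegral//; apply: ae_ge0_le_integral => //.
- by move=> x _; rewrite lee_fin mulr_ge0.
- by apply/measurable_EFinP; exact: rintegrable_measurable igw.
- by move=> x _; rewrite lee_fin mulr_ge0.
- by apply/measurable_EFinP; exact: rintegrable_measurable ibw.
- by apply: filterS hg => x gb _; rewrite lee_fin ler_wpM2r.
Qed.

Lemma weighted_hoelder (p : \bar R) g w b K C : (1 <= p)%E -> 0 <= b -> 0 < K -> 0 < C ->
  measurable_fun setT g -> (forall x, 0 <= g x) -> (forall x, 0 <= w x <= K) ->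
  rintegrable nu w -> rintegrable nu (fun x => g x * w x) -> \int[nu]_x w x <= C ->
  (Lnorm nu p (EFin \o g) <= b%:E)%E ->
  \int[nu]_x (g x * w x) <= b * K `^ (fine p^-1) * C `^ (1 - fine p^-1).
Proof.
move=> p1 b0 K0 C0 mg g0 wK iw igw hC hg.
case: p p1 hg => [r| |] //; last first.
  move=> _ hg; rewrite invey /= powRr0 mulr1 subr0 (powRr1 (ltW C0)).
  apply: weighted_hoelder_sup => //; first by move=> x; have /andP[] := wK x.
  move: hg; rewrite unlock; case: ifPn => [_|].
    move=> /ess_sup_inf.ess_supP; apply: filterS => x /=; rewrite lee_fin ger0_norm//.
  (* If the total mass is 0 the norm gives no information, but then every property holds almost
     everywhere. *)
  rewrite -leNgt => nu0 _; exists setT; split => //.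
  by apply/eqP; rewrite eq_le nu0 measure_ge0.
rewrite lee_fin => r1 hg; have r0 : 0 < r by exact: lt_le_trans r1.
have -> : fine (r%:E^-1)%E = r^-1 by rewrite inver gt_eqF.
have hgr (b' : R) : b <= b' -> (\int[nu]_x (g x `^ r)%:E <= (b' `^ r)%:E)%E.
  move=> bb'; have -> : (\int[nu]_x (g x `^ r)%:E = Lnorm nu r%:E (EFin \o g) `^ r)%E.
    rewrite (@poweR_Lnorm _ _ _ nu _ r (negbT (gt_eqF r0))); apply: eq_integral => x _ /=.
    by rewrite ger0_norm.
  rewrite -poweR_EFin; apply: gt0_ler_poweR; rewrite ?(ltW r0)//.
  - by rewrite in_itv /= leey Lnorm_ge0.
  - by rewrite in_itv /= leey andbT lee_fin (le_trans b0).
  - by apply: (le_trans hg); rewrite lee_fin.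
(* The optimal parameter needs a positive norm bound while [b] may be 0, so [b] is replaced by
   [b + e / D]. *)
apply/ler_addgt0Pr => e e0.
pose D := K `^ r^-1 * C `^ (1 - r^-1); have D0 : 0 < D by rewrite mulr_gt0// powR_gt0.
have be : 0 < b + e / D by rewrite ltr_wpDl// divr_gt0.
have := @weighted_hoelder_fin g w r (b + e / D) K C r1 be K0 C0 mg g0 wK iw igw hC.
move=> /(_ (hgr _ _)) => /(_ _) h; apply: (le_trans (h _)).
  by rewrite lerDl divr_ge0// ltW.
by rewrite -!mulrA -/D mulrDl divfK ?gt_eqF.
Qed.

End integral.
End weighted_hoelder.

(** * Summation over the levels *)

Section level_weights.
Context {R : realType}.
Implicit Types (q s ip X Y : R).

(** The first entry is determined by the sum and the other [k] entries. This saves one power, so the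
    exponent of the logarithm is governed by [k] rather than [k.+1]. *)
Lemma card_level_le k J n :
  (#|[set m : {ffun 'I_k.+1 -> 'I_J.+1} | (\sum_i m i)%N == n]%SET| <= n.+1 ^ k)%N.
Proof.
pose tail (m : {ffun 'I_k.+1 -> 'I_J.+1}) : {ffun 'I_k -> 'I_n.+1} :=
  [ffun i => inord (m (lift ord0 i))].
set A := [set m | _]%SET.
have inj : {in A &, injective tail}.
  move=> m m'; rewrite !inE => /eqP hm /eqP hm' /ffunP e.
  have le (a : {ffun 'I_k.+1 -> 'I_J.+1}) i : (\sum_i a i)%N = n -> (a i < n.+1)%N.
    by move=> <-; rewrite ltnS (bigD1 i) //= leq_addr.
  have el i : m (lift ord0 i) = m' (lift ord0 i) :> nat.
    by have := e i; rewrite !ffunE => /(congr1 val); rewrite /= !inordK ?le.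
  apply/ffunP => i; apply: val_inj; case: (unliftP ord0 i) => [j ->|->]; first exact: el.
  move: hm; rewrite -hm' !big_ord_recl (eq_bigr _ (fun i _ => el i)).
  by move/eqP; rewrite eqn_add2r => /eqP.
by rewrite -(card_in_imset inj) (leq_trans (max_card _))// card_ffun !card_ord.
Qed.

(** Summation by parts: multiplying by [1 - q] replaces the power [k.+1] by its increments, which
    have degree [k]. *)
Lemma polynomial_geometric_sum k q : 0 <= q < 1 ->
  exists2 C, 0 <= C & forall n, \sum_(j < n) j.+1%:R ^+ k * q ^+ j <= C.
Proof.
move=> /andP[q0 q1]; have q1' : 0 < 1 - q by rewrite subr_gt0.
elim: k => [|k [C C0 hC]].
  exists (1 - q)^-1; first by rewrite invr_ge0 ltW.
  move=> n; under eq_bigr do rewrite expr0 mul1r.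
  rewrite -[leRHS]mul1r ler_pdivlMr// -[X in X <= _]opprK -mulrN opprB.
  have := subrX1 q n; rewrite mulrC => <-; rewrite opprB gerBl; exact: exprn_ge0.
exists (k.+1%:R * C / (1 - q)); first by rewrite divr_ge0 ?mulr_ge0// ltW.
have mono n : n.+1%:R ^+ k.+1 - n%:R ^+ k.+1 <= k.+1%:R * n.+1%:R ^+ k :> R.
  rewrite subrXX; have -> : n.+1%:R - n%:R = 1 :> R by rewrite -natr1; ring.
  rewrite mul1r (_ : k.+1%:R * _ = \sum_(i < k.+1) n.+1%:R ^+ k); last first.
    by rewrite sumr_const card_ord mulr_natl.
  apply: ler_sum => i _; have ik : (i <= k)%N by have := ltn_ord i.
  rewrite -[in leRHS](subnK ik) exprD /=; apply: ler_wpM2l; first exact: exprn_ge0.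
  by apply: lerXn2r; rewrite ?nnegrE// ler_nat.
move=> n; rewrite ler_pdivlMr//.
suff H : (\sum_(j < n) j.+1%:R ^+ k.+1 * q ^+ j) * (1 - q) + n%:R ^+ k.+1 * q ^+ n <=
    k.+1%:R * \sum_(j < n) j.+1%:R ^+ k * q ^+ j.
  apply: (@le_trans _ _ (k.+1%:R * \sum_(j < n) j.+1%:R ^+ k * q ^+ j)).
    by apply: le_trans H; rewrite lerDl mulr_ge0// exprn_ge0.
  by rewrite ler_wpM2l.
elim: n => [|n IH]; first by rewrite !big_ord0 mul0r expr0n /= mul0r mulr0 addr0.
rewrite !big_ord_recr /= mulrDl [leRHS]mulrDr.
have := ler_wpM2r (exprn_ge0 n q0) (mono n).
rewrite mulrBl => h; rewrite (exprS q); move: IH h.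
set a := _ * (1 - q); set b := n%:R ^+ k.+1 * q ^+ n; set c := n.+1%:R ^+ k.+1; set e := q ^+ n.
move=> IH h; have -> : a + c * e * (1 - q) + c * (q * e) = a + c * e by ring.
by rewrite [_ * (_ * e)]mulrA; lra.
Qed.

(* [X ^ (- s)] times the factor of [block_kappa_le], for [X = 2 ^ |m| / Y]. *)
Definition level_weight ip s (B : nat) X : R :=
  if 1 <= X then X `^ (ip - s) else X `^ (B%:R - s).

(** The absolute difference of two naturals: at least one of the truncated differences is 0. *)
Definition level_dist (n0 n : nat) := (n0 - n + (n - n0))%N.

Lemma level_dist_le n0 n : (n <= n0)%N -> level_dist n0 n = (n0 - n)%N.
Proof. by rewrite /level_dist; lia. Qed.

Lemma level_dist_ge n0 n : (n0 <= n)%N -> level_dist n0 n = (n - n0)%N.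
Proof. by rewrite /level_dist; lia. Qed.

Lemma sum_over_levels k J (F : nat -> R) : (forall n, 0 <= F n) ->
  \sum_(m : {ffun 'I_k.+1 -> 'I_J.+1}) F (\sum_i m i)%N <=
  \sum_(n < (k.+1 * J).+1) n.+1%:R ^+ k * F n.
Proof.
move=> F0.
have hn (m : {ffun 'I_k.+1 -> 'I_J.+1}) : (\sum_i m i < (k.+1 * J).+1)%N.
  rewrite ltnS -[X in (_ <= X * _)%N](card_ord k.+1) -sum_nat_const leq_sum// => i _.
  by have := ltn_ord (m i).
rewrite (partition_big (fun m => Ordinal (hn m)) xpredT) //=.
apply: ler_sum => n _.
rewrite (eq_bigr (fun _ => F n)); last by move=> m /eqP <-.
rewrite sumr_const -[_ *+ _]mulr_natl ler_wpM2r// -natrX ler_nat.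
apply: leq_trans (card_level_le k J n); rewrite leq_eqVlt; apply/orP; left; apply/eqP.
by apply: eq_card => m; rewrite [RHS]inE.
Qed.

(** At distance [j] above [n0] the multiplicity is at most that of [n0] times that of [j], which the
    polynomial geometric sum absorbs; below [n0] it is at most [n0.+1%:R ^+ k]. *)
Lemma sum_level_geometric k q : 0 <= q < 1 ->
  exists2 C, 0 < C & forall n0 J,
    \sum_(m : {ffun 'I_k.+1 -> 'I_J.+1}) q ^+ level_dist n0 (\sum_i m i)%N <= C * n0.+1%:R ^+ k.
Proof.
move=> q01; have /andP[q0 q1] := q01.
have [C C0 hC] := polynomial_geometric_sum k q01.
have [D D0 hD] := polynomial_geometric_sum 0 q01.
exists (C + D + 1); first by rewrite ltr_wpDl// addr_ge0.
move=> n0 J; apply: (le_trans (sum_over_levels _ _ (fun n => exprn_ge0 _ q0))).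
set M := (k.+1 * J).+1.
have qe n : 0 <= q ^+ n by exact: exprn_ge0.
have n00 : 0 <= n0.+1%:R ^+ k :> R by exact: exprn_ge0.
rewrite -(big_mkord xpredT (fun n => n.+1%:R ^+ k * q ^+ level_dist n0 n)).
apply: (@le_trans _ _ (\sum_(0 <= n < n0 + M) n.+1%:R ^+ k * q ^+ level_dist n0 n)).
  rewrite [leRHS](big_cat_nat (leq0n M) (leq_addl n0 M)) /= lerDl.
  by apply: sumr_ge0 => n _; rewrite mulr_ge0// exprn_ge0.
rewrite (big_cat_nat (leq0n n0) (leq_addr M n0)) /= addrC.
rewrite (_ : (C + D + 1) * _ = n0.+1%:R ^+ k * C + (n0.+1%:R ^+ k * D + n0.+1%:R ^+ k)); last by ring.
apply: lerD.
  rewrite -[X in \sum_(X <= _ < _) _]add0n big_addn addKn big_mkord.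
  apply: (le_trans _ (ler_wpM2l n00 (hC M))); rewrite mulr_sumr; apply: ler_sum => j _.
  have -> : level_dist n0 (j + n0) = j by rewrite /level_dist; lia.
  rewrite mulrA ler_wpM2r// -exprMn lerXn2r ?nnegrE// -natrM ler_nat; nia.
apply: (@le_trans _ _ (n0.+1%:R ^+ k * D)); last by rewrite lerDl.
apply: (le_trans _ (ler_wpM2l n00 (hD n0.+1))).
rewrite big_ord_recl expr0 mul1r expr0 mulrDr mulr1 mulr_sumr.
rewrite big_nat_rev /= add0n big_mkord -[leLHS]add0r; apply: lerD => //.
apply: ler_sum => j _; rewrite expr0 mul1r.
have -> : level_dist n0 (n0 - j.+1) = j.+1 by have := ltn_ord j; rewrite /level_dist; lia.
apply: ler_wpM2r => //; rewrite lerXn2r ?nnegrE// ler_nat; lia.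
Qed.

(** The critical level [n0] is the integer part of the binary logarithm of [Y], set to 0 when
    [Y < 1], which happens if [psi] is large at [N]. *)
Lemma pow2_bracket Y : exists n0 : nat, [/\ Y < 2 ^+ n0.+1, 1 <= Y -> 2 ^+ n0 <= Y & Y < 1 -> n0 = 0%N].
Proof.
have [Y1|/negP] := pselect (Y < 1).
  exists 0%N; split=> //; first by rewrite expr1 (lt_trans Y1)// ltr1n.
rewrite -leNgt => Y1.
have [T hT] := pow2_unbounded Y.
have ex : exists n, Y < 2 ^+ n by exists T.+1; rewrite (le_lt_trans hT)// exprS ltr_pMl ?ltr1n// exprn_gt0.
case: (ex_minnP ex) => -[|n] hn hmin.
  by move: hn; rewrite expr0 ltNge Y1.
exists n; split=> // [_|Y2]; first by rewrite leNgt; apply/negP => /hmin; rewrite ltnn.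
by have := le_lt_trans Y1 Y2; rewrite ltxx.
Qed.

Lemma level_weight_le1 ip s B X : ip <= s -> s <= B%:R -> 0 < X -> 0 <= level_weight ip s B X <= 1.
Proof.
move=> is_ sB X0; rewrite /level_weight; case: ifPn => X1; rewrite powR_ge0 /=.
  by rewrite -[leRHS](powRr0 X) ler_powR// subr_le0.
apply: (@le_trans _ _ (1 `^ (B%:R - s))); last by rewrite powR1.
apply: ge0_ler_powR; rewrite ?nnegrE ?subr_ge0 ?ler01 ?(ltW X0)//.
by rewrite ltW// ltNge.
Qed.

Lemma powR_invN x X : 0 < X -> X^-1 `^ (- x) = X `^ x.
Proof. by move=> X0; rewrite -[X^-1](powR_inv1 (ltW X0)) -powRrM mulN1r opprK. Qed.

Lemma level_weight_le ip s (B : nat) : ip < s -> s + 1 <= B%:R ->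
  exists2 q, 0 < q < 1 & forall Y n0 n, 0 < Y ->
    Y < 2 ^+ n0.+1 -> (1 <= Y -> 2 ^+ n0 <= Y) -> (Y < 1 -> n0 = 0%N) ->
    level_weight ip s B (2 ^+ n / Y) <= q^-1 * q ^+ level_dist n0 n.
Proof.
move=> is_ sB; pose eta := Num.min (s - ip) 1.
have eta0 : 0 < eta by rewrite lt_min subr_gt0 is_ ltr01.
have [e1 e2] : eta <= s - ip /\ eta <= 1 by rewrite !ge_min !lexx orbT.
pose q : R := 2 `^ (- eta).
have q0 : 0 < q by rewrite powR_gt0.
have q1 : q < 1.
  by rewrite /q /powR gt_eqF// -[ltRHS]expR0 ltr_expR mulNr oppr_lt0 mulr_gt0// ln_gt0// ltr1n.
exists q; first by rewrite q0.
have qX (j : nat) : q ^+ j = (2 ^+ j) `^ (- eta).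
  by rewrite -powR_mulrn ?(ltW q0)// /q -powRrM mulrC powRrM powR_mulrn.
have p2 n : 0 < 2 ^+ n :> R by exact: exprn_gt0.
move=> Y n0 n Y0 hY1 hY2 hY3.
have X0 : 0 < 2 ^+ n / Y by exact: divr_gt0.
have sB' : s <= B%:R by rewrite (le_trans _ sB)// lerDl.
have /andP[_ w1] := level_weight_le1 (ltW is_) sB' X0.
have qi : 1 <= q^-1 by rewrite invf_ge1// ltW.
have expW (e a b : R) : 0 < a -> a <= b -> 0 <= e -> b `^ (- e) <= a `^ (- e).
  move=> a0 ab e0; rewrite !powRN lef_pV2 ?posrE ?powR_gt0//; last exact: lt_le_trans ab.
  by apply: ge0_ler_powR; rewrite ?nnegrE// ltW//; exact: lt_le_trans ab.
have [nn0|nn0] := leqP n n0.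
  rewrite (level_dist_le nn0).
  have [X1|X1] := boolP (1 <= 2 ^+ n / Y).
    have n0n : (n0 <= n)%N.
      have [Y1|/negP] := pselect (Y < 1); first by rewrite (hY3 Y1).
      rewrite -leNgt => /hY2 h; rewrite -(ler_eXn2l (_ : 1 < 2 :> R)) ?ltr1n// (le_trans h)//.
      by move: X1; rewrite ler_pdivlMr// mul1r.
    have -> : (n0 - n)%N = 0%N by apply/eqP; rewrite subn_eq0.
    by rewrite expr0 mulr1 (le_trans w1).
  have Y1 : 1 <= Y.
    rewrite leNgt; apply/negP => Y1; move/negP: X1; apply.
    by rewrite ler_pdivlMr// mul1r (le_trans (ltW Y1))// exprn_ege1// ler1n.
  rewrite /level_weight (negbTE X1) (@le_trans _ _ (q ^+ (n0 - n)))//; last by rewrite ler_peMl// exprn_ge0// ltW.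
  have lX : ln (2 ^+ n / Y) <= 0 by apply: ln_le0; rewrite ltW// ltNge.
  apply: (@le_trans _ _ ((2 ^+ n / Y) `^ eta)).
    rewrite /powR gt_eqF// ler_expR ler_wnM2r//; lra.
  rewrite -(powR_invN eta X0) qX; apply: expW => //; last exact: ltW.
  by rewrite invf_div ler_pdivlMr// -exprD subnK// hY2.
rewrite (level_dist_ge (ltnW nn0)).
have hX : 2 ^+ (n - n0.+1) <= 2 ^+ n / Y.
  by rewrite ler_pdivlMr// -{2}(subnK nn0) exprD ler_pM2l// ltW.
have X1 : 1 <= 2 ^+ n / Y by rewrite (le_trans _ hX)// exprn_ege1// ler1n.
rewrite /level_weight X1.
have -> : q^-1 * q ^+ (n - n0) = q ^+ (n - n0.+1).
  by rewrite -(subnSK nn0) exprS mulKf// gt_eqF.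
apply: (@le_trans _ _ ((2 ^+ n / Y) `^ (- eta))).
  by rewrite ler_powR//; lra.
by rewrite qX; apply: expW => //; exact: ltW.
Qed.

(** The critical level is at most [log2 N] because [Y <= N], and [N >= 2] makes this logarithm at
    least 1, so [n0.+1] is at most twice it. *)
Lemma level_weight_sum k ip s (B : nat) : ip < s -> s + 1 <= B%:R ->
  exists2 C, 0 < C & forall (N J : nat) Y, (2 <= N)%N -> 0 < Y <= N%:R ->
    \sum_(m : {ffun 'I_k.+1 -> 'I_J.+1}) level_weight ip s B (2 ^+ (\sum_i m i)%N / Y) <=
      C * log2 N%:R ^+ k.
Proof.
move=> is_ sB; have [q /andP[q0 q1] hq] := level_weight_le is_ sB.
have [C C0 hC] : exists2 C, 0 < C & forall n0 J,
    \sum_(m : {ffun 'I_k.+1 -> 'I_J.+1}) q ^+ level_dist n0 (\sum_i m i)%N <= C * n0.+1%:R ^+ k.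
  by apply: sum_level_geometric; rewrite q1 ltW.
exists (q^-1 * C * 2 ^+ k); first by rewrite !mulr_gt0 ?invr_gt0// exprn_gt0.
move=> N J Y N2 /andP[Y0 YN]; have [n0 [h1 h2 h3]] := pow2_bracket Y.
apply: (@le_trans _ _ (\sum_(m : {ffun 'I_k.+1 -> 'I_J.+1}) q^-1 * q ^+ level_dist n0 (\sum_i m i)%N)).
  by apply: ler_sum => m _; exact: hq.
have l2 : 0 < ln 2 :> R by rewrite ln_gt0// ltr1n.
have N1 : 1 <= log2 N%:R :> R.
  by rewrite /log2 ler_pdivlMr// mul1r ler_ln ?posrE ?ltr0n ?ler_nat// (leq_trans _ N2).
have n0N : n0%:R <= log2 N%:R :> R.
  have [Y1|/negP] := pselect (Y < 1); first by rewrite (h3 Y1) (le_trans _ N1).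
  rewrite -leNgt => /h2 h; rewrite /log2 ler_pdivlMr// mulr_natl -lnXn// ler_ln ?posrE ?exprn_gt0//.
    exact: le_trans YN.
  by rewrite ltr0n (leq_trans _ N2).
rewrite -mulr_sumr -!mulrA ler_wpM2l ?invr_ge0 ?(ltW q0)//.
apply: (le_trans (hC n0 J)); rewrite ler_wpM2l ?(ltW C0)// -exprMn lerXn2r ?nnegrE//.
  by rewrite mulr_ge0// (le_trans _ N1).
by rewrite -natr1; lra.
Qed.

End level_weights.

(** * Finite families of coefficients extracted from the Besov norm *)

Section besov_coefficients.
Context {R : realType}.

Lemma seq_le_esum (T : choiceType) (s : seq T) (a : T -> \bar R) : uniq s ->
  (\sum_(i <- s) a i <= \esum_(i in [set: T]) a i)%E.
Proof.
move=> us; apply: esum_ge; exists [set` s]; first by split=> //; exact: finite_seq.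
by rewrite -fsbig_seq.
Qed.

Definition nat_ffun d J (m : {ffun 'I_d -> 'I_J}) : {ffun 'I_d -> nat} := [ffun i => (m i : nat)].

Lemma nat_ffun_inj d J : injective (@nat_ffun d J).
Proof.
move=> m m' /ffunP e; apply/ffunP => i; apply: val_inj.
by have := e i; rewrite !ffunE.
Qed.

(** A block of infinite norm would make the Besov norm infinite, so the block norms are real
    numbers; only the levels of a finite box are kept, which turns the extended sum into a finite
    real one. *)
Lemma besov_coefficients d L (Psi0 : R -> R) s (p theta : \bar R) (T : ('rV[R]_d -> R[i]) -> R[i]) J :
  (1 <= theta)%E -> (besov_norm L Psi0 s p theta T <= 1)%E ->
  exists b : {ffun 'I_d -> 'I_J.+1} -> R,
  [/\ forall m, 0 <= b m,
   forall m, (besov_block L Psi0 p T (nat_ffun m) <= (b m)%:E)%E &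
   match theta with
   | t%:E => \sum_(m : {ffun 'I_d -> 'I_J.+1}) (2 `^ (s * (\sum_i m i)%:R) * b m) `^ t <= 1
   | _ => forall m : {ffun 'I_d -> 'I_J.+1}, 2 `^ (s * (\sum_i m i)%:R) * b m <= 1
   end].
Proof.
move=> th1 hnorm.
have bl0 m : (0 <= besov_block L Psi0 p T m)%E by exact: Lnorm_ge0.
have sE (m : {ffun 'I_d -> 'I_J.+1}) : (\sum_i nat_ffun m i)%N = (\sum_i m i)%N.
  by apply: eq_bigr => i _; rewrite ffunE.
have w0 (x : R) : 0 < 2 `^ x :> R by exact: powR_gt0.
exists (fun m => fine (besov_block L Psi0 p T (nat_ffun m))).
case: theta th1 hnorm => [t| |] //.
- rewrite lee_fin => t1 hnorm; have t0 : 0 < t by exact: lt_le_trans t1.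
  pose a (m : {ffun 'I_d -> nat}) := ((2 `^ (s * (\sum_i m i)%:R * t))%:E *
     poweR (besov_block L Psi0 p T m) t)%E.
  have a0 m : (0 <= a m)%E by rewrite mule_ge0 ?lee_fin ?powR_ge0 ?poweR_ge0.
  have hsum : (\esum_(m in [set: {ffun 'I_d -> nat}]) a m <= 1)%E.
    set E := (\esum_(m in _) _)%E; have E0 : (0 <= E)%E by apply: esum_ge0.
    have -> : E = poweR (poweR E t^-1) t by rewrite -poweRrM mulVf ?gt_eqF// poweRe1.
    rewrite -[leRHS](poweR1r t); apply: gt0_ler_poweR; rewrite ?(ltW t0)//.
    - by rewrite in_itv /= leey poweR_ge0.
    - by rewrite in_itv /= leey andbT lee_fin.
  have hfin : (\sum_(m : {ffun 'I_d -> 'I_J.+1}) a (nat_ffun m) <= 1)%E.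
    apply: le_trans hsum.
    have := @seq_le_esum _ (map (@nat_ffun d J.+1) (enum {: {ffun 'I_d -> 'I_J.+1}})) a.
    rewrite map_inj_uniq ?enum_uniq; last exact: nat_ffun_inj.
    by rewrite big_map big_enum => /(_ isT).
  have bfin (m : {ffun 'I_d -> 'I_J.+1}) : besov_block L Psi0 p T (nat_ffun m) \is a fin_num.
    rewrite ge0_fin_numE// ltNge leye_eq; apply/negP => /eqP hb.
    have : (a (nat_ffun m) <= 1)%E.
      apply: le_trans hfin; rewrite (bigD1 m) //= leeDl//; exact: sume_ge0.
    by rewrite /a hb poweRyr ?gt_eqF// gt0_muley ?lte_fin ?w0.
  split=> [m|m|].
  - exact: fine_ge0.
  - by rewrite fineK.
  - rewrite -lee_fin -sumEFin (le_trans _ hfin)//; apply: lee_sum => m _.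
    rewrite /a -(fineK (bfin m)) poweR_EFin -EFinM lee_fin.
    by rewrite sE (powRrM 2 (s * _) t) /= powRM ?powR_ge0 ?fine_ge0.
- move=> _ hnorm.
  have hb (m : {ffun 'I_d -> 'I_J.+1}) :
      ((2 `^ (s * (\sum_i m i)%:R))%:E * besov_block L Psi0 p T (nat_ffun m) <= 1)%E.
    apply: le_trans hnorm; apply: ereal_sup_ubound; exists (nat_ffun m) => //.
    by rewrite sE.
  have bfin (m : {ffun 'I_d -> 'I_J.+1}) : besov_block L Psi0 p T (nat_ffun m) \is a fin_num.
    rewrite ge0_fin_numE// ltNge leye_eq; apply/negP => /eqP e.
    by have := hb m; rewrite e gt0_muley ?lte_fin ?w0.
  split=> [m|m|m].
  - exact: fine_ge0.
  - by rewrite fineK.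
  - by rewrite -lee_fin EFinM fineK.
Qed.

End besov_coefficients.

(** * The worst-case error *)

Section kappa_integral.
Context {R : realType}.
Local Notation mu := (@lebesgue_measure R).
Local Notation nu := (lebesgue_rV R).
Variables (k T : nat) (Phi0 Phi1 : R -> R).
Hypotheses (t0 : tame Phi0) (t1 : tame Phi1).

Let kap N (alpha : 'rV[R]_k) (m : 'I_k.+1 -> nat) (y : 'rV[R]_k.+1) :=
  kappa N T alpha (fun i => dyadic Phi0 Phi1 (m i)) (fun i => y ord0 i).

Let tD j : tame (dyadic Phi0 Phi1 j). Proof. exact: tame_dyadic. Qed.

Lemma tens_reflect_norm_integral d (F : 'I_d -> R -> R) (lam : 'I_d -> R) : (forall i, tame (F i)) ->
  \int[nu d]_y `|tens (fun i t => F i (lam i - t)) y| = \prod_i \int[mu]_t `|F i t|.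
Proof.
move=> tF; have h i : rintegrable mu (fun t => `|F i (lam i - t)|).
  exact: (rintegrable_norm (reflect_tame_integrable lam (tF i))).
transitivity (\int[nu d]_y tens (fun i t => `|F i (lam i - t)|) y).
  by apply: eq_rintegral => y; rewrite /tens normr_prod.
have [_ ->] := tens_integral h; apply: eq_bigr => i _.
have [r _ hr] := tame_csupp (tF i).
have cN : continuous (fun t => `|F i t|) by exact: continuous_normf (tame_continuous (tF i)).
have hN : csupp r (fun t => `|F i t|) by move=> t /hr ->; rewrite normr0.
exact: (cc_reflect (lam i) cN hN).
Qed.

Lemma measurable_kappa N (alpha : 'rV[R]_k) (m : 'I_k.+1 -> nat) : measurable_fun setT (kap N alpha m).
Proof.
apply: measurable_funB => //; apply: measurable_funM => //.
apply: measurable_sum => n; apply: measurable_sum => q.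
have [h _] := tens_reflect_integral (fun i => shifted_node N T alpha n q i) (fun i => tD (m i)).
exact: rintegrable_measurable h.
Qed.

(** The number of nodes is proportional to [N], each product kernel has L_1 norm bounded uniformly
    in the level, and the sum is divided by [N]. The cut-off to a box makes the constant part of
    [kappa] integrable. *)
Lemma kappa_L1 : exists2 C, 0 < C & forall N (alpha : 'rV[R]_k) (m : 'I_k.+1 -> nat), (0 < N)%N ->
  rintegrable (nu k.+1) (fun y => `|kap N alpha m y| * boxf (-1) 2 y) /\
  \int[nu k.+1]_y (`|kap N alpha m y| * boxf (-1) 2 y) <= C.
Proof.
pose D := \int[mu]_t `|Phi0 t| + \int[mu]_t `|Phi1 t|.
have D0 : 0 <= D by rewrite addr_ge0// rintegral_ge0.
have hD j : \int[mu]_t `|dyadic Phi0 Phi1 j t| <= D.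
  rewrite dyadicE rintegral_norm_dil ?exprn_gt0//; last exact: tame_gen.
  by case: j => [|j] /=; rewrite /D ?lerDl ?lerDr rintegral_ge0.
have b12 : (-1 : R) <= 2 by lra.
have [iQ eQ] := @boxf_integral R k.+1 _ _ b12.
exists ((2 * T)%:R * (2 * T + 1)%:R ^+ k * D ^+ k.+1 + D ^+ k.+1 * (2 - -1) ^+ k.+1 + 1).
  by rewrite ltr_wpDl// addr_ge0 ?mulr_ge0 ?exprn_ge0//; lra.
move=> N alpha m N0; have NR : 0 < N%:R :> R by rewrite ltr0n.
pose ph (n : nat) q (y : 'rV[R]_k.+1) := tens (fun i t => dyadic Phi0 Phi1 (m i) (shifted_node N T alpha n q i - t)) y.
have iph n q : rintegrable (nu k.+1) (fun y => `|ph n q y|).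
  by apply: rintegrable_norm; have [] := tens_reflect_integral (fun i => shifted_node N T alpha n q i) (fun i => tD (m i)).
pose A := \prod_i \int[mu]_z dyadic Phi0 Phi1 (m i) z.
have hA : `|A| <= D ^+ k.+1.
  rewrite /A normr_prod; apply: prod_le_expr => i; rewrite normr_ge0 /=.
  by apply: le_trans (hD (m i)); apply: norm_rintegral; exact: tame_integrable.
pose F y := N%:R^-1 * (\sum_(n < 2 * T * N) \sum_q `|ph n q y|) + `|A| * boxf (-1) 2 y.
have iF1 n : rintegrable (nu k.+1) (fun y => \sum_q `|ph n q y|) by apply: rintegrable_sum => q _; exact: iph.
have iF2 : rintegrable (nu k.+1) (fun y => \sum_(n < 2 * T * N) \sum_q `|ph n q y|).
  by apply: rintegrable_sum => n _; exact: iF1.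
have iF3 := rintegrableZ (N%:R^-1) iF2; have iF4 := rintegrableZ `|A| iQ.
have iF : rintegrable (nu k.+1) F by exact: rintegrableD.
have le y : `|kap N alpha m y| * boxf (-1) 2 y <= F y.
  have Q0 := @boxf_ge0 R k.+1 (-1) 2 y; have Q1 := @boxf_le1 R k.+1 (-1) 2 y.
  apply: (@le_trans _ _ ((N%:R^-1 * (\sum_(n < 2 * T * N) \sum_q `|ph n q y|) + `|A|) * boxf (-1) 2 y)).
    apply: ler_wpM2r => //; rewrite /kap /kappa (le_trans (ler_normB _ _))// lerD2r.
    rewrite normrM ger0_norm ?invr_ge0//; apply: ler_wpM2l; first by rewrite invr_ge0.
    by apply: (le_trans (ler_norm_sum _ _ _)); apply: ler_sum => n _; exact: ler_norm_sum.
  rewrite mulrDl /F lerD2r ler_piMr// mulr_ge0 ?invr_ge0//.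
  by apply: sumr_ge0 => n _; apply: sumr_ge0.
have ik : rintegrable (nu k.+1) (fun y => `|kap N alpha m y| * boxf (-1) 2 y).
  apply: rintegrable_le iF _ => [|y]; last by rewrite ger0_norm// mulr_ge0// boxf_ge0.
  apply: measurable_funM; last exact: rintegrable_measurable iQ.
  by apply: measurableT_comp => //; exact: measurable_kappa.
split=> //; apply: (le_trans (le_rintegral ik iF le)).
rewrite /F rintegralD// !rintegralZ// eQ; apply: (@le_trans _ _ ((2 * T)%:R * (2 * T + 1)%:R ^+ k * D ^+ k.+1 + D ^+ k.+1 * (2 - -1) ^+ k.+1)); last by rewrite lerDl.
apply: lerD; last by apply: ler_wpM2r => //; apply: exprn_ge0; lra.
rewrite rintegral_sum; last by move=> n _; exact: iF1.
rewrite mulrC ler_pdivrMr//.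
apply: (@le_trans _ _ (\sum_(n < 2 * T * N) ((2 * T + 1)%:R ^+ k * D ^+ k.+1))).
  apply: ler_sum => n _; rewrite rintegral_sum; last by move=> q _; exact: iph.
  have -> : (2 * T + 1)%:R ^+ k * D ^+ k.+1 = \sum_(q : {ffun 'I_k -> 'I_(2 * T + 1)}) D ^+ k.+1.
    by rewrite sumr_const card_ffun !card_ord -[RHS]mulr_natl natrX.
  apply: ler_sum => q _; rewrite [leLHS](tens_reflect_norm_integral (fun i => shifted_node N T alpha n q i) (fun i => tD (m i))).
  by apply: prod_le_expr => i; rewrite rintegral_ge0 //= hD.
by rewrite sumr_const card_ord -[leLHS]mulr_natl natrM mulrAC !mulrA.
Qed.

(** Above the critical level the L_1 bound of [kap] is interpolated with its supremum bound of order
    1; below it, the supremum bound of order [B] is used on the box [[-1, 2]], of volume 3 to the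
    power [k.+1]. The function [G] stands for the modulus of the complex block, which the Besov norm
    controls, and [g] for its real or imaginary part. *)
Lemma block_kappa_le (B : nat) r (p : \bar R) : 0 <= r -> csupp r Phi0 -> csupp r Phi1 ->
  (0 < B)%N -> r + B%:R + 4 <= T%:R -> (1 <= p)%E ->
  exists2 C, 0 < C & forall N (alpha : 'rV[R]_k) (Y : R) (m : 'I_k.+1 -> nat)
      (g G : 'rV[R]_k.+1 -> R) (b : R),
    (0 < N)%N -> 0 < Y <= N%:R -> resonance_free N alpha Y ->
    rintegrable (nu k.+1) g -> (forall y, g y != 0 -> forall i, -1 <= y ord0 i <= 2) ->
    rintegrable (nu k.+1) G -> (forall y, `|g y| <= G y) -> 0 <= b ->
    (Lnorm (nu k.+1) p (EFin \o G) <= b%:E)%E ->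
    `|\int[nu k.+1]_y (g y * kap N alpha m y)| <=
    C * b * (if 1 <= 2 ^+ (\sum_i m i)%N / Y then (2 ^+ (\sum_i m i)%N / Y) `^ (fine p^-1)
             else (2 ^+ (\sum_i m i)%N / Y) ^+ B).
Proof.
move=> r0 h0 h1 B0 rT p1.
have rT1 : r + 1%:R + 4 <= T%:R.
  by apply: le_trans rT; rewrite lerD2r lerD2l ler_nat.
have [C1' C10' hC1'] := @kappa_bound R k 1 T r Phi0 Phi1 t0 t1 r0 h0 h1 isT rT1.
have [CB CB0 hCB] := @kappa_bound R k B T r Phi0 Phi1 t0 t1 r0 h0 h1 B0 rT.
have [CL CL0 hCL] := kappa_L1.
pose C1 := C1' + 1; have C10 : 0 < C1 by rewrite ltr_wpDl.
have b12 : (-1 : R) <= 2 by lra.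
have [iQ eQ] := @boxf_integral R k.+1 _ _ b12.
pose ip := fine p^-1.
have V0 : 0 < (2 - -1) ^+ k.+1 :> R by apply: exprn_gt0; lra.
exists (C1 `^ ip * CL `^ (1 - ip) + CB * ((2 - -1) ^+ k.+1) `^ (1 - ip)).
  by rewrite ltr_pwDl ?mulr_ge0 ?mulr_gt0 ?powR_gt0// powR_ge0.
move=> N alpha Y m g G b N0 YN res ig gs iG gG b0 hG.
set X := 2 ^+ _ / Y; have /andP[Y0 _] := YN.
have X0 : 0 < X by rewrite divr_gt0// exprn_gt0.
have G0 y : 0 <= G y by exact: le_trans (gG y).
have mG := rintegrable_measurable iG.
have kQ0 y : 0 <= `|kap N alpha m y| * boxf (-1) 2 y by rewrite mulr_ge0// boxf_ge0.
have kapQ y K : (forall z : 'I_k.+1 -> R, (forall i, -1 <= z i <= 2) ->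
      `|kappa N T alpha (fun i => dyadic Phi0 Phi1 (m i)) z| <= K) ->
    0 <= K -> `|kap N alpha m y| * boxf (-1) 2 y <= K * boxf (-1) 2 y.
  move=> hK K0; have [h|[i hi]] : (forall i, -1 <= y ord0 i <= 2) \/ exists i, ~~ (-1 <= y ord0 i <= 2).
    have [h|/existsNP[i /negP hi]] := pselect (forall i, -1 <= y ord0 i <= 2); [by left|by right; exists i].
    by apply: ler_wpM2r; [exact: boxf_ge0|exact: hK].
  by rewrite (boxf0 hi) !mulr0.
have gk y : `|g y * kap N alpha m y| <= G y * (`|kap N alpha m y| * boxf (-1) 2 y).
  have [->|gy] := eqVneq (g y) 0; first by rewrite mul0r normr0 mulr_ge0.
  by rewrite boxf1 ?mulr1 ?normrM; [apply: ler_wpM2r|exact: gs].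
have [iw hw] := hCL N alpha m N0.
have k1 y : `|kap N alpha m y| * boxf (-1) 2 y <= C1 * X * boxf (-1) 2 y.
  apply: kapQ; last by rewrite mulr_ge0 ?(ltW X0) ?(ltW C10).
  move=> z hz; apply: (le_trans (hC1' N alpha Y m z N0 YN res hz)).
  by rewrite -/X expr1 ler_wpM2r ?(ltW X0)// /C1 lerDl.
have iGw : rintegrable (nu k.+1) (fun y => G y * (`|kap N alpha m y| * boxf (-1) 2 y)).
  apply: (rintegrable_le _ (rintegrableZ (C1 * X) iG)) => [|y].
    by apply: measurable_funM => //; exact: rintegrable_measurable iw.
  rewrite normrM (ger0_norm (G0 y)) (ger0_norm (kQ0 y)) [leRHS]mulrC; apply: ler_wpM2l => //.
  apply: (le_trans (k1 y)); rewrite ler_piMr ?boxf_le1// mulr_ge0 ?(ltW X0) ?(ltW C10)//.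
have igk : rintegrable (nu k.+1) (fun y => g y * kap N alpha m y).
  apply: rintegrable_le iGw gk; apply: measurable_funM; first exact: rintegrable_measurable ig.
  exact: measurable_kappa.
apply: (le_trans (norm_rintegral igk)).
apply: (le_trans (le_rintegral (rintegrable_norm igk) iGw gk)).
case: ifPn => X1.
  have wK y : 0 <= `|kap N alpha m y| * boxf (-1) 2 y <= C1 * X.
    rewrite kQ0 /= (le_trans (k1 y))// ler_piMr ?boxf_le1// mulr_ge0 ?(ltW X0) ?(ltW C10)//.
  have := @weighted_hoelder R _ _ (nu k.+1) p G _ b (C1 * X) CL p1 b0 (mulr_gt0 C10 X0) CL0 mG G0 wK iw iGw hw hG.
  move=> /le_trans; apply.
  rewrite (powRM _ (ltW C10) (ltW X0)) -/ip.
  have -> : b * (C1 `^ ip * X `^ ip) * CL `^ (1 - ip) = C1 `^ ip * CL `^ (1 - ip) * b * X `^ ip by ring.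
  apply: ler_wpM2r; first exact: powR_ge0.
  by apply: ler_wpM2r => //; rewrite lerDl mulr_ge0// powR_ge0.
have iGQ : rintegrable (nu k.+1) (fun y => G y * boxf (-1) 2 y).
  apply: rintegrable_le iG _ => [|y].
    by apply: measurable_funM => //; exact: rintegrable_measurable iQ.
  by rewrite normrM (ger0_norm (G0 y)) (ger0_norm (boxf_ge0 _ _ _)) ler_piMr// boxf_le1.
have XB0 : 0 <= CB * X ^+ B by rewrite mulr_ge0// exprn_ge0// ltW.
apply: (@le_trans _ _ (\int[nu k.+1]_y (CB * X ^+ B * (G y * boxf (-1) 2 y)))).
  apply: le_rintegral => //; first exact: rintegrableZ.
  move=> y; rewrite [leRHS]mulrCA; apply: ler_wpM2l => //; apply: kapQ => // z hz.
  exact: hCB.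
rewrite rintegralZ//.
have wK (y : 'rV[R]_k.+1) : 0 <= boxf (-1) 2 y <= 1 by rewrite boxf_ge0 boxf_le1.
have hV : \int[nu k.+1]_y boxf (-1) 2 y <= (2 - -1) ^+ k.+1 by rewrite eQ.
have := @weighted_hoelder R _ _ (nu k.+1) p G _ b 1 _ p1 b0 ltr01 V0 mG G0 wK iQ iGQ hV hG.
rewrite powR1 mulr1 -/ip => /(ler_wpM2l XB0) /le_trans; apply.
have -> : CB * X ^+ B * (b * ((2 - -1) ^+ k.+1) `^ (1 - ip)) = CB * ((2 - -1) ^+ k.+1) `^ (1 - ip) * b * X ^+ B by ring.
apply: ler_wpM2r; first by rewrite exprn_ge0// ltW.
by apply: ler_wpM2r => //; rewrite lerDr mulr_ge0// powR_ge0.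
Qed.

End kappa_integral.

Section worst_case_error.
Context {R : realType}.
Local Notation mu := (@lebesgue_measure R).

Lemma sum_hoelder_ereal (I : finType) (theta : \bar R) (g w : I -> R) (C : R) : (1 <= theta)%E ->
  (forall i, 0 <= g i) -> (forall i, 0 <= w i <= 1) -> 0 < C -> \sum_i w i <= C ->
  match theta with t%:E => is_true (\sum_i g i `^ t <= 1) | _ => forall i, g i <= 1 end ->
  \sum_i g i * w i <= C `^ (1 - fine theta^-1).
Proof.
move=> th1 g0 w01 C0 wC; case: theta th1 => [t| |//]; rewrite ?lee_fin => t1 hg.
  have t0 : t != 0 by rewrite gt_eqF// (lt_le_trans ltr01).
  by rewrite inver (negbTE t0) /=; exact: sum_hoelder.
rewrite invey /= subr0 powRr1; last exact: ltW.
apply: le_trans wC; apply: ler_sum => i _; have /andP[w0 _] := w01 i.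
by rewrite ler_piMl.
Qed.

Lemma level_weight_scale ip s (B n : nat) (Y b : R) : 0 < Y ->
  let X := 2 ^+ n / Y in
  b * (if 1 <= X then X `^ ip else X ^+ B) =
  Y `^ (- s) * (2 `^ (s * n%:R) * b * level_weight ip s B X).
Proof.
move=> Y0 X; have X0 : 0 < X by rewrite divr_gt0// exprn_gt0.
have eX : Y `^ (- s) * 2 `^ (s * n%:R) = X `^ s.
  have := powR_invN (- s) Y0; rewrite opprK => <-.
  rewrite /X powRM ?exprn_ge0 ?invr_ge0 ?(ltW Y0)// mulrC; congr (_ * _).
  by rewrite mulrC powRrM powR_mulrn.
have Xd a : X `^ s * X `^ (a - s) = X `^ a.
  by rewrite -powRD ?(gt_eqF X0) ?implybT// addrC subrK.
transitivity (b * (X `^ s * level_weight ip s B X)); last by rewrite -eX; ring.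
by rewrite /level_weight; case: ifP => _; rewrite Xd// powR_mulrn// ltW.
Qed.

Lemma smooth1_difference (Psi0 : R -> R) : smooth1 Psi0 ->
  smooth1 (fun x => 2 * Psi0 (2 * x) - Psi0 x).
Proof. by move=> sP; apply: smooth1B => //; exact: smooth1_dil. Qed.

Lemma csupp_difference (Psi0 : R -> R) : csupp 1 Psi0 -> csupp 1 (fun x => 2 * Psi0 (2 * x) - Psi0 x).
Proof.
move=> hP x x1; rewrite !hP ?mulr0 ?subr0//.
by rewrite normrM ger0_norm//; lra.
Qed.

Lemma exists_nat_ge (x : R) : exists n : nat, x <= n%:R.
Proof. by exists (Num.bound `|x|); apply: (le_trans (ler_norm x)); apply: ltW; exact: archi_boundP. Qed.

Lemma log2_ge1 (N : nat) : (2 <= N)%N -> 1 <= log2 (N%:R : R).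
Proof.
move=> N2; have l2 : 0 < ln (2 : R) by rewrite ln_gt0// ltr1n.
by rewrite /log2 ler_pdivlMr// mul1r ler_ln ?posrE ?ltr0n ?(ltn_trans _ N2)// ler_nat.
Qed.

(** The dual kernels, their radius, the order [B] and the window [T] are fixed before [N], [alpha],
    [Y] and [f], so the constant depends on none of these. *)
Lemma cubature_component k (p theta : \bar R) (s : R) L (Psi0 : R -> R) :
  (1 <= p)%E -> (1 <= theta)%E -> (p^-1 < s%:E)%E -> is_up_function Psi0 ->
  exists2 C : R, 0 < C & forall (N : nat) (alpha : 'rV[R]_k) (Y : R) (f : 'rV[R]_k.+1 -> R[i])
      (u : 'rV[R]_k.+1 -> R),
    (2 <= N)%N -> 0 < Y <= N%:R -> resonance_free N alpha Y ->
    besov0_unit_ball L Psi0 s p theta f ->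
    (u = (fun z => complex.Re (f z)) \/ u = (fun z => complex.Im (f z))) ->
    `|N%:R^-1 * (\sum_(n < N) u (kronecker alpha n)) - \int[lebesgue_rV R k.+1]_z u z| <=
    C * Y `^ (- s) * log2 N%:R `^ (k%:R * (1 - fine theta^-1)).
Proof.
move=> p1 th1 ps hup.
pose ip := fine p^-1; pose e : R := 1 - fine theta^-1.
have [ip0 ips] : 0 <= ip /\ ip < s.
  have p0 : (0 <= p^-1)%E by rewrite inve_ge0 (le_trans lee01 p1).
  have pf : p^-1%E \is a fin_num by rewrite ge0_fin_numE// (lt_trans ps) ?ltry.
  by split; [exact: fine_ge0|rewrite -lte_fin fineK].
have sP := up_smooth1 hup; have hP := up_csupp hup.
have [Phi0 [Phi1 [chi [t0 t1 tchi [chi1 e0 e1]]]]] := reproducing_pair L sP hP (up_integral hup).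
have tP0 := tame_up hup.
have sD := smooth1_difference sP; have hD := csupp_difference hP.
have tP1 : tame (local_mean1 L Psi0) by exact: tame_derive1n sD hD.
have hP1 : csupp 1 (local_mean1 L Psi0) by exact: csupp_derive1n.
have [r [r0 h0 h1]] : exists r, [/\ 0 <= r, csupp r Phi0 & csupp r Phi1].
  have [ra ra0 ha] := tame_csupp t0; have [rb rb0 hb] := tame_csupp t1.
  exists (ra + rb); split; first exact: addr_ge0.
    by apply: csuppW ha; rewrite lerDl.
  by apply: csuppW hb; rewrite lerDr.
have [B hB] : exists B : nat, s + 1 <= B%:R by exact: exists_nat_ge.
have B0 : (0 < B)%N.
  by case: (B) hB => // h; exfalso; move: h ip0 ips => /=; rewrite mulr0n; lra.
have [T hT] := exists_nat_ge (r + B%:R + 4).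
have T0 : (0 < T)%N.
  case: (T) hT => // h; exfalso; have := ler0n R B; move: (B%:R : R) h r0 => b; lra.
have [CK CK0 hCK] := @block_kappa_le R k T Phi0 Phi1 t0 t1 B r p r0 h0 h1 B0 hT p1.
have [CL CL0 hCL] := @level_weight_sum R k ip s B ips hB.
exists (CK * CL `^ e); first by rewrite mulr_gt0// powR_gt0.
move=> N alpha Y f u N2 YN res [[cRe cIm] [_ hsupp] hnorm] hu.
have N0 : (0 < N)%N by exact: ltn_trans N2.
have /andP[Y0 _] := YN.
have l1 := log2_ge1 N2; have l0 : 0 < log2 (N%:R : R) by exact: lt_le_trans l1.
have cu : continuous u by case: hu => ->.
have van := dsupport_vanish hup (conj cRe cIm) hsupp.
have vanish (v : 'rV[R]_k.+1 -> R) : v = (fun z => complex.Re (f z)) \/ v = (fun z => complex.Im (f z)) ->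
    forall z : 'rV[R]_k.+1, v z != 0 -> forall i, 0 <= z ord0 i <= 1.
  move=> hv z vz; apply: contrapT => nz; move/negP: vz; apply; apply/eqP.
  by have [hr hi] := van z nz; case: hv => ->.
have u0 := vanish u hu.
apply: (@cubature_error_le R k u cu u0 N T alpha Phi0 Phi1 Psi0 (local_mean1 L Psi0) chi 1 _ N0 T0
  t0 t1 tP0 tP1 tchi ler01 hP hP1 chi1 e0 e1) => J.
have [b [b0 hb hg]] := besov_coefficients J th1 hnorm.
pose P (m : {ffun 'I_k.+1 -> 'I_J.+1}) (i : 'I_k.+1) := dyadic Psi0 (local_mean1 L Psi0) (m i).
pose X (m : {ffun 'I_k.+1 -> 'I_J.+1}) : R := 2 ^+ (\sum_i m i)%N / Y.
have one (m : {ffun 'I_k.+1 -> 'I_J.+1}) :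
    `|\int[lebesgue_rV R k.+1]_y (block u (P m) y *
       kappa N T alpha (fun i => dyadic Phi0 Phi1 (m i)) (fun i => y ord0 i))| <=
    CK * Y `^ (- s) * (2 `^ (s * (\sum_i m i)%:R) * b m * level_weight ip s B (X m)).
  pose G y := normc (dconvolution (tensor_mean L Psi0 (nat_ffun m)) (regular_distribution f) y).
  have tP i : tame (P m i) by exact: tame_dyadic.
  have cP i : csupp 1 (P m i).
    rewrite /P; case: (nat_of_ord (m i)) => [|j] //; apply: csuppW (csupp_dil _ hP1); last exact: exprn_gt0.
    by rewrite ler_pdivrMr ?exprn_gt0// mul1r exprn_ege1// ler1n.
  have eP : (fun i => local_mean L Psi0 (nat_ffun m i)) = P m.
    by apply/funext => i; rewrite ffunE local_mean_dyadic.
  have GE y : G y = normc (Complex (block (fun z => complex.Re (f z)) (P m) y)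
      (block (fun z => complex.Im (f z)) (P m) y)) by rewrite /G block_dconvolution eP.
  have bl (v : 'rV[R]_k.+1 -> R) : continuous v -> v = (fun z => complex.Re (f z)) \/ v = (fun z => complex.Im (f z)) ->
      rintegrable (lebesgue_rV R k.+1) (block v (P m)) /\
      forall y : 'rV[R]_k.+1, block v (P m) y != 0 -> forall i, - 1 <= y ord0 i <= 2.
    move=> cv hv; have v0 := vanish v hv.
    have [h _ hs] := @block_integral R k.+1 v (P m) (cube_supported_integrable cv v0) tP 1 ler01 cP v0.
    by split=> // y hy i; have := hs y hy i; rewrite -natr1.
  have [iRe _] := bl _ cRe (or_introl erefl); have [iIm _] := bl _ cIm (or_intror erefl).
  have [iu su] := bl u cu hu.
  have G_le y : G y <= `|block (fun z => complex.Re (f z)) (P m) y| + `|block (fun z => complex.Im (f z)) (P m) y|.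
    by rewrite GE; exact: le_normc_ReIm.
  have iG : rintegrable (lebesgue_rV R k.+1) G.
    apply: (rintegrable_le _ (rintegrableD (rintegrable_norm iRe) (rintegrable_norm iIm))) => [|y].
      rewrite (_ : G = (fun y => Num.sqrt (block (fun z => complex.Re (f z)) (P m) y ^+ 2 +
        block (fun z => complex.Im (f z)) (P m) y ^+ 2))); last by apply/funext => y; rewrite GE.
      apply: measurableT_comp; first by apply: continuous_measurable_fun; exact: sqrt_continuous.
      have mRe := rintegrable_measurable iRe; have mIm := rintegrable_measurable iIm.
      exact: (measurable_funD (measurable_funM mRe mRe) (measurable_funM mIm mIm)).
    rewrite ger0_norm ?G_le//; exact: le_trans (normr_ge0 _) (Re_le_normc _).
  have uG y : `|block u (P m) y| <= G y.
    by rewrite GE; case: hu => ->; [exact: (Re_le_normc (Complex _ _))|exact: (Im_le_normc (Complex _ _))].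
  have := hCK N alpha Y (fun i => m i) (block u (P m)) G (b m) N0 YN res iu su iG uG (b0 m) (hb m).
  move=> /le_trans; apply; rewrite le_eqVlt; apply/orP; left; apply/eqP.
  rewrite -[LHS]mulrA -[RHS]mulrA; congr (CK * _); exact: level_weight_scale.
apply: (le_trans (ler_norm_sum _ _ _)); apply: (le_trans (ler_sum _ (fun m _ => one m))).
rewrite -mulr_sumr.
have -> : CK * CL `^ e * Y `^ (- s) * log2 N%:R `^ (k%:R * e) = CK * Y `^ (- s) * (CL * log2 N%:R ^+ k) `^ e.
  rewrite (powRrM (log2 N%:R) k%:R e) powR_mulrn; last exact: ltW.
  rewrite powRM; [ring|exact: ltW|exact/exprn_ge0/ltW].
apply: ler_wpM2l; first by rewrite mulr_ge0 ?powR_ge0// ltW.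
apply: sum_hoelder_ereal => //.
- by move=> m; rewrite mulr_ge0// powR_ge0.
- move=> m; apply: level_weight_le1; [exact: ltW| |by rewrite divr_gt0// exprn_gt0].
  by move: hB; move: (B%:R : R) => x; lra.
- by rewrite mulr_gt0// exprn_gt0.
- exact: hCL.
Qed.

Lemma kronecker_wce_le k (p theta : \bar R) (s : R) L (Psi0 : R -> R) :
  (1 <= p)%E -> (1 <= theta)%E -> (p^-1 < s%:E)%E -> is_up_function Psi0 ->
  exists2 C : R, 0 < C & forall (N : nat) (alpha : 'rV[R]_k) (Y : R),
    (2 <= N)%N -> 0 < Y <= N%:R -> resonance_free N alpha Y ->
    (wce (@kronecker R k alpha N) (besov0_unit_ball L Psi0 s p theta) <=
     (C * Y `^ (- s) * log2 N%:R `^ (k%:R * (1 - fine theta^-1)))%:E)%E.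
Proof.
move=> p1 th1 ps hup; have [C C0 hC] := cubature_component k L p1 th1 ps hup.
(* The factor 2 adds the real and the imaginary part. *)
exists (2 * C) => [|N alpha Y N2 YN res]; first by rewrite mulr_gt0.
apply: ge_ereal_sup => _ [f hf <-]; rewrite lee_fin.
have [[cRe cIm] [_ hsupp] _] := hf.
have van := dsupport_vanish hup (conj cRe cIm) hsupp.
have restrict (u : 'rV[R]_k.+1 -> R) : (forall x, ~ unit_cube x -> u x = 0) ->
    \int[lebesgue_rV R k.+1]_(x in unit_cube) u x = \int[lebesgue_rV R k.+1]_x u x.
  move=> hu; rewrite /Rintegral [X in fine X = _]integral_mkcond; congr fine.
  apply: eq_integral => x _; rewrite /patch; case: ifPn => //; rewrite notin_setE => nx.
  by rewrite hu.
have hRe := hC N alpha Y f _ N2 YN res hf (or_introl erefl).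
have hIm := hC N alpha Y f _ N2 YN res hf (or_intror erefl).
set E := C * _ * _ in hRe hIm.
apply: (@le_trans _ _ (E + E)); last by rewrite -[leRHS]mulrA -[leRHS]mulrA -mulr2n mulr_natl /E mulrA.
have eRe : complex.Re (Cintegral (lebesgue_rV R k.+1) unit_cube f -
    N%:R^-1 * \sum_(n < N) f (kronecker alpha n)) =
    - (N%:R^-1 * (\sum_(n < N) complex.Re (f (kronecker alpha n))) -
       \int[lebesgue_rV R k.+1]_z complex.Re (f z)).
  rewrite opprB -(rmorph_nat (real_complex R)) -(fmorphV (real_complex R)) mulrC -Re_sum.
  rewrite -restrict; last by move=> x /van[].
  by rewrite -[RHS]/(_ - _) [in RHS]mulrC -Re_mulr_real; case: (_ * _).
have eIm : complex.Im (Cintegral (lebesgue_rV R k.+1) unit_cube f -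
    N%:R^-1 * \sum_(n < N) f (kronecker alpha n)) =
    - (N%:R^-1 * (\sum_(n < N) complex.Im (f (kronecker alpha n))) -
       \int[lebesgue_rV R k.+1]_z complex.Im (f z)).
  rewrite opprB -(rmorph_nat (real_complex R)) -(fmorphV (real_complex R)) mulrC -Im_sum.
  rewrite -restrict; last by move=> x /van[].
  by rewrite -[RHS]/(_ - _) [in RHS]mulrC -Im_mulr_real; case: (_ * _).
apply: (le_trans (le_normc_ReIm _)); rewrite eRe eIm !normrN.
exact: lerD.
Qed.

Lemma kronecker_wce_ae k (p theta : \bar R) (s : R) L (Psi0 : R -> R) (psi : nat -> R) :
  (1 <= p)%E -> (1 <= theta)%E -> (p^-1 < s%:E)%E -> is_up_function Psi0 ->
  (forall n, (1 <= n)%N -> 0 < psi n) ->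
  (forall m n, (1 <= m)%N -> (m <= n)%N -> psi m <= psi n) ->
  (\sum_(1 <= n <oo) (1 / (n%:R * psi n))%:E < +oo)%E ->
  {ae lebesgue_rV R k, forall alpha : 'rV[R]_k,
    exists C : R, forall N : nat, (2 <= N)%N ->
      (wce (@kronecker R k alpha N) (besov0_unit_ball L Psi0 s p theta) <=
       (C * (log2 N%:R `^ (k%:R * (1 - fine theta^-1)) / N%:R `^ s) *
          psi N `^ (s * k%:R))%:E)%E}.
Proof.
move=> p1 th1 ps hup psi0 psim hsum.
have [C C0 hC] := kronecker_wce_le k L p1 th1 ps hup.
have := @diophantine_ae R psi k psi0 hsum; apply: filterS => alpha [c c0 hc].
(* Lowering the Diophantine constant keeps the inequality valid and ensures that the critical size
   [Y] does not exceed [N]. *)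
pose c' := Num.min c (psi 1%N ^+ k).
have c'0 : 0 < c' by rewrite lt_min c0 exprn_gt0 ?psi0.
exists (C * c' `^ (- s)) => N N2; have N0 : (0 < N)%N by exact: ltn_trans N2.
have dioph (h : 'I_k -> int) : (exists i, h i != 0) -> forall q : int,
    c' * res_weight psi h <= `|dot h alpha - q%:~R|.
  move=> h0 q; apply: le_trans (hc h h0 q); apply: ler_wpM2r; last by rewrite ge_min lexx.
  by apply: ltW; exact: res_weight_gt0.
have c'1 : 0 < c' <= psi 1%N ^+ k by rewrite c'0 ge_min lexx orbT.
have [YN res] := resonance_free_of_diophantine psi0 psim c'1 N0 dioph.
apply: (le_trans (hC N alpha _ N2 YN res)); rewrite lee_fin.
have pN := psi0 N N0; have NR : 0 < N%:R :> R by rewrite ltr0n.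
rewrite le_eqVlt; apply/orP; left; apply/eqP.
have -> : (c' * N%:R / psi N ^+ k) `^ (- s) = c' `^ (- s) * (N%:R `^ s)^-1 * psi N `^ (s * k%:R).
  rewrite powRM ?powRM ?mulr_ge0 ?invr_ge0 ?exprn_ge0 ?(ltW c'0) ?(ltW pN)//.
  rewrite powRN; congr (_ * _); first by rewrite powRN.
  rewrite [s * _]mulrC powRrM powR_mulrn ?(ltW pN)//.
  have := powR_invN s (exprn_gt0 k pN); exact.
ring.
Qed.

End worst_case_error.

(** * The iterated logarithm as an admissible weight *)

Section loglog.
Context {R : realType}.

Definition antitone_pos (a : nat -> R) := forall m n, (1 <= m)%N -> (m <= n)%N -> 0 <= a n <= a m.

Lemma condensation (a : nat -> R) (J : nat) : antitone_pos a ->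
  \sum_(1 <= n < 2 ^ J) a n <= \sum_(j < J) 2 ^+ j * a (2 ^ j)%N.
Proof.
move=> ha; elim: J => [|J IH]; first by rewrite expn0 big_geq// big_ord0.
have e1 : (1 <= 2 ^ J)%N by rewrite expn_gt0.
have e2 : (2 ^ J <= 2 ^ J.+1)%N by rewrite leq_exp2l.
rewrite big_ord_recr /= (@big_cat_nat _ _ _ (2 ^ J)%N) //=; apply: lerD IH _.
apply: (@le_trans _ _ (\sum_(2 ^ J <= n < 2 ^ J.+1) a (2 ^ J)%N)).
  by rewrite !big_nat; apply: ler_sum => n /andP[hn _]; have /andP[_] := ha _ _ e1 hn.
rewrite sumr_const_nat expnS mul2n -addnn addnK -[leLHS]mulr_natl natrX; exact: lexx.
Qed.

Lemma condensation_bound (a : nat -> R) (K : R) : antitone_pos a ->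
  (forall J, \sum_(j < J) 2 ^+ j * a (2 ^ j)%N <= K) -> forall n, \sum_(1 <= m < n) a m <= K.
Proof.
move=> ha hK n; apply: le_trans (hK n); apply: le_trans (condensation n ha).
case: n => [|n]; first by rewrite expn0 !big_geq.
have hn : (n.+1 <= 2 ^ n.+1)%N by apply: ltnW; exact: ltn_expl.
rewrite [leRHS](@big_cat_nat _ _ _ n.+1) //= lerDl big_nat; apply: sumr_ge0 => m /andP[hm _].
by have /andP[] := ha m m (leq_trans (ltn0Sn n) hm) (leqnn m).
Qed.

Lemma sum_ord_nat1 (F : nat -> R) n : (forall j, 0 <= F j) ->
  \sum_(j < n) F j <= F 0%N + \sum_(1 <= j < n) F j.
Proof.
move=> F0; rewrite -(big_mkord predT F); case: n => [|n]; last by rewrite big_ltn.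
by rewrite !big_geq// addr0.
Qed.

Lemma powR_series_bounded (delta : R) : 0 < delta ->
  exists K : R, forall n, \sum_(1 <= m < n) (m%:R `^ (1 + delta))^-1 <= K.
Proof.
move=> d0; pose q := 2 `^ (- delta) : R.
have q0 : 0 < q by exact: powR_gt0.
have q1 : q < 1.
  rewrite /q powRN invf_lt1 ?powR_gt0//.
  have := @gt0_ltr_powR R delta d0 1 2; rewrite !nnegrE powR1; apply => //; exact: ltr1n.
exists (1 - q)^-1; apply: condensation_bound => [m n m1 mn|J].
  have mR : 0 < m%:R :> R by rewrite ltr0n.
  have nR : 0 < n%:R :> R by rewrite ltr0n (leq_trans m1).
  rewrite invr_ge0 powR_ge0 /= lef_pV2 ?posrE ?powR_gt0//.
  by apply: ge0_ler_powR; rewrite ?nnegrE ?ler_nat ?ler0n//; lra.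
have e (j : nat) : 2 ^+ j * (((2 ^ j)%N%:R : R) `^ (1 + delta))^-1 = q ^+ j.
  rewrite natrX -(powR_mulrn j (ler0n R 2)) -powRrM -powRN -powRD ?pnatr_eq0 ?implybT//.
  rewrite /q -powR_mulrn ?powR_ge0// -powRrM; congr (_ `^ _); ring.
under eq_bigr do rewrite e.
have := subrX1 q J; rewrite -opprB -[X in _ = X * _]opprB mulNr => /oppr_inj h.
rewrite -[leRHS]mulr1 ler_pdivlMl; last by rewrite subr_gt0.
by rewrite -h gerBl exprn_ge0// ltW.
Qed.

(* The maximum keeps [log2 (llog n)] positive. *)
Definition llog (n : nat) : R := log2 (maxn n 3)%:R.
Definition loglog_weight (delta : R) (n : nat) : R := llog n * log2 (llog n) `^ (1 + delta).

Let ln2 : 0 < ln (2 : R). Proof. by rewrite ln_gt0// ltr1n. Qed.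

Lemma log2_le (x y : R) : 0 < x -> x <= y -> log2 x <= log2 y.
Proof.
move=> x0 xy; rewrite /log2 ler_pM2r ?invr_gt0// ler_ln ?posrE//.
exact: lt_le_trans xy.
Qed.

Lemma log2_pow n : log2 (2 ^+ n : R) = n%:R.
Proof. by rewrite /log2 lnXn// -[ln 2 *+ n]mulr_natl mulfK// gt_eqF. Qed.

Lemma log2_gt0 (x : R) : 1 < x -> 0 < log2 x.
Proof. by move=> x1; rewrite /log2 divr_gt0// ln_gt0. Qed.

Lemma llog_gt1 n : 1 < llog n.
Proof.
have l23 : 1 < log2 (3 : R) by rewrite /log2 ltr_pdivlMr// mul1r ltr_ln ?posrE// ltr_nat.
by apply: (lt_le_trans l23); apply: log2_le; rewrite ?ler_nat ?leq_maxr.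
Qed.

Lemma llog_le m n : (m <= n)%N -> llog m <= llog n.
Proof.
move=> mn; apply: log2_le; first by rewrite ltr0n leq_max orbT.
by rewrite ler_nat geq_max leq_maxr andbT (leq_trans mn)// leq_maxl.
Qed.

Variable delta : R.
Hypothesis delta0 : 0 < delta.

Lemma loglog_weight_gt0 n : 0 < loglog_weight delta n.
Proof.
have h := llog_gt1 n; apply: mulr_gt0; first exact: lt_trans h.
exact/powR_gt0/log2_gt0.
Qed.

Lemma loglog_weight_le m n : (m <= n)%N -> loglog_weight delta m <= loglog_weight delta n.
Proof.
move=> mn; have h := llog_gt1 m; have h' := llog_gt1 n; have hl := llog_le mn.
have m0 : 0 < llog m by exact: lt_trans h.
apply: ler_pM => //; [exact: ltW|exact: powR_ge0|].
apply: ge0_ler_powR; [by move: delta0; lra| | |exact: log2_le].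
  by rewrite nnegrE; exact/ltW/log2_gt0.
by rewrite nnegrE; exact/ltW/log2_gt0.
Qed.

Lemma loglog_weight_pow2 i : (1 <= i)%N -> loglog_weight delta (2 ^ 2 ^ i) = 2 ^+ i * i%:R `^ (1 + delta).
Proof.
move=> i1; have h : llog (2 ^ 2 ^ i) = 2 ^+ i.
  rewrite /llog (maxn_idPl _); last first.
    apply: (@leq_trans (2 ^ 2 ^ 1)) => //; rewrite leq_exp2l//.
    by rewrite leq_exp2l.
  by rewrite natrX log2_pow natrX.
by rewrite /loglog_weight h log2_pow.
Qed.

Lemma antitone_inv (c : nat -> R) : (forall n, 0 < c n) ->
  (forall m n, (m <= n)%N -> c m <= c n) -> antitone_pos (fun n => (c n)^-1).
Proof. by move=> c0 cm m n _ mn; rewrite invr_ge0 ltW//= lef_pV2 ?posrE// cm. Qed.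

(** Two condensations: the first cancels the factor [m] and leaves the inverse weight at powers of
    2, the second reduces to the series of exponent [1 + delta]. The initial term of each is kept
    apart, because the explicit value at [2 ^ 2 ^ i] requires [i >= 1]. *)
Lemma loglog_weight_bounded : exists K : R, forall n,
  \sum_(1 <= m < n) (m%:R * loglog_weight delta m)^-1 <= K.
Proof.
pose psi := loglog_weight delta; have p0 n : 0 < psi n by exact: loglog_weight_gt0.
pose b j := (psi (2 ^ j)%N)^-1.
have b0 j : 0 <= b j by rewrite invr_ge0 ltW.
have [K hK] := powR_series_bounded delta0.
have hb : antitone_pos b.
  apply: antitone_inv => [j|m n mn]; [exact: p0|apply: loglog_weight_le].
  by rewrite leq_exp2l.
have ha : antitone_pos (fun m => (m%:R * psi m)^-1).
  move=> m n m1 mn; have n1 := leq_trans m1 mn.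
  have q0 (j : nat) : (1 <= j)%N -> 0 < j%:R * psi j.
    by move=> j1; apply: mulr_gt0; [rewrite ltr0n|exact: p0].
  rewrite invr_ge0 (ltW (q0 _ n1)) /= lef_pV2 ?posrE; [|exact: q0|exact: q0].
  apply: ler_pM; [exact: ler0n|exact/ltW/p0|by rewrite ler_nat|exact: loglog_weight_le].
exists (b 0%N + (b 1%N + K)); apply: condensation_bound => [//|J].
have eb j : 2 ^+ j * ((2 ^ j)%N%:R * psi (2 ^ j)%N)^-1 = b j.
  by rewrite natrX invfM mulrA mulfV ?mul1r// expf_neq0// pnatr_eq0.
under eq_bigr do rewrite eb.
apply: (le_trans (sum_ord_nat1 J b0)); rewrite lerD2l.
apply: condensation_bound => [//|I].
have h0 j : 0 <= 2 ^+ j * b (2 ^ j)%N by rewrite mulr_ge0// exprn_ge0.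
apply: (le_trans (sum_ord_nat1 I h0)); rewrite expr0 mul1r expn0 lerD2l.
apply: le_trans (hK I); rewrite !big_nat; apply: ler_sum => i /andP[i1 _].
by rewrite /b /psi loglog_weight_pow2// invfM mulrA mulfV ?mul1r// expf_neq0// pnatr_eq0.
Qed.

Lemma loglog_weight_summable :
  (\sum_(1 <= n <oo) (1 / (n%:R * loglog_weight delta n))%:E < +oo)%E.
Proof.
have [K hK] := loglog_weight_bounded.
have h0 n : (0 <= (1 / (n%:R * loglog_weight delta n))%:E)%E.
  by rewrite lee_fin mul1r invr_ge0 mulr_ge0// ltW// loglog_weight_gt0.
apply: (@le_lt_trans _ _ K%:E); last exact: ltry.
apply: lime_le; first by apply: is_cvg_nneseries.
apply: nearW => n; rewrite sumEFin lee_fin.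
by under eq_bigr do rewrite mul1r.
Qed.

End loglog.

Theorem theorem19 (R : realType) (k : nat) (hd : (3 <= k.+1)%N)
    (p theta : \bar R) (hp : (1 <= p)%E) (htheta : (1 <= theta)%E)
    (s : R) (hs : (p^-1 < s%:E)%E)
    (L : nat) (hL : s < (L + 1)%:R)
    (Psi0 : R -> R) (hPsi0 : is_up_function Psi0) :
  (forall psi : nat -> R,
     (forall n, (1 <= n)%N -> 0 < psi n) ->
     (forall m n, (1 <= m)%N -> (m <= n)%N -> psi m <= psi n) ->
     (\sum_(1 <= n <oo) (1 / (n%:R * psi n))%:E < +oo)%E ->
     {ae lebesgue_rV R k, forall alpha : 'rV[R]_k,
       exists C : R, forall N : nat, (2 <= N)%N ->
         (wce (@kronecker R k alpha N) (besov0_unit_ball L Psi0 s p theta) <=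
          (C * (log2 N%:R `^ (k%:R * (1 - fine theta^-1)) / N%:R `^ s) *
             psi N `^ (s * k%:R))%:E)%E}) /\
  (forall delta : R, 0 < delta ->
     {ae lebesgue_rV R k, forall alpha : 'rV[R]_k,
       exists C : R, forall N : nat, (3 <= N)%N ->
         (wce (@kronecker R k alpha N) (besov0_unit_ball L Psi0 s p theta) <=
          (C * (log2 N%:R `^ (k%:R * (s + 1 - fine theta^-1)) / N%:R `^ s) *
             log2 (log2 N%:R) `^ (s * k%:R * (1 + delta)))%:E)%E}).
Proof.
split=> [psi psi0 psim hsum|delta d0]; first exact: kronecker_wce_ae.
have := @kronecker_wce_ae R k p theta s L Psi0 (loglog_weight delta) hp htheta hs hPsi0
  (fun n _ => loglog_weight_gt0 delta n) (fun m n _ => @loglog_weight_le R delta d0 m n) (loglog_weight_summable d0).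
apply: filterS => alpha [C hC]; exists C => N N3.
apply: (le_trans (hC N (ltnW N3))); rewrite lee_fin le_eqVlt; apply/orP; left; apply/eqP.
(* The condition [3 <= N] makes the maximum in [llog] equal to [N]; the outer logarithm of the
   weight then supplies the additional exponent [s * k]. *)
have lN : llog N = log2 (N%:R : R) by rewrite /llog (maxn_idPl N3).
have l1 : 1 < log2 (N%:R : R) by rewrite -lN llog_gt1.
have l0 : 0 < log2 (N%:R : R) by exact: lt_trans l1.
rewrite /loglog_weight lN powRM ?powR_ge0 ?(ltW l0)// -powRrM.
have -> : (k%:R * (s + 1 - fine theta^-1) : R) = k%:R * (1 - fine theta^-1) + s * k%:R by ring.
rewrite (powRD (x := log2 N%:R)) ?(gt_eqF l0) ?implybT// [(1 + delta) * _]mulrC; ring.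
Qed.
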